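(* Let $d\ge 1$ and $\alpha>0$. The operator $H_{\mathrm{par}}^{-\alpha}$ has an integral representation $$H_{\mathrm{par}}^{-\alpha} f(z)=\int_{\mathbb R^{d+1}}K_\alpha(z,z')f(z')\,dz'$$ for all $f\in C_0^\infty(\mathbb R^{d+1})$. Moreover, there exist a function $\Psi_\alpha\in L^1(\mathbb R^{d+1})$ and a constant $C>0$ such that $$K_\alpha(z,z')\le C\,\Psi_\alpha(z-z')\quad\text{for all } z,z'\in\mathbb R^{d+1}.$$ Hence $H_{\mathrm{par}}^{-\alpha}$ is well defined and bounded on $L^p(\mathbb R^{d+1})$ for every $p\in[1,+\infty]$.
   Context: Write $z=(\rho,x)\in\mathbb R\times\mathbb R^d$. The partial harmonic oscillator is $H_{\mathrm{par}}=-\partial_\rho^2-\Delta_x+|x|^2$ on $\mathbb R^{d+1}$. Let $\mathcal F_\rho f(\tau,x)=(2\pi)^{-1/2}\int_{\mathbb R}e^{-i\rho\tau}f(\rho,x)\,d\rho$, and let $P_k$ be the spectral projection (acting in $x$) of $-\Delta_x+|x|^2$ on $L^2(\mathbb R^d)$ onto the eigenspace with eigenvalue $2k+d$, $k=0,1,2,\dots$. For $\alpha\in\mathbb R$ and $f\in C_0^\infty(\mathbb R^{d+1})$, $$H_{\mathrm{par}}^{\alpha}f(\rho,x)=\sum_{k=0}^\infty\frac1{\sqrt{2\pi}}\int_{\mathbb R}e^{i\rho\tau}(\tau^2+2k+d)^{\alpha}\,P_k(\mathcal F_\rho f)(\tau,x)\,d\tau .$$ For $\alpha>0$, equivalently $H_{\mathrm{par}}^{-\alpha}f=\frac1{\Gamma(\alpha)}\int_0^\infty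 t^{\alpha-1}e^{-tH_{\mathrm{par}}}f\,dt$, so that $K_\alpha(z,z')=\frac1{\Gamma(\alpha)}\int_0^\infty t^{\alpha-1}E(t,z,z')\,dt>0$, where $E$ is the heat kernel, i.e. the integral kernel of $e^{-tH_{\mathrm{par}}}$: $$E(t,z,z')=2^{-\frac{d+2}2}\pi^{-\frac{d+1}2}t^{-1/2}(\sinh 2t)^{-d/2}e^{-B(t,z,z')},$$ $$B(t,z,z')=\tfrac14(2\coth 2t-\tanh t)|x-x'|^2+\tfrac{\tanh t}{4}|x+x'|^2+\tfrac{(\rho-\rho')^2}{4t}.$$ *)

(* Defs.v *)
From HB Require Import structures.
From mathcomp Require Import all_boot all_order all_algebra.
From mathcomp Require Import complex.
From mathcomp Require Import all_classical all_reals all_analysis.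

Set Implicit Arguments.
Unset Strict Implicit.
Unset Printing Implicit Defensive.

Import Order.TTheory GRing.Theory Num.Theory.
Import numFieldNormedType.Exports.

Local Open Scope classical_set_scope.
Local Open Scope ring_scope.
Local Open Scope complex_scope.

Definition rV_display : measure_display -> measure_display.
Proof. exact. Qed.

Section rV_measurable.
Context {disp : measure_display} {T : sigmaRingType disp} (n : nat).

Let coor (i : 'I_n) (x : 'rV[T]_n) : T := x ord0 i.

Let rV_set0 : g_sigma_preimage coor set0.
Proof. exact: sigma_algebra0. Qed.

Let rV_setC A : g_sigma_preimage coor A -> g_sigma_preimage coor (~` A).
Proof. exact: sigma_algebraC. Qed.

Let rV_bigcup (F : (set 'rV[T]_n)^nat) :
  (forall i, g_sigma_preimage coor (F i)) ->
  g_sigma_preimage coor (\bigcup_i F i).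
Proof. exact: sigma_algebra_bigcup. Qed.

HB.instance Definition _ := @isMeasurable.Build (rV_display disp)
  'rV[T]_n (g_sigma_preimage coor) rV_set0 rV_setC rV_bigcup.

End rV_measurable.

Lemma measurable_coord {disp : measure_display} {T : sigmaRingType disp} n
    (i : 'I_n) :
  measurable_fun [set: 'rV[T]_n] (fun x : 'rV[T]_n => x ord0 i).
Proof.
move=> _ Y mY; rewrite setTI; apply: sub_sigma_algebra => /=.
rewrite -bigcup_seq/=; exists i => /=; first by rewrite mem_index_enum.
by exists Y => //; rewrite setTI.
Qed.

Lemma measurable_fun_rV {disp disp' : measure_display}
    {T : sigmaRingType disp} {S : measurableType disp'} n (f : S -> 'rV[T]_n) :
  (forall i, measurable_fun [set: S] (fun s => f s ord0 i)) ->
  measurable_fun [set: S] f.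
Proof.
move=> mf _ A mA; rewrite setTI.
have {mA} : (image_set_system setT f measurable) A.
  apply: mA; split; first exact/sigma_algebra_image/sigma_algebra_measurable.
  move=> B; rewrite -bigcup_seq => -[i _ [C mC <-]].
  rewrite /image_set_system /= !setTI -[X in measurable X]setTI.
  exact: mf.
by rewrite /image_set_system /= setTI.
Qed.

(* The library's canonical sigma-finite structure on [\x] only covers factors
   that are subprobabilities. *)
Lemma sigma_finite_prod d1 d2 (T1 : measurableType d1) (T2 : measurableType d2)
    (R : realType) (m1 : {sigma_finite_measure set T1 -> \bar R})
    (m2 : {sigma_finite_measure set T2 -> \bar R}) :
  sigma_finite setT (m1 \x m2)%E.
Proof.
have /sigma_finiteP[F [TF ndF Foo]] := sigma_finiteT m1.
have /sigma_finiteP[G [TG ndG Goo]] := sigma_finiteT m2.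
exists (fun n => F n `*` G n).
  rewrite -setXTT TF TG predeqE => -[x y]; split.
    move=> [/= [n _ Fnx] [k _ Gky]]; exists (maxn n k) => //; split.
    - by move: x Fnx; exact/subsetPset/ndF/leq_maxl.
    - by move: y Gky; exact/subsetPset/ndG/leq_maxr.
  by move=> [n _ []/= ? ?]; split; exists n.
move=> k; have [? ?] := Foo k; have [? ?] := Goo k.
split; first exact: measurableX.
by rewrite product_measure1E// lte_mul_pinfty// ge0_fin_numE.
Qed.

Section lebesgue_rV.
Variable R : realType.

Definition rV_cons n (z : measurableTypeR R * 'rV[R]_n) : 'rV[R]_n.+1 :=
  row_mx (const_mx z.1 : 'rV_1) z.2.

Lemma rV_cons0 n (z : measurableTypeR R * 'rV[R]_n) : rV_cons z ord0 ord0 = z.1.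
Proof.
rewrite /rV_cons mxE; case: splitP => j; first by rewrite mxE.
by [].
Qed.

Lemma rV_consS n (z : measurableTypeR R * 'rV[R]_n) (i : 'I_n) :
  rV_cons z ord0 (lift ord0 i) = z.2 ord0 i.
Proof.
rewrite /rV_cons mxE; case: splitP => [[[]//]|j] /= ij.
by congr (z.2 _ _); apply/val_inj => /=; move: ij; rewrite /bump /= => -[].
Qed.

Definition rV_uncons n (x : 'rV[R]_n.+1) : measurableTypeR R * 'rV[R]_n :=
  (x ord0 ord0, \row_j x ord0 (lift ord0 j)).

Lemma rV_consK n : cancel (@rV_cons n) (@rV_uncons n).
Proof.
move=> [a x]; rewrite /rV_uncons rV_cons0; congr pair.
by apply/rowP => j; rewrite mxE rV_consS.
Qed.

Lemma rV_unconsK n : cancel (@rV_uncons n) (@rV_cons n).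
Proof.
move=> x; apply/rowP => i.
by case: (unliftP ord0 i) => [j|] ->; rewrite ?rV_consS ?rV_cons0 ?mxE.
Qed.

Lemma measurable_rV_cons n : measurable_fun setT (@rV_cons n).
Proof.
apply: measurable_fun_rV => i; case: (unliftP ord0 i) => [j|] ->.
  rewrite (_ : (fun _ => _) = (fun x : 'rV[R]_n => x ord0 j) \o snd).
    by apply: measurableT_comp => //; exact: measurable_coord.
  by apply/funext => z; rewrite rV_consS.
rewrite (_ : (fun _ => _) = fst) //.
by apply/funext => z; rewrite rV_cons0.
Qed.

Lemma measurable_rV_uncons n : measurable_fun setT (@rV_uncons n).
Proof.
apply/measurable_fun_pairP; split; first exact: measurable_coord.
apply: measurable_fun_rV => i /=.
rewrite (_ : (fun _ => _) = fun x : 'rV[R]_n.+1 => x ord0 (lift ord0 i)).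
  exact: measurable_coord.
by apply/funext => x; rewrite /= mxE.
Qed.

Section step.
Variables (n : nat) (m : {sigma_finite_measure set 'rV[R]_n -> \bar R}).

Definition lebesgue_rV_step : set 'rV[R]_n.+1 -> \bar R :=
  pushforward (@lebesgue_measure R \x m)%E (@rV_cons n).

Let step0 : lebesgue_rV_step set0 = 0%E.
Proof. by rewrite /lebesgue_rV_step /pushforward preimage_set0 measure0. Qed.

Let step_ge0 A : (0 <= lebesgue_rV_step A)%E.
Proof. by rewrite /lebesgue_rV_step /pushforward measure_ge0. Qed.

Let step_sigma_additive : semi_sigma_additive lebesgue_rV_step.
Proof.
have mp A : measurable A -> measurable (@rV_cons n @^-1` A).
  by move=> mA; rewrite -[X in measurable X]setTI; exact: measurable_rV_cons.
move=> F mF tF mUF; rewrite /lebesgue_rV_step /pushforward preimage_bigcup.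
apply: measure_semi_sigma_additive => [k||]; first exact: mp.
- apply/trivIsetP => /= i j _ _ ij; rewrite -preimage_setI.
  by move/trivIsetP : tF => /(_ _ _ _ _ ij) ->//; rewrite preimage_set0.
- by rewrite -preimage_bigcup; exact: mp.
Qed.

HB.instance Definition _ := isMeasure.Build _ _ _ lebesgue_rV_step
  step0 step_ge0 step_sigma_additive.

Let step_sigma_finite : sigma_finite setT lebesgue_rV_step.
Proof.
have [F FT Fm] := sigma_finite_prod (@lebesgue_measure R) m.
exists (fun k => @rV_uncons n @^-1` F k) => [|k].
  by rewrite -preimage_bigcup -FT preimage_setT.
have [mF Foo] := Fm k; split.
  by rewrite -[X in measurable X]setTI; exact: measurable_rV_uncons.
rewrite /lebesgue_rV_step /pushforward -comp_preimage.
by rewrite (_ : _ \o _ = id) //; apply/funext => z /=; rewrite rV_consK.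
Qed.

HB.instance Definition _ := @Measure_isSigmaFinite.Build _ _ _
  lebesgue_rV_step step_sigma_finite.

End step.

Fixpoint lebesgue_rV n : {sigma_finite_measure set 'rV[R]_n -> \bar R} :=
  match n with
  | 0 => \d_(0 : 'rV[R]_0)
  | k.+1 => lebesgue_rV_step (lebesgue_rV k)
  end.

Lemma lebesgue_rV_box n (A : 'I_n -> set R) :
  (forall i, measurable (A i)) ->
  lebesgue_rV n [set x | forall i, A i (x ord0 i)] =
  (\prod_(i < n) @lebesgue_measure R (A i))%E.
Proof.
elim: n A => [|n IHn] A mA.
  by rewrite big_ord0 /= diracE mem_set //= => -[].
rewrite big_ord_recl -IHn => [|i]; last exact: mA.
rewrite /= /lebesgue_rV_step /pushforward -product_measure1E.
- congr (_ _); apply/seteqP; split => -[a x] /=.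
    move=> h; split; first by have := h ord0; rewrite rV_cons0.
    by move=> i; have := h (lift ord0 i); rewrite rV_consS.
  move=> [Aa Ax] i; case: (unliftP ord0 i) => [j|] ->.
    by rewrite rV_consS.
  by rewrite rV_cons0.
- exact: mA.
- rewrite [X in measurable X](_ : _ =
      \bigcap_(i in [set: 'I_n])
        ((fun x : 'rV[R]_n => x ord0 i) @^-1` A (lift ord0 i))); last first.
    by apply/seteqP; split => x /= h i => [_|]; exact: h.
  apply: fin_bigcap_measurable => // i _.
  by rewrite -[X in measurable X]setTI; apply: measurable_coord.
Qed.

Definition lebesgue_RxRd d : set (measurableTypeR R * 'rV[R]_d) -> \bar R :=
  (@lebesgue_measure R \x lebesgue_rV d)%E.

HB.instance Definition _ d := Measure.on (@lebesgue_RxRd d).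

HB.instance Definition _ d := @Measure_isSigmaFinite.Build _ _ _
  (@lebesgue_RxRd d) (sigma_finite_prod (@lebesgue_measure R) (lebesgue_rV d)).

End lebesgue_rV.
Arguments lebesgue_rV {R} n.
Arguments lebesgue_RxRd {R} d.

Section complex_valued.
Context {disp : measure_display} {T : measurableType disp} {R : realType}.
Variable mu : {measure set T -> \bar R}.

Definition cintegrable (g : T -> R[i]) : Prop :=
  mu.-integrable setT (fun x => (complex.Re (g x))%:E) /\
  mu.-integrable setT (fun x => (complex.Im (g x))%:E).

Definition cintegral (g : T -> R[i]) : R[i] :=
  (\int[mu]_x complex.Re (g x)) +i* (\int[mu]_x complex.Im (g x)).

Definition cinner (u v : T -> R[i]) : R[i] :=
  cintegral (fun x => u x * conjc (v x)).

Definition cLnorm (p : \bar R) (g : T -> R[i]) : \bar R :=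
  Lnorm mu p (fun x => (Normc.normc (g x))%:E).

Definition inLp (p : \bar R) (g : T -> R[i]) : Prop :=
  [/\ measurable_fun setT (fun x => complex.Re (g x)),
      measurable_fun setT (fun x => complex.Im (g x)) &
      (cLnorm p g < +oo)%E].

(* Elements of L^p are represented by functions; an operator on functions
   induces one on L^p when it respects almost everywhere equality. *)
Definition bounded_linear_on_Lp (p : \bar R)
    (A : (T -> R[i]) -> (T -> R[i])) : Prop :=
  [/\ forall f g, inLp p f -> inLp p g -> {ae mu, forall x, f x = g x} ->
        {ae mu, forall x, A f x = A g x},
      forall (c : R[i]) f g, inLp p f -> inLp p g ->
        {ae mu, forall x, A (fun y => c * f y + g y) x = c * A f x + A g x} &
      exists2 M : R, 0 <= M & forall f, inLp p f ->
        inLp p (A f) /\ (cLnorm p (A f) <= M%:E * cLnorm p f)%E].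

End complex_valued.

Section smooth.
Context {R : realType} {V : normedModType R}.

(* On a finite-dimensional V this is n-fold continuous differentiability. *)
Fixpoint is_Cn (n : nat) (g : V -> R) : Prop :=
  continuous g /\
  if n is m.+1 then
    forall v, (forall x, derivable g x v) /\ is_Cn m (fun x => 'D_v g x)
  else True.

Definition smooth (g : V -> R[i]) : Prop := forall n,
  is_Cn n (fun x => complex.Re (g x)) /\ is_Cn n (fun x => complex.Im (g x)).

Definition test_function (g : V -> R[i]) : Prop :=
  smooth g /\ compact (closure [set x | g x != 0]).

End smooth.

Section harmonic_oscillator.
Context {R : realType} {d : nat}.
Implicit Types x : 'rV[R]_d.

(* The norm that 'rV carries in the library is the sup norm. *)
Definition sqnorm x : R := \sum_(i < d) x ord0 i ^+ 2.

Definition laplacian (g : 'rV[R]_d -> R) x : R :=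
  \sum_(i < d) 'D_(delta_mx ord0 i) (fun y => 'D_(delta_mx ord0 i) g y) x.

Definition osc_re (g : 'rV[R]_d -> R) x : R := - laplacian g x + sqnorm x * g x.

Definition osc (g : 'rV[R]_d -> R[i]) x : R[i] :=
  osc_re (fun y => complex.Re (g y)) x +i* osc_re (fun y => complex.Im (g y)) x.

(* By elliptic regularity every L^2 eigenfunction has a unique smooth
   representative, so taking smooth functions makes the values of a projection
   at points well defined. *)
Definition osc_eigenspace (k : nat) : set ('rV[R]_d -> R[i]) :=
  [set g | [/\ smooth g, inLp (lebesgue_rV d) 2%:E g &
               forall x, osc g x = (2 * k + d)%:R * g x]].

Definition osc_proj (k : nat) (u : 'rV[R]_d -> R[i]) : 'rV[R]_d -> R[i] :=
  xget (fun=> 0) [set g | osc_eigenspace k g /\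
    forall h, osc_eigenspace k h ->
      cinner (lebesgue_rV d) (fun x => u x - g x) h = 0].

End harmonic_oscillator.

Section partial_harmonic_oscillator.
Context {R : realType} {d : nat}.
Implicit Types (z : R * 'rV[R]_d) (f : R * 'rV[R]_d -> R[i]).

Definition expi (theta : R) : R[i] := cos theta +i* sin theta.

Definition fourier_rho f (tau : R) (x : 'rV[R]_d) : R[i] :=
  ((Num.sqrt (2 * pi))^-1)%:C *
  cintegral (@lebesgue_measure R) (fun rho => expi (- (rho * tau)) * f (rho, x)).

Definition Hpar_integrand (alpha : R) f z (k : nat) (tau : R) : R[i] :=
  expi (z.1 * tau) * ((tau ^+ 2 + (2 * k + d)%:R) `^ alpha)%:C *
  osc_proj k (fourier_rho f tau) z.2.

Definition Hpar_term (alpha : R) f z (k : nat) : R[i]^o :=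
  ((Num.sqrt (2 * pi))^-1)%:C *
  cintegral (@lebesgue_measure R) (Hpar_integrand alpha f z k).

Definition Hpar_converges (alpha : R) f z : Prop :=
  (forall k, cintegrable (@lebesgue_measure R) (Hpar_integrand alpha f z k)) /\
  cvgn (series (Hpar_term alpha f z)).

Definition Hpar (alpha : R) f z : R[i] := limn (series (Hpar_term alpha f z)).

End partial_harmonic_oscillator.

Section kernel.
Context {R : realType} {d : nat}.
Implicit Types z : R * 'rV[R]_d.

Definition sinh (t : R) : R := (expR t - expR (- t)) / 2.
Definition cosh (t : R) : R := (expR t + expR (- t)) / 2.
Definition tanh (t : R) : R := sinh t / cosh t.
Definition coth (t : R) : R := cosh t / sinh t.

Definition Gamma (a : R) : R :=
  \int[@lebesgue_measure R]_(t in `]0, +oo[) (t `^ (a - 1) * expR (- t)).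

Definition heat_exponent (t : R) z z' : R :=
  4^-1 * (2 * coth (2 * t) - tanh t) * sqnorm (z.2 - z'.2) +
  tanh t / 4 * sqnorm (z.2 + z'.2) +
  (z.1 - z'.1) ^+ 2 / (4 * t).

Definition heat_kernel (t : R) z z' : R :=
  2 `^ (- ((d%:R + 2) / 2)) * pi `^ (- ((d%:R + 1) / 2)) *
  t `^ (- 2^-1) * sinh (2 * t) `^ (- (d%:R / 2)) *
  expR (- heat_exponent t z z').

(* Extended-real valued: the integral may diverge at z = z'. *)
Definition Kpar (alpha : R) z z' : \bar R :=
  ((Gamma alpha)^-1%:E *
   \int[@lebesgue_measure R]_(t in `]0%R, +oo[)
     (t `^ (alpha - 1) * heat_kernel t z z')%:E)%E.

Definition Kpar_integrable (alpha : R) (f : R * 'rV[R]_d -> R[i]) z : Prop :=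
  (lebesgue_RxRd d).-integrable setT
    (fun z' => Kpar alpha z z' * (Normc.normc (f z'))%:E)%E.

(* Meaningful under [Kpar_integrable alpha f z], which forces the kernel to be
   finite at almost every point where f is nonzero. *)
Definition Kpar_op (alpha : R) (f : R * 'rV[R]_d -> R[i]) z : R[i] :=
  cintegral (lebesgue_RxRd d) (fun z' => (fine (Kpar alpha z z'))%:C * f z').

End kernel.

(* Main.v *)
Require Import Defs.
From HB Require Import structures.
From mathcomp Require Import all_boot all_order all_algebra.
From mathcomp Require Import complex.
From mathcomp Require Import all_classical all_reals all_analysis.
From mathcomp Require Import measurable_realfun ess_sup_inf.
From mathcomp Require Import ring lra.

Set Implicit Arguments.
Unset Strict Implicit.
Unset Printing Implicit Defensive.

Import Order.TTheory GRing.Theory Num.Theory.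
Import numFieldNormedType.Exports.

Local Open Scope classical_set_scope.
Local Open Scope ring_scope.
Local Open Scope complex_scope.

(** The projection [P_k] has the kernel [sum_(|mu| = k) h_mu(x) h_mu(y)] built from
    Hermite functions, and Mehler's formula sums [r^k P_k(x, y)] in closed form; at
    [r = exp(- 2 t)] this is the spatial part of the heat kernel. Because the
    projections are specified through smooth square-integrable eigenfunctions, one also
    needs that these are spanned by the [h_mu]: by Green's identity with cutoffs an
    eigenfunction of eigenvalue [2 k + d] is orthogonal to [h_mu] unless [|mu| = k], so
    applying Mehler's kernel to it and letting [r] tend to [1] shows that [P_k]
    reproduces it.

    Dropping the term [tanh t |x + x'|^2] from the exponent of the heat kernel leaves a
    Gaussian in [z - z'] of mass at most [2^d exp(- d t)]; integrated against
    [t^(alpha - 1)] it gives the integrable majorant, and Schur's test then gives the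
    bounds on every [L^p].

    For a test function [f], [(tau^2 + lambda)^(- alpha)] is a Gamma integral in [t], and
    the Fourier transform of the Gaussian turns the integral over [tau] into the heat
    kernel of the line. Summing over [k] under the integral in [t] is justified by
    dominated convergence: integrating [f] by parts against
    [cos ((rho - rho') tau) P_k(x, x')] gains [1 / (1 + tau^2)] and arbitrary powers of
    [1 / (2 k + d)], while [P_k(x, x')] grows only polynomially in [k]. *)

(** * Lebesgue measure on R^d *)

(** Mehler's formula is the main source of estimates for the Hermite functions. The terms
    [Pk k x x * r ^+ k] are nonnegative, so each is bounded by the closed form: [r = 1/2] gives
    Gaussian decay of the Hermite functions, [r = 1 - 1/(k+2)] polynomial growth of [Pk]. Conjugated
    with the ground state, the kernel is a Gaussian probability density, which fixes the
    normalization; norms of Hermite functions and orthogonality within one degree are never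
    computed.

    An eigenfunction is only known to be smooth and square integrable, with no control of its
    derivatives at infinity. Green's identity therefore puts the cutoff and all derivatives on the
    Hermite function.

    The exchange of the sum with the integral in [t] is delicate at small [t]: bounding the kernel
    by its supremum costs [t] to the power [-(d+1)/2], which is not integrable against
    [t^(alpha - 1)] for small [alpha]. Each mode is instead estimated on the frequency side, which
    gives a bound independent of [t]. At large [t] the decay comes from the lowest eigenvalue
    [d >= 1]. *)

Section rV_topology.
Variable R : realType.

(** The sigma-algebra on ['rV] is generated by the coordinates, the topology by the sup norm. An
    open set is the union of the boxes with rational centre and radius [1/(k+1)] that it contains,
    and there are countably many of them. *)
Lemma open_measurable_rV n (U : set 'rV[R]_n) : open U -> measurable U.
Proof.
move=> oU.
pose bx (q : 'rV[rat]_n) (k : nat) : set 'rV[R]_n :=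
  [set x | forall i, `|ratr (q ord0 i) - x ord0 i| < k.+1%:R^-1].
have mbx q k : measurable (bx q k).
  rewrite [X in measurable X](_ : _ =
      \bigcap_(i in [set: 'I_n])
        ((fun x : 'rV[R]_n => x ord0 i) @^-1` ball (ratr (q ord0 i) : R) k.+1%:R^-1)).
    apply: fin_bigcap_measurable => // i _.
    rewrite -[X in measurable X]setTI; apply: measurable_coord => //.
    exact: measurable_ball.
  by apply/seteqP; split => x /= h i => [_|]; exact: h.
pose F (qk : 'rV[rat]_n * nat) : set 'rV[R]_n :=
  if `[< bx qk.1 qk.2 `<=` U >] then bx qk.1 qk.2 else set0.
suff -> : U = \bigcup_qk F qk.
  apply: countable_bigcupT_measurable; first exact: countableP.
  by move=> qk; rewrite /F; case: ifP.
apply/seteqP; split => [x Ux|x [qk _]]; last first.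
  by rewrite /F; case: asboolP => // sub; exact: sub.
have /nbhs_ballP[e /= e0 xeU] : nbhs x U by exact: open_nbhs_nbhs.
(* Any two points of a box of radius [1/(k+1)] are closer than twice the radius, so a box containing
   [x] stays in the ball. *)
have [k ke] : exists k : nat, 2 * k.+1%:R^-1 < e.
  have e2 : 0 < e / 2 by rewrite divr_gt0.
  have [k _ hk] := near_infty_natSinv_lt (PosNum e2).
  exists k; have := hk k (leqnn k); rewrite /= => h.
  by rewrite mulrC -ltr_pdivlMr.
have [q hq] : exists q : 'rV[rat]_n, forall i,
    `|ratr (q ord0 i) - x ord0 i| < k.+1%:R^-1.
  have /choice[q hq] : forall i, exists q : rat, `|ratr q - x ord0 i| < k.+1%:R^-1.
    move=> i; have := @rat_in_itvoo R (x ord0 i - k.+1%:R^-1) (x ord0 i + k.+1%:R^-1).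
    rewrite ltrBlDr -addrA ltrDl addr_gt0// => /(_ isT)[q].
    rewrite in_itv/= => /andP[q1 q2]; exists q.
    by rewrite ltr_norml ltrBrDr addrC q1/= ltrBlDl.
  by exists (\row_i q i) => i; rewrite mxE.
exists (q, k) => //; rewrite /F /=; case: asboolP => //; case.
move=> y /= hy; apply: xeU; split => // i j.
rewrite (ord1 i) /ball /=.
have := hq j; have := hy j; rewrite (distrC (ratr _) (x ord0 j)) => h1 h2.
rewrite (le_lt_trans _ ke)// (le_trans (ler_distD (ratr (q ord0 j)) _ _))//.
by rewrite mulr_natl mulr2n lerD// ltW.
Qed.

Lemma continuous_measurable_rV n (g : 'rV[R]_n -> R) :
  continuous g -> measurable_fun setT g.
Proof.
move=> cg; apply: (@measurability _ _ _ _ _ _ (@RGenOpens.G R)).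
  exact: RGenOpens.measurableE.
move=> _ [_ [a [b ->] <-]]; rewrite setTI.
by apply: open_measurable_rV; move/continuousP: cg; apply; exact: interval_open.
Qed.

End rV_topology.

Section rV_integral.
Variable R : realType.
Local Notation mu := (@lebesgue_measure R).

Lemma ge0_integral_rV_cons n (f : 'rV[R]_n.+1 -> \bar R) :
  measurable_fun setT f -> (forall x, 0 <= f x)%E ->
  (\int[lebesgue_rV n.+1]_x f x =
   \int[mu]_a \int[lebesgue_rV n]_x f (rV_cons (a, x)))%E.
Proof.
move=> mf f0.
have mc := @measurable_rV_cons R n.
transitivity (\int[(mu \x lebesgue_rV n)%E]_z (f \o @rV_cons R n) z)%E; last first.
  have mfc : measurable_fun setT (f \o @rV_cons R n) by exact: measurableT_comp.
  by rewrite (fubini_tonelli1 (f \o @rV_cons R n) mfc) => // z; exact: f0.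
by rewrite -(ge0_integral_pushforward mc _ measurableT mf (fun y _ => f0 y)).
Qed.

(** Named and registered as a measurable function so that the push-forward along it is recognized as
    a measure; [dilation] follows the same pattern. *)
Definition translation (v : R) (x : measurableTypeR R) : measurableTypeR R := x + v.

Lemma measurable_translation v : measurable_fun setT (translation v).
Proof. by apply: measurable_funD. Qed.

HB.instance Definition _ v :=
  isMeasurableFun.Build _ _ _ _ (translation v) (measurable_translation v).

Lemma lebesgue_measureD (A : set R) (v : R) : measurable A ->
  pushforward mu (translation v) A = mu A.
Proof.
move=> mA; apply/esym/lebesgue_measure_unique => //= _ [[a b]] _ <-.
rewrite /pushforward.
rewrite (_ : _ @^-1` _ = `]a - v, b - v]%classic); last first.
  by apply/seteqP; split => x /=; rewrite !in_itv/= ltrBlDr lerBrDr.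
rewrite !lebesgue_measure_itv/= !lte_fin ltrD2r; case: ifPn => // _.
by rewrite -!EFinD; congr EFin; ring.
Qed.

Lemma ge0_integral_translation (f : R -> \bar R) v :
  measurable_fun setT f -> (forall x, 0 <= f x)%E ->
  (\int[mu]_x f (x + v)%R = \int[mu]_x f x)%E.
Proof.
move=> mf f0.
transitivity (\int[mu]_x (f \o translation v) x)%E; first by [].
rewrite -[X in (\int[_]_(z in X) _)%E = _](preimage_setT (translation v)).
rewrite -(ge0_integral_pushforward (measurable_translation v))//.
by apply: eq_measure_integral => A mA _; exact: lebesgue_measureD.
Qed.

Lemma rV_consD n (z w : R * 'rV[R]_n) :
  rV_cons z + rV_cons w = rV_cons (z.1 + w.1, z.2 + w.2).
Proof.
apply/rowP => i; rewrite mxE.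
by case: (unliftP ord0 i) => [j|] ->; rewrite ?rV_consS ?rV_cons0 ?mxE.
Qed.

(** Peeling off one coordinate reduces the claim to the line, where invariance follows from the
    uniqueness of Lebesgue measure. *)
Lemma ge0_integral_rV_translation n (f : 'rV[R]_n -> \bar R) v :
  measurable_fun setT f -> (forall x, 0 <= f x)%E ->
  (\int[lebesgue_rV n]_x f (x + v)%R = \int[lebesgue_rV n]_x f x)%E.
Proof.
elim: n f v => [|n IH] f v mf f0.
  by apply: eq_integral => x _; congr f; apply/rowP => -[].
have mc : measurable_fun setT (f \o @rV_cons R n).
  by apply: measurableT_comp => //; exact: measurable_rV_cons.
rewrite !ge0_integral_rV_cons//; last first.
  apply: measurableT_comp => //.
  apply: measurable_fun_rV => i.
  rewrite (_ : (fun _ => _) = fun x : 'rV[R]_n.+1 => x ord0 i + v ord0 i).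
    by apply: measurable_funD => //; exact: measurable_coord.
  by apply/funext => x; rewrite mxE.
rewrite -(rV_unconsK v).
under eq_integral do under eq_integral do rewrite rV_consD/=.
rewrite -(@ge0_integral_translation (fun a => \int[lebesgue_rV n]_x f (rV_cons (a, x)))%E (rV_uncons v).1).
- apply: eq_integral => a _.
  rewrite (IH (fun y => f (rV_cons (a + (rV_uncons v).1, y))))//.
  apply: (measurableT_comp mc); exact: pair1_measurable.
- apply: (measurable_fun_fubini_tonelli_F (f \o @rV_cons R n)) => //.
  by move=> z; exact: f0.
- by move=> x; exact: integral_ge0.
Qed.

Lemma ge0_integral_rV_prod n (f : 'I_n -> R -> R) :
  (forall i, measurable_fun setT (f i)) -> (forall i x, 0 <= f i x) ->
  (\int[lebesgue_rV n]_x (\prod_(i < n) f i (x ord0 i))%:E =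
   \prod_(i < n) \int[mu]_x (f i x)%:E)%E.
Proof.
elim: n f => [|n IH] f mf f0.
  rewrite big_ord0.
  under eq_integral do rewrite big_ord0.
  by rewrite integral_dirac// diracT mul1e.
rewrite ge0_integral_rV_cons//; last first.
- by move=> x; rewrite lee_fin prodr_ge0.
- apply/measurable_EFinP; apply: measurable_prod => i _.
  apply: measurableT_comp; [exact: mf|exact: measurable_coord].
rewrite big_ord_recl -IH//.
under eq_integral => a _.
  under eq_integral => x _.
    rewrite big_ord_recl rV_cons0/= EFinM.
    under eq_bigr do rewrite rV_consS/=.
    over.
  rewrite ge0_integralZl_EFin//; last first.
  - apply/measurable_EFinP; apply: measurable_prod => i _.
    apply: measurableT_comp; [exact: mf|exact: measurable_coord].
  - by move=> x _; rewrite lee_fin prodr_ge0.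
  over.
rewrite ge0_integralZr//.
- by apply/measurable_EFinP; exact: mf.
- by move=> x _; rewrite lee_fin.
- by apply: integral_ge0 => x _; rewrite lee_fin prodr_ge0.
Qed.

End rV_integral.

Section real_integrable.
Context d (T : measurableType d) (R : realType) (mu : {measure set T -> \bar R}).
Variables (D : set T) (mD : measurable D).
Implicit Types f g : T -> R.
Local Notation intg f := (mu.-integrable D (EFin \o f)).

Lemma intgD f g : intg f -> intg g -> intg (fun x => f x + g x).
Proof. by move=> fi gi; rewrite /comp; under eq_fun do rewrite EFinD; exact: integrableD. Qed.

Lemma intgB f g : intg f -> intg g -> intg (fun x => f x - g x).
Proof. by move=> fi gi; rewrite /comp; under eq_fun do rewrite EFinB; exact: integrableB. Qed.

Lemma intgZl c f : intg f -> intg (fun x => c * f x).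
Proof. by move=> fi; rewrite /comp; under eq_fun do rewrite EFinM; exact: integrableZl. Qed.

Lemma intgZr c f : intg f -> intg (fun x => f x * c).
Proof. by move=> fi; under eq_fun do rewrite mulrC; exact: intgZl. Qed.

Lemma intg_sum I (s : seq I) (P : pred I) (F : I -> T -> R) :
  (forall i, P i -> intg (F i)) -> intg (fun x => \sum_(i <- s | P i) F i x).
Proof.
move=> Fi; elim: s => [|i s IH].
  by under eq_fun do rewrite big_nil; exact: integrable0.
under eq_fun do rewrite big_cons; case Pi : (P i); last exact: IH.
by apply: intgD => //; exact: Fi.
Qed.

Lemma intg_le f g : measurable_fun D f -> (forall x, D x -> `|f x| <= g x) ->
  intg g -> intg f.
Proof.
move=> mf fg gi; apply: le_integrable gi => //; first exact/measurable_EFinP.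
by move=> x Dx; rewrite /= lee_fin (le_trans (fg x Dx))// ler_norm.
Qed.

Lemma intg_abs f : intg f -> intg (fun x => `|f x|).
Proof. by move=> fi; exact: (integrable_abse fi). Qed.

Lemma intg_meas f : intg f -> measurable_fun D f.
Proof. by move=> /integrableP[/measurable_EFinP]. Qed.

Lemma intgE f : intg f -> (\int[mu]_(x in D) f x)%:E = (\int[mu]_(x in D) (f x)%:E)%E.
Proof. by move=> fi; rewrite /Rintegral fineK//; exact: integrable_fin_num. Qed.

Lemma Rintegral_sum I (s : seq I) (P : pred I) (F : I -> T -> R) :
  (forall i, P i -> intg (F i)) ->
  \int[mu]_(x in D) (\sum_(i <- s | P i) F i x) =
  \sum_(i <- s | P i) \int[mu]_(x in D) F i x.
Proof.
move=> Fi; elim: s => [|i s IH].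
  rewrite big_nil; under eq_Rintegral do rewrite big_nil.
  by rewrite Rintegral_cst// mul0r.
rewrite big_cons -IH; under eq_Rintegral do rewrite big_cons.
case: ifPn => // Pi; rewrite RintegralD//; first exact: Fi.
exact: intg_sum.
Qed.

Lemma intg_indic (A : set T) : measurable A -> (mu A < +oo)%E ->
  mu.-integrable setT (EFin \o (\1_A : T -> R)).
Proof.
move=> mA Aoo; apply/integrableP; split; first exact/measurable_EFinP.
rewrite (eq_integral (fun x => (\1_A x)%:E)); last by move=> t _; rewrite gee0_abs// lee_fin.
by rewrite integral_indic// setIT.
Qed.

End real_integrable.

Section dominated.
Context d (T : measurableType d) (R : realType) (mu : {measure set T -> \bar R}).
Local Notation intg f := (mu.-integrable setT (EFin \o f)).

Lemma dominated_cvg_Rintegral (F : nat -> T -> R) (f g : T -> R) :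
  (forall n, measurable_fun setT (F n)) -> measurable_fun setT f ->
  (forall x, F n x @[n --> \oo] --> f x) ->
  intg g -> (forall n x, `|F n x| <= g x) ->
  intg f /\ \int[mu]_x F n x @[n --> \oo] --> \int[mu]_x f x.
Proof.
move=> mF mf Ff ig Fg.
have [] := @dominated_convergence _ T R mu setT measurableT
  (fun n x => (F n x)%:E) (fun x => (f x)%:E) (fun x => (g x)%:E).
- by move=> n; exact/measurable_EFinP.
- exact/measurable_EFinP.
- by apply: aeW => x _; apply: cvg_EFin; [exact: nearW|exact: Ff].
- exact: ig.
- by apply: aeW => x n _; rewrite lee_fin.
move=> fi _ H; split => //; apply: fine_cvg.
rewrite intgE//.
Qed.

End dominated.

Section RxRd_integral.
Variables (R : realType) (n : nat).
Local Notation mu := (@lebesgue_measure R).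

Lemma norm_rV_le (x : 'rV[R]_n) (M : R) : 0 <= M ->
  (`|x| <= M) = [forall i, `|x ord0 i| <= M].
Proof.
move=> M0; apply/idP/forallP => [xM i|h].
  apply: le_trans xM; rewrite [leRHS]mx_normrE.
  exact: (le_bigmax_cond _ (fun ij => `|x ij.1 ij.2|) (isT : xpredT (ord0, i))).
rewrite [leLHS]mx_normrE; apply: bigmax_le => // -[i j] _ /=.
by rewrite (ord1 i).
Qed.

Lemma measurable_norm_rV_le (M : R) : measurable [set x : 'rV[R]_n | `|x| <= M].
Proof.
rewrite -[X in measurable X]setTI.
have := @continuous_measurable_rV R n (fun x => `|x|) (@norm_continuous _ _).
move=> /(_ measurableT [set r | r <= M]); apply.
rewrite (_ : [set r | r <= M] = `]-oo, M]%classic); first exact: measurable_itv.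
by apply/seteqP; split => x; rewrite /= in_itv.
Qed.

Lemma lebesgue_rV_ball_lty (M : R) :
  (lebesgue_rV n [set x : 'rV[R]_n | `|x|%R <= M]%R < +oo)%E.
Proof.
have [M0|M0] := leP 0 M; last first.
  rewrite (_ : [set _ | _] = set0) ?measure0//.
  by apply/seteqP; split => // x /= xM; have := normr_ge0 x; lra.
have -> : [set x : 'rV[R]_n | `|x| <= M] = [set x | forall i : 'I_n, `[- M, M]%classic (x ord0 i)].
  apply/seteqP; split => x /=; rewrite norm_rV_le// => h.
    by move=> i; move/forallP: h => /(_ i); rewrite in_itv/= ler_norml.
  by apply/forallP => i; have := h i; rewrite in_itv/= ler_norml.
have -> := @lebesgue_rV_box R n (fun=> `[- M, M]%classic) (fun=> measurable_itv _).
elim/big_rec : _ => [|i x _ xoo]; first exact: ltry.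
by rewrite lebesgue_measure_itv/=; case: ifPn => _; rewrite ?mul0e ?ltry// lte_mul_pinfty// lee_fin; lra.
Qed.

End RxRd_integral.

(** * Directional derivatives and Green's identity *)

Section is_derive_pointwise.
Context {R : realType} {V : normedModType R}.
Implicit Types (f g : V -> R) (x v : V).

Lemma is_derive_mul f g x v (df dg : R) : is_derive x v f df -> is_derive x v g dg ->
  is_derive x v (fun y => f y * g y) (df * g x + f x * dg).
Proof.
by move=> Hf Hg; apply: (is_derive_eq (is_deriveM Hf Hg)); rewrite /GRing.scale/=; ring.
Qed.

Lemma is_derive_add f g x v (df dg : R) : is_derive x v f df -> is_derive x v g dg ->
  is_derive x v (fun y => f y + g y) (df + dg).
Proof. by move=> Hf Hg; exact: (is_derive_eq (is_deriveD Hf Hg)). Qed.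

Lemma is_derive_opp f x v (df : R) : is_derive x v f df ->
  is_derive x v (fun y => - f y) (- df).
Proof. by move=> Hf; exact: (is_derive_eq (is_deriveN Hf)). Qed.

Lemma is_derive_sub f g x v (df dg : R) : is_derive x v f df -> is_derive x v g dg ->
  is_derive x v (fun y => f y - g y) (df - dg).
Proof. by move=> Hf /is_derive_opp; exact: is_derive_add. Qed.

Lemma is_derive_cstmul (c : R) f x v (df : R) : is_derive x v f df ->
  is_derive x v (fun y => c * f y) (c * df).
Proof. by move=> Hf; exact: (is_derive_eq (is_deriveZ c Hf)). Qed.

End is_derive_pointwise.

Section derive_line.
Context {R : realType} {V : normedModType R}.
Implicit Types (G : V -> R) (x v : V).

Lemma derive_lineE G x v t : 
  (fun h : R => h^-1 *: (G ((h *: (1:R) + t) *: v + x) - G (t *: v + x))) =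
  (fun h : R => h^-1 *: (G (h *: v + (t *: v + x)) - G (t *: v + x))).
Proof. by apply/funext => h; rewrite scalerDl addrA /GRing.scale/= mulr1. Qed.

(** Along the line [s *: v + x] the two difference quotients are the same function, so one-variable
    results such as the chain rule and the mean value theorem carry over to directional
    derivatives. *)
Lemma is_derive_line G x v (t : R) (df : R) :
  is_derive t (1 : R) (fun s => G (s *: v + x)) df <->
  is_derive (t *: v + x) v G df.
Proof.
have E := derive_lineE G x v t.
split=> -[dG GE]; (split; last rewrite -GE); rewrite /derivable /derive in dG *.
- by rewrite -E.
- by rewrite -E.
- by rewrite E.
- by rewrite E.
Qed.

Lemma is_derive_line0 G x v (df : R) :
  is_derive (0 : R) (1 : R) (fun s => G (s *: v + x)) df <-> is_derive x v G df.
Proof. by rewrite is_derive_line scale0r add0r. Qed.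

Lemma is_derive_cvg_seq G x v (df : R) : is_derive x v G df ->
  n.+1%:R * (G (n.+1%:R^-1 *: v + x) - G x) @[n --> \oo] --> df.
Proof.
case=> dG GE.
have : h^-1 *: (G (h *: v + x) - G x) @[h --> (0:R)^'] --> df by rewrite -GE; exact: dG.
move/cvgr_dnbhsP => /(_ (fun n => n.+1%:R^-1)) H.
under eq_fun do rewrite -[X in X * _]invrK.
apply: H; split; last exact: cvg_harmonic.
by move=> n; rewrite invr_eq0.
Qed.

Lemma lerB_normDl (w y : V) : `|y| - `|w| <= `|w + y|.
Proof. by rewrite lerBlDr; have := ler_normD (w + y) (- w); rewrite addrAC subrr add0r normrN. Qed.

Lemma is_derive_out G x v (df M : R) : (forall y, M < `|y| -> G y = 0) ->
  M < `|x| -> is_derive x v G df -> df = 0.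
Proof.
move=> G0 Mx [dG <-].
(* For [|h|] below this bound [h *: v + x] stays outside the ball of radius [M]; adding 1 to [|v|]
   covers [v = 0]. *)
have e0 : 0 < (`|x| - M) / (`|v| + 1).
  by rewrite divr_gt0// ?subr_gt0// ltr_wpDl.
apply: cvg_lim => //; apply: cvg_near_cst; near=> h; rewrite /= (G0 x)// subr0 G0 ?scaler0//.
have : `|x| - `|h| * `|v| <= `|h *: v + x|.
  by rewrite -normrZ lerB_normDl.
apply: lt_le_trans; rewrite ltrBrDl -ltrBrDr.
have h1 : `|h| * (`|v| + 1) < `|x| - M.
  rewrite -ltr_pdivlMr ?ltr_wpDl//.
  by near: h; exact: dnbhs0_lt.
by apply: le_lt_trans h1; rewrite ler_wpM2l// lerDl.
Unshelve. all: by end_near. Qed.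

Lemma is_derive_MVT G (D : V -> R) x v : (forall y, is_derive y v G (D y)) ->
  forall h : R, 0 < h -> h <= 1 -> exists2 c : R, 0 <= c <= 1 &
  G (h *: v + x) - G x = h * D (c *: v + x).
Proof.
move=> dG h h0 h1.
pose g s := G (s *: v + x).
have dg s : is_derive s (1:R) g (D (s *: v + x)) by apply/is_derive_line.
have [c ch E] : exists2 c : R, c \in `]0, h[ & g h - g 0 = D (c *: v + x) * (h - 0).
  apply: MVT => //.
  apply: derivable_within_continuous => s _; exact: @ex_derive _ _ _ _ _ _ _ (dg s).
exists c; first by move: ch; rewrite in_itv/= => /andP[/ltW -> /ltW/le_trans ->].
by move: E; rewrite /g scale0r add0r subr0 mulrC.
Qed.

End derive_line.

Section integral_derive.
Context {R : realType} {d} {T : measurableType d} (mu : {measure set T -> \bar R}).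
(** The measurable space and the normed space are kept as separate types because the two structures
    sit on different descriptions of the same set. In both uses, [R^d] and [R x R^d], the map [j] is
    the identity and the hypotheses are facts about Lebesgue measure. *)
Context {V : normedModType R} (j : T -> V).
Hypothesis cm : forall g : V -> R, continuous g -> measurable_fun setT (g \o j).
Hypothesis tr : forall (g : V -> \bar R) v, measurable_fun setT (g \o j) ->
  (forall x, 0 <= g x)%E ->
  (\int[mu]_x g (j x + v)%R = \int[mu]_x g (j x))%E.
Hypothesis fb : forall M : R, mu.-integrable setT
  (fun x => (if `|j x| <= M then 1 else 0 : R)%:E).
Hypothesis bb : forall (g : V -> R) (M : R), continuous g ->
  exists2 C, 0 <= C & forall x, `|x| <= M -> `|g x| <= C.

Lemma cs_integrable (g : V -> R) (M : R) : continuous g ->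
  (forall y, M < `|y| -> g y = 0) -> mu.-integrable setT (fun x => (g (j x))%:E).
Proof.
move=> cg g0; have [C C0 gC] := bb M cg.
apply: (@le_integrable _ _ _ _ _ measurableT _
  (fun x => (C * (if `|j x| <= M then 1 else 0 : R))%:E)).
- by apply/measurable_EFinP; exact: cm.
- move=> x _; rewrite lee_fin; case: ifPn => [/gC|]; first by rewrite mulr1 (ger0_norm C0).
  by rewrite -ltNge => /g0 ->; rewrite mulr0.
- under eq_fun do rewrite EFinM; exact: integrableZl.
Qed.

(** Translation invariance makes the integral of every difference quotient vanish, and dominated
    convergence passes to the derivative. *)
Lemma integral_derive_eq0 (G D : V -> R) v (M : R) :
  (forall x, is_derive x v G (D x)) -> continuous G -> continuous D ->
  (forall y, M < `|y| -> G y = 0) ->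
  \int[mu]_x D (j x) = 0.
Proof.
move=> dG cG continuousR_add G0.
have Gi := cs_integrable cG G0.
have cT (w : V) : continuous (fun y : V => y + w).
  by move=> y; apply: cvgD; [exact: cvg_id|exact: cvg_cst].
have cTG w : continuous (fun y => G (y + w)).
  by move=> y; apply: (@continuous_comp _ _ _ (fun y => y + w) G); [exact: cT|exact: cG].
pose F n y : R := n.+1%:R * (G (n.+1%:R^-1 *: v + y) - G y).
have intT w : mu.-integrable setT (fun x => (G (w + j x))%:E).
  apply: (@cs_integrable (fun y => G (w + y)) (M + `|w|)).
  - by under [X in continuous X]eq_fun do rewrite addrC; exact: cTG.
  - move=> y My; apply: G0; rewrite -ltrBrDr in My; apply: (lt_le_trans My).
    exact: lerB_normDl.
have int0 : forall n, \int[mu]_x F n (j x) = 0.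
  move=> n.
  rewrite /F RintegralZl//; last by apply: intgB => //; exact: intT.
  rewrite RintegralB//; last exact: intT.
  suff -> : \int[mu]_x G (n.+1%:R^-1 *: v + j x) = \int[mu]_x G (j x) by rewrite subrr mulr0.
  (* Translation invariance is available for nonnegative functions, so the positive and negative
     parts are shifted separately. *)
  rewrite /Rintegral; congr fine; rewrite integralE [in RHS]integralE.
  have mG := cm cG.
  have mGp : measurable_fun setT ((fun y => ((EFin \o G)^\+ y)%E) \o j).
    have /measurable_EFinP/measurable_funepos := mG.
    by rewrite -[EFin \o (G \o j)]/((EFin \o G) \o j) funepos_comp.
  have mGn : measurable_fun setT ((fun y => ((EFin \o G)^\- y)%E) \o j).
    have /measurable_EFinP/measurable_funeneg := mG.
    by rewrite -[EFin \o (G \o j)]/((EFin \o G) \o j) funeneg_comp.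
  congr (_ - _)%E.
  - transitivity (\int[mu]_x ((fun y => (EFin \o G)^\+ y) (j x + n.+1%:R^-1 *: v)%R))%E.
      by apply: eq_integral => x _; rewrite !funeposE /= (addrC (j x)).
    etransitivity; first exact: (tr _ mGp (fun y => funepos_ge0 _ y)).
    by apply: eq_integral => x _; rewrite !funeposE.
  - transitivity (\int[mu]_x ((fun y => (EFin \o G)^\- y) (j x + n.+1%:R^-1 *: v)%R))%E.
      by apply: eq_integral => x _; rewrite !funenegE /= (addrC (j x)).
    etransitivity; first exact: (tr _ mGn (fun y => funeneg_ge0 _ y)).
    by apply: eq_integral => x _; rewrite !funenegE.
(* The quotient vanishes unless [|x| <= M + |v|]; there it equals [D] at a point [c *: v + x] with
   [c <= 1], which costs the second [|v|]. *)
have [C C0 DC] := bb (M + `|v| + `|v|) continuousR_add.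
have [] := @dominated_cvg_Rintegral _ T R mu (fun n x => F n (j x)) (fun x => D (j x))
  (fun x => C * (if `|j x| <= M + `|v| then 1 else 0)).
- move=> n; apply: measurable_funM => //; apply: measurable_funB; last exact: cm.
  by have /integrableP[/measurable_EFinP] := intT (n.+1%:R^-1 *: v).
- exact: cm.
- by move=> x; exact: is_derive_cvg_seq.
- by apply: intgZl => //; exact: fb.
- move=> n x; rewrite /F.
  have n0 : (0:R) < n.+1%:R^-1 by rewrite invr_gt0.
  have n1 : (n.+1%:R^-1 : R) <= 1 by rewrite invf_le1// ler1n.
  case: ifPn => [xM|]; last first.
    rewrite -ltNge => xM; rewrite !G0 ?subr0 ?mulr0 ?normr0//.
    + by rewrite (le_lt_trans _ xM)// lerDl.
    + rewrite -ltrBrDr in xM; apply: (lt_le_trans xM).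
      have : `|n.+1%:R^-1 *: v| <= `|v| by rewrite normrZ (ger0_norm (ltW n0)) ler_piMl.
      move=> h; apply: (@le_trans _ _ (`|j x| - `|n.+1%:R^-1 *: v|)); first by rewrite lerD2l lerN2.
      exact: lerB_normDl.
  have [c /andP[c0 c1] ->] := @is_derive_MVT R V G D (j x) v dG _ n0 n1.
  rewrite mulrA divff ?mul1r ?mulr1// DC// (le_trans (ler_normD _ _))// addrC.
  by rewrite lerD// normrZ (ger0_norm c0) ler_piMl.
move=> _; under eq_fun do rewrite int0.
by move/(cvg_lim (@Rhausdorff R)); rewrite lim_cst.
Qed.

(** The derivative of [p f' - f p'] is [p f'' - f p''], so the claim is the vanishing of the
    integral of a derivative. Only [f] has bounded support; [p] may grow arbitrarily. *)
Lemma green (f f1 f2 p p1 p2 : V -> R) v (M : R) :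
  (forall x, is_derive x v f (f1 x)) -> (forall x, is_derive x v f1 (f2 x)) ->
  (forall x, is_derive x v p (p1 x)) -> (forall x, is_derive x v p1 (p2 x)) ->
  continuous f -> continuous f1 -> continuous f2 ->
  continuous p -> continuous p1 -> continuous p2 ->
  (forall y, M < `|y| -> f y = 0) ->
  \int[mu]_x (p (j x) * f2 (j x)) = \int[mu]_x (f (j x) * p2 (j x)).
Proof.
move=> df df1 dp dp1 cf cf1 cf2 cp cp1 cp2 f0.
have f10 y : M < `|y| -> f1 y = 0 by move=> My; exact: (is_derive_out f0 My (df y)).
have f20 y : M < `|y| -> f2 y = 0 by move=> My; exact: (is_derive_out f10 My (df1 y)).
apply/eqP; rewrite -subr_eq0; apply/eqP.
have continuousR_mul (g h : V -> R) : continuous g -> continuous h -> continuous (fun x => g x * h x).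
  by move=> cg ch x; apply: cvgM; [exact: cg|exact: ch].
rewrite -RintegralB//; last 2 first.
- by apply: (@cs_integrable (fun y => p y * f2 y) M) => [|y /f20 ->]; [exact: continuousR_mul|rewrite mulr0].
- by apply: (@cs_integrable (fun y => f y * p2 y) M) => [|y /f0 ->]; [exact: continuousR_mul|rewrite mul0r].
apply: (@integral_derive_eq0 (fun y => p y * f1 y - f y * p1 y)
  (fun y => p y * f2 y - f y * p2 y) v M).
- move=> x; have H := is_derive_sub (is_derive_mul (dp x) (df1 x)) (is_derive_mul (df x) (dp1 x)).
  apply: (is_derive_eq H).
  by ring.
- by move=> x; apply: cvgB; apply: continuousR_mul.
- by move=> x; apply: cvgB; apply: continuousR_mul.
- by move=> y My; rewrite f10// f0// mulr0 mul0r subr0.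
Qed.

End integral_derive.

(** * Integration on R x R^d and smooth functions *)

Section instances.
Context {R : realType} (n : nat).
Local Notation mu := (@lebesgue_measure R).
Local Notation V := (R * 'rV[R]_n)%type.

Lemma continuous_rV_uncons :
  continuous (fun x : 'rV[R]_n.+1 => (rV_uncons x : R * 'rV[R]_n)).
Proof.
move=> x A /nbhs_ballP[e /= e0 xeA]; apply/nbhs_ballP; exists e => //= y [_ xy].
apply: xeA.
split; first exact: xy.
by split => // i j; rewrite !mxE; exact: xy.
Qed.

Lemma normr_rV_uncons (z : V) : `|rV_cons z| <= `|z|.
Proof.
rewrite norm_rV_le//; apply/forallP => i.
case: (unliftP ord0 i) => [j|] ->; rewrite ?rV_consS ?rV_cons0.
  apply: (@le_trans _ _ `|z.2|); last by rewrite [leRHS]prod_normE le_max lexx orbT.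
  by have := norm_rV_le z.2 (normr_ge0 z.2); rewrite lexx => /esym/forallP.
by rewrite [leRHS]prod_normE le_max lexx.
Qed.

(** The passage through [R^(n+1)] uses that [rV_cons] is measurable and its inverse [rV_uncons]
    continuous, so continuous functions on the product inherit measurability from ['rV]. *)
Lemma continuous_measurable_RxRd (g : V -> R) :
  continuous g -> measurable_fun [set: measurableTypeR R * 'rV[R]_n] g.
Proof.
move=> cg.
rewrite (_ : g = (fun x => g (rV_uncons x)) \o @rV_cons R n); last first.
  by apply/funext => z /=; rewrite rV_consK.
apply: measurableT_comp; last exact: measurable_rV_cons.
apply: continuous_measurable_rV => x.
apply: (@continuous_comp _ _ _ (fun x : 'rV[R]_n.+1 => (rV_uncons x : V)) g).
  exact: continuous_rV_uncons.
exact: cg.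
Qed.

Lemma tonelli_RxRd (g : V -> \bar R) :
  measurable_fun [set: measurableTypeR R * 'rV[R]_n] g -> (forall x, 0 <= g x)%E ->
  (\int[lebesgue_RxRd n]_z g z = \int[mu]_a \int[lebesgue_rV n]_x g (a, x))%E.
Proof.
move=> mg g0.
exact: (@fubini_tonelli1 _ _ (measurableTypeR R) _ R mu (lebesgue_rV n) g mg g0).
Qed.

Lemma ge0_integral_RxRd_translation (g : V -> \bar R) (v : V) :
  measurable_fun [set: measurableTypeR R * 'rV[R]_n] g -> (forall x, 0 <= g x)%E ->
  (\int[lebesgue_RxRd n]_z g (z + v)%R = \int[lebesgue_RxRd n]_z g z)%E.
Proof.
move=> mg g0.
have mgv : measurable_fun [set: measurableTypeR R * 'rV[R]_n] (fun z : V => g (z + v)).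
  apply: measurableT_comp => //; apply/measurable_fun_pairP; split.
    by apply: measurable_funD => //; exact: measurable_fst.
  apply: measurable_fun_rV => i.
  rewrite (_ : (fun _ => _) = fun z : V => z.2 ord0 i + v.2 ord0 i); last first.
    by apply/funext => z /=; rewrite mxE.
  apply: measurable_funD => //.
  by apply: (measurableT_comp (measurable_coord i)); exact: measurable_snd.
rewrite !tonelli_RxRd//.
rewrite -(@ge0_integral_translation R (fun a => \int[lebesgue_rV n]_x g (a, x))%E v.1).
- apply: eq_integral => a _.
  apply: (@ge0_integral_rV_translation R n (fun y => g (a + v.1, y)) v.2) => //.
  apply: (measurableT_comp mg); exact: pair1_measurable.
- exact: (measurable_fun_fubini_tonelli_F g).
- by move=> x; exact: integral_ge0.
Qed.

Lemma integrable_ball_rV (M : R) : (lebesgue_rV n).-integrable setT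
  (fun x : 'rV[R]_n => (if `|x| <= M then 1 else 0 : R)%:E).
Proof.
rewrite (_ : (fun _ => _) = (EFin \o \1_[set x : 'rV[R]_n | `|x| <= M])); last first.
  apply/funext => x /=; rewrite indicE; congr EFin.
  by case: ifPn => h; [rewrite mem_set|rewrite memNset//; exact/negP].
by apply: intg_indic => //; [exact: measurable_norm_rV_le|exact: lebesgue_rV_ball_lty].
Qed.

Lemma integrable_ball_RxRd (M : R) : (lebesgue_RxRd n).-integrable setT
  (fun z : V => (if `|z| <= M then 1 else 0 : R)%:E).
Proof.
rewrite (_ : (fun _ => _) = (EFin \o
    \1_([set a : measurableTypeR R | `|a|%R <= M] `*` [set x : 'rV[R]_n | `|x| <= M]))); last first.
  apply/funext => z /=; rewrite indicE; congr EFin.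
  case: ifPn => h; [rewrite mem_set//|rewrite memNset//].
    by move: h; rewrite prod_normE ge_max => /andP[].
  by apply: contraNnot h => -[/= h1 h2]; rewrite prod_normE ge_max h1.
have E : [set a : measurableTypeR R | `|a|%R <= M] = `[- M, M]%classic.
  by apply/seteqP; split => a; rewrite /= in_itv/= ler_norml.
have mB := @measurable_norm_rV_le R n M.
apply: intg_indic => //; first by apply: measurableX => //; rewrite E.
rewrite /lebesgue_RxRd.
rewrite [ltLHS]product_measure1E//; last by rewrite E.
rewrite lte_mul_pinfty//.
  rewrite ge0_fin_numE// E.
  have := @lebesgue_measure_itv R `[- M, M]; rewrite /= => ->.
  by case: ifPn => // _; rewrite ltry.
exact: lebesgue_rV_ball_lty.
Qed.

End instances.

Lemma bounded_on_ball_rV (R : realType) n (g : 'rV[R]_n -> R) (M : R) : continuous g ->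
  exists2 C, 0 <= C & forall x, `|x| <= M -> `|g x| <= C.
Proof.
move=> cg.
have cK : compact [set x : 'rV[R]_n | `|x| <= M].
  apply: bounded_closed_compact.
    by exists M; split; [exact: num_real|move=> N MN x /= /le_trans; apply; exact: ltW].
  rewrite (_ : [set x | _] = (fun x : 'rV[R]_n => `|x|) @^-1` [set r | r <= M])//.
  apply: closed_comp; last exact: closed_le.
  by move=> x _; exact: norm_continuous.
have [|C [_ hC]] := @compact_bounded _ _ (g @` [set x : 'rV[R]_n | `|x| <= M]).
  by apply: continuous_compact => //; apply: continuous_subspaceT.
exists (`|C| + 1); first by rewrite addr_ge0.
move=> x xM; apply: (hC (`|C| + 1)); last by exists x.
by rewrite (le_lt_trans (ler_norm _))// ltrDl.
Qed.

Lemma bounded_on_ball_RxRd (R : realType) n (g : R * 'rV[R]_n -> R) (M : R) : continuous g ->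
  exists2 C, 0 <= C & forall x, `|x| <= M -> `|g x| <= C.
Proof.
move=> cg.
have [|C C0 hC] := @bounded_on_ball_rV R n.+1 (fun x => g (rV_uncons x)) M.
  move=> x; apply: (@continuous_comp _ _ _ (fun x : 'rV[R]_n.+1 => (rV_uncons x : R * 'rV[R]_n)) g).
    exact: continuous_rV_uncons.
  exact: cg.
exists C => // z zM; have := hC (rV_cons z); rewrite rV_consK; apply.
exact: le_trans (normr_rV_uncons z) zM.
Qed.

Definition green_rV (R : realType) n := @green R _ _ (@lebesgue_rV R n) _ id
  (@continuous_measurable_rV R n) (@ge0_integral_rV_translation R n)
  (@integrable_ball_rV R n) (@bounded_on_ball_rV R n).

Definition green_RxRd (R : realType) n := @green R _ _ (@lebesgue_RxRd R n) _ id
  (@continuous_measurable_RxRd R n) (@ge0_integral_RxRd_translation R n)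
  (@integrable_ball_RxRd R n) (@bounded_on_ball_RxRd R n).

Definition cs_integrable_rV (R : realType) n := @cs_integrable R _ _ (@lebesgue_rV R n) _ id
  (@continuous_measurable_rV R n)
  (@integrable_ball_rV R n) (@bounded_on_ball_rV R n).

Definition cs_integrable_RxRd (R : realType) n := @cs_integrable R _ _ (@lebesgue_RxRd R n) _ id
  (@continuous_measurable_RxRd R n)
  (@integrable_ball_RxRd R n) (@bounded_on_ball_RxRd R n).

(** * Calculus of smooth real-valued functions *)

Section is_Cn_theory.
Context {R : realType} {V : normedModType R}.
Implicit Types (g f : V -> R) (x v : V).

Definition smoothR g := forall n, is_Cn n g.

Lemma is_Cn_cont n g : is_Cn n g -> continuous g.
Proof. by case: n => [|n] []. Qed.

Lemma is_CnW n g : is_Cn n.+1 g -> is_Cn n g.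
Proof.
elim: n g => [|n IH] g [cg dg]; first by split.
by split => // v; have [d1 d2] := dg v; split => //; exact: IH.
Qed.

Lemma is_Cn_derive n g (g' : V -> V -> R) : continuous g ->
  (forall v x, is_derive x v g (g' v x)) -> (forall v, is_Cn n (g' v)) -> is_Cn n.+1 g.
Proof.
move=> cg dg cg'; split => // v; split; first by move=> x; exact: (@ex_derive _ _ _ _ _ _ _ (dg v x)).
rewrite (_ : (fun _ => _) = g' v)//; apply/funext => x.
exact: (@derive_val _ _ _ _ _ _ _ (dg v x)).
Qed.

Lemma is_CnP n g : is_Cn n.+1 g -> forall v x, is_derive x v g ('D_v g x).
Proof. by move=> [_ dg] v x; have [d1 _] := dg v; split. Qed.

Lemma is_CnD n f g : is_Cn n f -> is_Cn n g -> is_Cn n (fun x => f x + g x).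
Proof.
elim: n f g => [|n IH] f g cf cg.
  by split => // x; apply: cvgD; [exact: (is_Cn_cont cf)|exact: (is_Cn_cont cg)].
apply: (@is_Cn_derive _ _ (fun v x => 'D_v f x + 'D_v g x)).
- by move=> x; apply: cvgD; [exact: (is_Cn_cont cf)|exact: (is_Cn_cont cg)].
- by move=> v x; apply: is_derive_add; [exact: (is_CnP cf)|exact: (is_CnP cg)].
- by move=> v; apply: IH; [have [_ /(_ v)[]] := cf|have [_ /(_ v)[]] := cg].
Qed.

Lemma is_CnM n f g : is_Cn n f -> is_Cn n g -> is_Cn n (fun x => f x * g x).
Proof.
elim: n f g => [|n IH] f g cf cg.
  by split => // x; apply: cvgM; [exact: (is_Cn_cont cf)|exact: (is_Cn_cont cg)].
apply: (@is_Cn_derive _ _ (fun v x => 'D_v f x * g x + f x * 'D_v g x)).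
- by move=> x; apply: cvgM; [exact: (is_Cn_cont cf)|exact: (is_Cn_cont cg)].
- by move=> v x; apply: is_derive_mul; [exact: (is_CnP cf)|exact: (is_CnP cg)].
- move=> v; apply: is_CnD; apply: IH.
  + by have [_ /(_ v)[]] := cf.
  + exact: is_CnW.
  + exact: is_CnW.
  + by have [_ /(_ v)[]] := cg.
Qed.

Lemma smoothR_cont g : smoothR g -> continuous g.
Proof. by move=> /(_ 0%N)[]. Qed.

Lemma smoothR_is_derive g v x : smoothR g -> is_derive x v g ('D_v g x).
Proof. by move=> sg; exact: (is_CnP (sg 1%N)). Qed.

Lemma smoothR_derive g v : smoothR g -> smoothR (fun x => 'D_v g x).
Proof. by move=> sg n; have [_ /(_ v)[]] := sg n.+1. Qed.

Lemma smoothR_cst (c : R) : smoothR (fun=> c).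
Proof.
move=> n; elim: n c => [|n IH] c; first by split => //; exact: cst_continuous.
apply: (@is_Cn_derive _ _ (fun _ _ => 0)); first exact: cst_continuous.
by move=> _; exact: IH.
Qed.

Lemma smoothR_add f g : smoothR f -> smoothR g -> smoothR (fun x => f x + g x).
Proof. by move=> sf sg n; exact: is_CnD. Qed.

Lemma smoothR_mul f g : smoothR f -> smoothR g -> smoothR (fun x => f x * g x).
Proof. by move=> sf sg n; exact: is_CnM. Qed.

Lemma smoothR_opp f : smoothR f -> smoothR (fun x => - f x).
Proof. by move=> sf; under eq_fun do rewrite -mulN1r; apply: smoothR_mul => //; exact: smoothR_cst. Qed.

Lemma smoothR_sub f g : smoothR f -> smoothR g -> smoothR (fun x => f x - g x).
Proof. by move=> sf /smoothR_opp; exact: smoothR_add. Qed.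

Lemma smoothR_sum I (s : seq I) (P : pred I) (F : I -> V -> R) :
  (forall i, P i -> smoothR (F i)) -> smoothR (fun x => \sum_(i <- s | P i) F i x).
Proof.
move=> sF; elim: s => [|i s IH].
  by under eq_fun do rewrite big_nil; exact: smoothR_cst.
under eq_fun do rewrite big_cons; case Pi : (P i) => //.
by apply: smoothR_add => //; exact: sF.
Qed.

Lemma smoothR_prod I (s : seq I) (F : I -> V -> R) :
  (forall i, smoothR (F i)) -> smoothR (fun x => \prod_(i <- s) F i x).
Proof.
move=> sF; elim: s => [|i s IH].
  by under eq_fun do rewrite big_nil; exact: smoothR_cst.
by under eq_fun do rewrite big_cons; exact: smoothR_mul.
Qed.

Lemma smoothR_linear (l : V -> R) : continuous l ->
  (forall (t : R) x v, l (t *: v + x) = t * l v + l x) -> smoothR l.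
Proof.
move=> cl ll; case => [|n]; first by split.
apply: (@is_Cn_derive _ _ (fun v _ => l v)) => //; last by move=> v; exact: smoothR_cst.
move=> v x; apply/is_derive_line0; under eq_fun do rewrite ll.
have H := is_derive_add (is_derive_mul (is_derive_id (0:R) (1:R)) (is_derive_cst (l v) (0:R) (1:R)))
  (is_derive_cst (l x) (0:R) (1:R)).
by apply: (is_derive_eq H); rewrite mul1r mulr0 !addr0.
Qed.

Lemma is_derive_chain (p : R -> R) f x v (dp df : R) :
  is_derive (f x) (1 : R) p dp -> is_derive x v f df ->
  is_derive x v (fun y => p (f y)) (dp * df).
Proof.
move=> Hp /is_derive_line0 Hf; apply/is_derive_line0.
apply: (@is_derive1_comp _ p (fun s => f (s *: v + x))) => //.
by rewrite scale0r add0r.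
Qed.

(* [p k] is the [k]-th derivative of [p 0]. *)
Lemma smoothR_comp (p : nat -> R -> R) f : (forall k t, is_derive t (1 : R) (p k) (p k.+1 t)) ->
  smoothR f -> smoothR (fun x => p 0%N (f x)).
Proof.
move=> dp sf n; elim: n 0%N => [|n IH] k.
  split => // x; apply: (@continuous_comp _ _ _ f (p k)); first exact: smoothR_cont.
  apply: differentiable_continuous; apply/derivable1_diffP.
  exact: (@ex_derive _ _ _ _ _ _ _ (dp k (f x))).
apply: (@is_Cn_derive _ _ (fun v x => p k.+1 (f x) * 'D_v f x)).
- move=> x; apply: (@continuous_comp _ _ _ f (p k)); first exact: smoothR_cont.
  apply: differentiable_continuous; apply/derivable1_diffP.
  exact: (@ex_derive _ _ _ _ _ _ _ (dp k (f x))).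
- by move=> v x; apply: is_derive_chain => //; exact: smoothR_is_derive.
- by move=> v; apply: is_CnM => //; exact: smoothR_derive.
Qed.

End is_Cn_theory.

(** * Mehler's formula in one variable *)

Section subexponential.
Context {R : realType}.
Implicit Types (u v : nat -> R).

(** Growth slower than every geometric sequence of ratio above 1, so that the power series converges
    for [|r| < 1]. The condition is stable under shifts and under multiplication by [n], hence under
    differentiation of the series. *)
Definition subexp u := forall q : R, 1 < q ->
  exists2 K : R, 0 <= K & forall n, `|u n| <= K * q ^+ n.

Lemma subexp_le u v : (forall n, `|u n| <= v n) -> subexp v -> subexp u.
Proof.
move=> uv sv q q1; have [K K0 vK] := sv q q1; exists K => // n.
by rewrite (le_trans (uv n))// (le_trans (ler_norm _)).
Qed.

Lemma subexpD u v : subexp u -> subexp v -> subexp (fun n => u n + v n).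
Proof.
move=> su sv q q1; have [K K0 uK] := su q q1; have [L L0 vL] := sv q q1.
exists (K + L); first exact: addr_ge0.
by move=> n; rewrite (le_trans (ler_normD _ _))// mulrDl lerD.
Qed.

Lemma subexpZ (c : R) u : subexp u -> subexp (fun n => c * u n).
Proof.
move=> su q q1; have [K K0 uK] := su q q1.
exists (`|c| * K); first exact: mulr_ge0.
by move=> n; rewrite normrM -mulrA ler_wpM2l.
Qed.

Lemma subexpS u : subexp u -> subexp (fun n => u n.+1).
Proof.
move=> su q q1; have [K K0 uK] := su q q1; exists (K * q).
  by rewrite mulr_ge0//; lra.
by move=> n; rewrite -mulrA -exprS.
Qed.

(** The coefficients of the power series multiplied by its variable; see [psum_delay]. *)
Definition delay u n : R := if n is m.+1 then u m else 0.

Lemma subexp_delay u : subexp u -> subexp (delay u).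
Proof.
move=> su q q1; have [K K0 uK] := su q q1; exists K => // -[|n] /=.
  by rewrite normr0 mulr_ge0// exprn_ge0//; lra.
rewrite (le_trans (uK n))// ler_wpM2l// exprS ler_peMl//; last lra.
by rewrite exprn_ge0//; lra.
Qed.

Lemma subexp_natM u : subexp u -> subexp (fun n => n%:R * u n).
Proof.
(* The rate [q] is split as [p * p]: one factor bounds [u], the other absorbs [n] by Bernoulli's
   inequality [n (p - 1) <= p^n]. *)
move=> su q q1; pose p := Num.sqrt q.
have q0 : 0 <= q by lra.
have p1 : 1 < p by rewrite -sqrtr1 ltr_sqrt//; lra.
have [K K0 uK] := su p p1; exists (K / (p - 1)).
  by rewrite divr_ge0//; lra.
move=> n; rewrite normrM normr_nat.
have nb : n%:R * (p - 1) <= p ^+ n.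
  elim: n => [|n IH]; first by rewrite mul0r ler01.
  have h1 : 1 <= p ^+ n by rewrite exprn_ege1// ltW.
  rewrite -natr1 exprS; nra.
have -> : q ^+ n = p ^+ n * p ^+ n by rewrite -exprMn -expr2 sqr_sqrtr.
have -> : K / (p - 1) * (p ^+ n * p ^+ n) = (p ^+ n / (p - 1)) * (K * p ^+ n) by ring.
by apply: ler_pM => //; rewrite ler_pdivlMr//; lra.
Qed.

Lemma subexp_diffs u : subexp u -> subexp (pseries_diffs u).
Proof. by move=> su; exact: (subexpS (subexp_natM su)). Qed.

Lemma subexp_norm u : subexp u -> subexp (fun n => `|u n|).
Proof. by move=> su q /su[K K0 uK]; exists K => // n; rewrite normr_id. Qed.

Lemma subexp_cvg u (r : R) : subexp u -> `|r| < 1 -> cvgn (pseries u r).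
Proof.
move=> su r1; apply: normed_cvg; have r0 := normr_ge0 r.
(* This rate exceeds 1, yet its product with [|r|] stays below 1. *)
have q1 : 1 < 2 / (1 + `|r|) by rewrite ltr_pdivlMr//; lra.
have [K K0 uK] := su _ q1.
apply: (@series_le_cvg _ _ (geometric K (2 / (1 + `|r|) * `|r|))).
- by move=> n; exact: normr_ge0.
- by move=> n; rewrite /geometric/= mulr_ge0// exprn_ge0// mulr_ge0// divr_ge0//; lra.
- move=> n; rewrite /geometric/= normrM normrX exprMn mulrA ler_wpM2r//.
- apply: is_cvg_geometric_series; rewrite ger0_norm; last first.
    by rewrite mulr_ge0// divr_ge0//; lra.
  by rewrite mulrAC ltr_pdivrMr; lra.
Qed.

Definition psum u (r : R) : R := limn (pseries u r).

Lemma psum_cvg u (r : R) : subexp u -> `|r| < 1 -> pseries u r @ \oo --> psum u r.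
Proof. by move=> su r1; exact: subexp_cvg. Qed.

Lemma psumD u v r : subexp u -> subexp v -> `|r| < 1 ->
  psum (fun n => u n + v n) r = psum u r + psum v r.
Proof.
move=> su sv r1; apply: cvg_lim => //.
rewrite (_ : pseries _ r = pseries u r + pseries v r); last first.
  apply/funext => n; rewrite /pseries /series/= fctE -big_split.
  by apply: eq_bigr => i _; rewrite mulrDl.
by apply: cvgD; exact: psum_cvg.
Qed.

Lemma psumZ c u r : subexp u -> `|r| < 1 -> psum (fun n => c * u n) r = c * psum u r.
Proof.
move=> su r1; apply: cvg_lim => //.
rewrite (_ : pseries _ r = (fun n => c * pseries u r n)); last first.
  apply/funext => n; rewrite /pseries /series/= mulr_sumr.
  by apply: eq_bigr => i _; rewrite mulrA.
by apply: cvgMr; exact: psum_cvg.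
Qed.

Lemma psum_delay u r : subexp u -> `|r| < 1 -> psum (delay u) r = r * psum u r.
Proof.
move=> su r1; apply: cvg_lim => //; rewrite -(cvg_shiftn 1).
rewrite (_ : (fun n => _) = (fun n => r * pseries u r n)); last first.
  apply/funext => n; rewrite /pseries /series/= addn1 big_nat_recl//= mul0r add0r mulr_sumr.
  by apply: eq_bigr => i _; rewrite exprS mulrCA.
by apply: cvgMr; exact: psum_cvg.
Qed.

Lemma psum_is_derive u (r : R) : subexp u -> `|r| < 1 ->
  is_derive r (1 : R) (psum u) (psum (pseries_diffs u) r).
Proof.
move=> su r1; have r0 := normr_ge0 r.
have K1 : `|(1 + `|r|) / 2| < 1 by rewrite ger0_norm; lra.
have su1 := subexp_diffs su; have su2 := subexp_diffs su1.
apply: (@pseries_snd_diffs _ _ ((1 + `|r|) / 2)); try exact: subexp_cvg.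
by rewrite [ltRHS]ger0_norm; lra.
Qed.

Lemma psum0 u : psum u 0 = u 0%N.
Proof.
apply: cvg_lim => //; rewrite -(cvg_shiftn 1).
apply: cvg_near_cst; apply: nearW => n; rewrite /pseries /series/= addn1 big_nat_recl//=.
rewrite expr0 mulr1 big1 ?addr0// => i _; by rewrite exprS mul0r mulr0.
Qed.

End subexponential.

(** * Hermite polynomials and the differential equation of Mehler's series *)

Section hermite.
Context {R : realType}.
Implicit Types (x y t : R).

(** The physicists' Hermite polynomials, orthogonal for the weight [exp(- t^2)], given by their
    three-term recurrence. *)
Fixpoint herm (n : nat) t : R :=
  if n is m.+1 then if m is k.+1 then 2 * t * herm m t - 2 * m%:R * herm k t else 2 * t
  else 1.

Lemma hermSS n t : herm n.+2 t = 2 * t * herm n.+1 t - 2 * n.+1%:R * herm n t.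
Proof. by []. Qed.

(* Also valid for [n = 0], where the second term vanishes. *)
Lemma hermS n t : herm n.+1 t = 2 * t * herm n t - 2 * n%:R * herm n.-1 t.
Proof. by case: n => [|n]; rewrite ?hermSS//= mulr0 mul0r subr0 mulr1. Qed.

Lemma is_derive_herm n t : is_derive t (1 : R) (herm n) (2 * n%:R * herm n.-1 t).
Proof.
elim/ltn_ind: n => -[|[|n]] IH.
- by apply: (is_derive_eq (is_derive_cst _ _ _)); rewrite mulr0 mul0r.
- apply: (is_derive_eq (is_derive_cstmul 2 (is_derive_id t 1))); by rewrite mulr1 /= mulr1.
- have H := is_derive_sub
    (is_derive_mul (is_derive_cstmul 2 (is_derive_id t 1)) (IH n.+1 (ltnSn _)))
    (is_derive_cstmul (2 * n.+1%:R) (IH n (ltnW (ltnSn _)))).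
  apply: (is_derive_eq H).
  change (2 * 1 * herm n.+1 t + 2 * t * (2 * n.+1%:R * herm n t) -
    2 * n.+1%:R * (2 * n%:R * herm n.-1 t) = 2 * n.+2%:R * herm n.+1 t).
  by rewrite (hermS n t) -[n.+2%:R]natr1 -[n.+1%:R]natr1; ring.
Qed.

(** The reciprocal of the squared norm of [herm n] for the weight [exp(- t^2)], without the factor
    [sqrt pi], which enters in [hw]. *)
Definition hwt (n : nat) : R := (2 ^+ n * n`!%:R)^-1.

Lemma hwt_gt0 n : 0 < hwt n.
Proof. by rewrite invr_gt0 mulr_gt0 ?exprn_gt0// ltr0n fact_gt0. Qed.

Lemma hwtS n : 2 * n.+1%:R * hwt n.+1 = hwt n.
Proof.
rewrite /hwt factS natrM exprS.
have n0 : n.+1%:R != 0 :> R by rewrite pnatr_eq0.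
have f0 : n`!%:R != 0 :> R by rewrite pnatr_eq0 -lt0n fact_gt0.
have e0 : 2 ^+ n != 0 :> R by rewrite expf_neq0.
move: n0 f0 e0; move: (n.+1%:R) (n`!%:R) (2 ^+ n) => a b c a0 b0 c0.
by field; rewrite a0 b0 c0.
Qed.

(** The recurrence combined with [(a - b)^2 <= (1 + 1/e) a^2 + (1 + e) b^2]. After normalization the
    coefficient of the term of index [n+1] tends to 0, while that of index [n] is as close to 1 as
    wanted. *)
Lemma herm_step x (e : R) n : 0 < e ->
  hwt n.+2 * herm n.+2 x ^+ 2 <=
  (1 + e^-1) * (2 * x ^+ 2 / n.+2%:R) * (hwt n.+1 * herm n.+1 x ^+ 2) +
  (1 + e) * (hwt n * herm n x ^+ 2).
Proof.
move=> e0; rewrite hermSS; set A := herm n.+1 x; set B := herm n x.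
have n2 : (0 : R) < n.+2%:R by [].
have w2 : hwt n.+1 = 2 * n.+2%:R * hwt n.+2 by rewrite hwtS.
have w1 : hwt n = 4 * n.+1%:R * n.+2%:R * hwt n.+2 by rewrite -hwtS w2; ring.
rewrite w1 w2; have := hwt_gt0 n.+2; set w := hwt n.+2 => w0.
have -> : (1 + e^-1) * (2 * x ^+ 2 / n.+2%:R) * (2 * n.+2%:R * w * A ^+ 2) +
  (1 + e) * (4 * n.+1%:R * n.+2%:R * w * B ^+ 2) =
  w * ((1 + e^-1) * (2 * x * A) ^+ 2 + (1 + e) * (4 * n.+1%:R * n.+2%:R) * B ^+ 2).
  move: (gt_eqF n2) (gt_eqF e0); move: (n.+2%:R) => N /negbT N0 /negbT e1.
  by field; rewrite N0 e1.
apply: ler_wpM2l; first exact: ltW.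
have := sqr_ge0 (2 * x * A + e * (2 * n.+1%:R * B)) => h.
have h2 : 0 <= e^-1 * (2 * x * A + e * (2 * n.+1%:R * B)) ^+ 2.
  by apply: mulr_ge0; [rewrite invr_ge0 ltW|exact: sqr_ge0].
have E : (1 + e^-1) * (2 * x * A) ^+ 2 + (1 + e) * (2 * n.+1%:R * B) ^+ 2
   = (2 * x * A - 2 * n.+1%:R * B) ^+ 2 + e^-1 * (2 * x * A + e * (2 * n.+1%:R * B)) ^+ 2.
  by field; rewrite (gt_eqF e0).
apply: (@le_trans _ _ ((1 + e^-1) * (2 * x * A) ^+ 2 + (1 + e) * (2 * n.+1%:R * B) ^+ 2)).
  by rewrite E lerDl.
rewrite lerD2l -[leRHS]mulrA ler_wpM2l//; first lra.
rewrite exprMn ler_wpM2r ?sqr_ge0//.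
rewrite exprMn (_ : 2 ^+ 2 = 4 :> R); last by ring.
by rewrite -mulrA ler_wpM2l// expr2 ler_wpM2l// ler_nat.
Qed.

Lemma subexp_herm2 x : subexp (fun n => hwt n * herm n x ^+ 2).
Proof.
move=> q q1; pose e := q - 1; have e0 : 0 < e by rewrite /e; lra.
pose g n := hwt n * herm n x ^+ 2.
have g0 n : 0 <= g n by rewrite mulr_ge0 ?sqr_ge0// ltW// hwt_gt0.
pose c := (1 + e^-1) * (2 * x ^+ 2).
have c0 : 0 <= c.
  by apply: mulr_ge0; [rewrite addr_ge0// invr_ge0 ltW|rewrite mulr_ge0 ?sqr_ge0].
(* From index [N+2] on, the first coefficient of [herm_step] is at most [e]. Since [q = 1 + e]
   satisfies [q^2 = e q + (1 + e)], a bound by a multiple of [q^n] propagates; the finitely many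
   earlier values are absorbed in the constant. *)
have [N hN] : exists N : nat, c / e <= N%:R.
  by exists (Num.truncn (c / e)).+1; rewrite ltW// truncnS_gt.
exists (\sum_(i < N.+2) g i); first exact: sumr_ge0.
have base n : (n <= N.+1)%N -> g n <= (\sum_(i < N.+2) g i) * q ^+ n.
  move=> nN; rewrite (@le_trans _ _ (\sum_(i < N.+2) g i))//.
    by rewrite (bigD1 (Ordinal (nN : (n < N.+2)%N)))//= lerDl sumr_ge0.
  rewrite ler_peMr ?sumr_ge0//; by rewrite exprn_ege1// ltW.
have step : forall n, g n <= (\sum_(i < N.+2) g i) * q ^+ n.
  elim/ltn_ind => n IH; have [|nN] := leqP n N.+1; first exact: base.
  case: n nN IH => [//|[//|n]] nN IH.
  set S := \sum_(i < N.+2) g i in IH *.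
  apply: (le_trans (herm_step x n e0)); rewrite -!/(g _).
  have i1 := IH n.+1 (ltnSn _); have i0 := IH n (ltnW (ltnSn _)).
  have ce : (1 + e^-1) * (2 * x ^+ 2 / n.+2%:R) <= e.
    rewrite mulrA -/c ler_pdivrMr// mulrC -ler_pdivrMr// (le_trans hN)// ler_nat.
    by rewrite ltnW// ltnW.
  have -> : S * q ^+ n.+2 = e * (S * q ^+ n.+1) + (1 + e) * (S * q ^+ n).
    by rewrite !exprS /e; ring.
  apply: lerD; last by rewrite ler_wpM2l//; lra.
  apply: ler_pM => //.
  by apply: mulr_ge0; [rewrite addr_ge0// invr_ge0 ltW|rewrite divr_ge0// mulr_ge0 ?sqr_ge0].
by move=> n; rewrite ger0_norm ?g0//; exact: step.
Qed.

Lemma norm_mul_le (h a b : R) : 0 < h -> `|h * a * b| <= h * a ^+ 2 + h * b ^+ 2.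
Proof.
move=> h0; rewrite ler_norml.
have h1 : 0 <= h * (a + b) ^+ 2 by rewrite mulr_ge0 ?sqr_ge0// ltW.
have h2 : 0 <= h * (a - b) ^+ 2 by rewrite mulr_ge0 ?sqr_ge0// ltW.
by apply/andP; split; nra.
Qed.

Section mehler.
Variables x y : R.
Let a n := hwt n * herm n x * herm n y.
Let u n := hwt n * herm n.+1 x * herm n y.
Let w n := hwt n * herm n x * herm n.+1 y.

Lemma subexp_mehler : subexp a.
Proof.
apply: subexp_le (subexpD (subexp_herm2 x) (subexp_herm2 y)) => n.
rewrite /a; apply: norm_mul_le; exact: hwt_gt0.
Qed.

Let subexp_herm1 (z : R) : subexp (fun n => hwt n * herm n.+1 z ^+ 2).
Proof.
have := subexp_natM (subexp_herm2 z) => /subexpS /(subexpZ 2).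
apply: subexp_le => n.
rewrite mulrA mulrA hwtS ger0_norm// mulr_ge0 ?sqr_ge0// ltW//; exact: hwt_gt0.
Qed.

Let subexp_u : subexp u.
Proof.
apply: subexp_le (subexpD (subexp_herm1 x) (subexp_herm2 y)) => n.
rewrite /u; apply: norm_mul_le; exact: hwt_gt0.
Qed.

Let subexp_w : subexp w.
Proof.
apply: subexp_le (subexpD (subexp_herm2 x) (subexp_herm1 y)) => n.
rewrite /w; apply: norm_mul_le; exact: hwt_gt0.
Qed.

(** Since [2 n hwt n = hwt (n-1)], the lower-order term of the recurrence becomes a delayed
    coefficient of the companion series. Thus [uE] and [wE] give a linear system for the sums of [u]
    and [w] in terms of that of [a]. *)
Let uE n : u n = 2 * x * a n + -1 * delay w n.
Proof.
rewrite /u /a /w /delay hermS; case: n => [|n]; first by rewrite /=; ring.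
by rewrite -(hwtS n) /=; ring.
Qed.

Let wE n : w n = 2 * y * a n + -1 * delay u n.
Proof.
rewrite /u /a /w /delay (hermS n y); case: n => [|n]; first by rewrite /=; ring.
by rewrite -(hwtS n) /=; ring.
Qed.

Let dE n : 2 * pseries_diffs a n = 2 * x * w n +
  (-(2 * y) * delay w n + 2 * delay (fun k => a k + delay (pseries_diffs a) k) n).
Proof.
have aE k : a k + delay (pseries_diffs a) k = k.+1%:R * a k.
  case: k => [|k] /=; first by rewrite addr0 mul1r.
  by rewrite /pseries_diffs -[k.+2%:R]natr1; ring.
(* The weight relation removes the factor [n+1] produced by differentiation. *)
transitivity (hwt n * herm n.+1 x * herm n.+1 y).
  by rewrite /pseries_diffs /a -(hwtS n); ring.
rewrite hermS /w /delay; case: n => [|n]; first by rewrite /=; ring.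
have {}aE : a n + match n with 0%N => 0 | m.+1 => pseries_diffs a m end = n.+1%:R * a n by exact: aE.
rewrite aE /a -(hwtS n) (hermSS n y) /=; ring.
Qed.

(* The recurrences of the Hermite polynomials turn into a first-order linear equation in
   [r] for Mehler's series. *)
Lemma mehler_ode (r : R) : `|r| < 1 ->
  (1 - r ^+ 2) ^+ 2 * psum (pseries_diffs a) r =
  (r * (1 - r ^+ 2) + 2 * (x * y) * (1 + r ^+ 2) - 2 * r * (x ^+ 2 + y ^+ 2)) * psum a r.
Proof.
move=> r1.
have sa := subexp_mehler; have sd := subexp_diffs sa.
have su := subexp_u; have sw := subexp_w.
have sdw := subexp_delay sw; have sdu := subexp_delay su; have sdd := subexp_delay sd.
have EU : psum u r = 2 * x * psum a r - r * psum w r.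
  rewrite (_ : u = fun n => 2 * x * a n + -1 * delay w n); last exact/funext.
  rewrite psumD//; [|exact: subexpZ|exact: subexpZ].
  by rewrite !psumZ// psum_delay// mulN1r.
have EW : psum w r = 2 * y * psum a r - r * psum u r.
  rewrite (_ : w = fun n => 2 * y * a n + -1 * delay u n); last exact/funext.
  rewrite psumD//; [|exact: subexpZ|exact: subexpZ].
  by rewrite !psumZ// psum_delay// mulN1r.
have ED : 2 * psum (pseries_diffs a) r = 2 * x * psum w r +
   (-(2 * y) * (r * psum w r) + 2 * (r * (psum a r + r * psum (pseries_diffs a) r))).
  rewrite -psumZ//.
  rewrite (_ : (fun n => 2 * _) = (fun n => 2 * x * w n +
    (-(2 * y) * delay w n + 2 * delay (fun k => a k + delay (pseries_diffs a) k) n))); last first.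
    exact/funext.
  have sda := subexpD sa sdd; have sdda := subexp_delay sda.
  rewrite psumD//; [|exact: subexpZ|by apply: subexpD; exact: subexpZ].
  rewrite psumD//; [|exact: subexpZ|exact: subexpZ].
  rewrite !psumZ// psum_delay// (psum_delay sda)// psumD// (psum_delay sd)//.
set A := psum a r in EU EW ED *; set U := psum u r in EU EW; set W := psum w r in EU EW ED.
set D := psum (pseries_diffs a) r in ED *.
have W1 : (1 - r ^+ 2) * W = (2 * y - 2 * r * x) * A.
  by rewrite EU in EW; lra.
have D1 : (1 - r ^+ 2) * D = (x - y * r) * W + r * A by lra.
by rewrite expr2 -mulrA D1 mulrDr mulrCA W1; ring.
Qed.

(** [L] is minus the exponent on the right. By [mehler_ode] the product of the series with
    [expR (L r)] has zero derivative, and it equals 1 at 0. Writing the prefactor [(1 - r^2)^(-1/2)]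
    as an exponential makes the product over coordinates a sum of exponents later on. *)
Lemma mehler1 (r : R) : 0 <= r < 1 -> psum a r =
  expR (- (2^-1 * ln (1 - r ^+ 2)) +
    (2 * r * (x * y) - r ^+ 2 * (x ^+ 2 + y ^+ 2)) / (1 - r ^+ 2)).
Proof.
move=> /andP[r0 r1].
set s := x * y; set q := x ^+ 2 + y ^+ 2.
pose L t : R := 2^-1 * ln (1 - t ^+ 2) - (2 * t * s - t ^+ 2 * q) / (1 - t ^+ 2).
have t1 t : `|t| < 1 -> 0 < 1 - t ^+ 2.
  by rewrite ltr_norml => /andP[? ?]; nra.
have dL t : `|t| < 1 -> is_derive t (1 : R) L (- (t * (1 - t ^+ 2) + 2 * s * (1 + t ^+ 2) - 2 * t * q) / (1 - t ^+ 2) ^+ 2).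
  move=> /t1 h.
  have h0 : 1 - t ^+ 2 != 0 by rewrite gt_eqF.
  have d2 : is_derive t (1 : R) (fun t => t ^+ 2 : R) (2 * t).
    have H := is_derive_mul (is_derive_id t (1:R)) (is_derive_id t (1:R)).
    by apply: (is_derive_eq H); ring.
  have d1 : is_derive t (1 : R) (fun t => 1 - t ^+ 2 : R) (- (2 * t)).
    by apply: (is_derive_eq (is_derive_sub (is_derive_cst (1:R) t (1:R)) d2)); ring.
  have dl : is_derive t (1:R) (fun t => ln (1 - t ^+ 2)) ((1 - t ^+ 2)^-1 * - (2 * t)).
    exact: (@is_derive_chain R R^o (@ln R) (fun t => 1 - t ^+ 2) t 1 _ _ (is_derive1_ln h) d1).
  have dv : is_derive t (1:R) (fun t => (1 - t ^+ 2)^-1 : R) (2 * t / (1 - t ^+ 2) ^+ 2).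
    apply: (is_derive_eq (@is_deriveV R (fun t => 1 - t ^+ 2) t _ 1 h0 d1)).
    by rewrite /GRing.scale/=; field.
  have dn := is_derive_sub (is_derive_mul (is_derive_cstmul 2 (is_derive_id t (1:R))) (is_derive_cst s t (1:R)))
     (is_derive_mul d2 (is_derive_cst q t (1:R))).
  have H := is_derive_sub (is_derive_cstmul 2^-1 dl) (is_derive_mul dn dv).
  apply: (is_derive_eq H); rewrite /cst /=; by field.
have dF t : `|t| < 1 -> is_derive t (1 : R) (fun t => psum a t * expR (L t)) 0.
  move=> ht; have dp := psum_is_derive subexp_mehler ht.
  have de := @is_derive_chain R R^o (@expR R) L t 1 _ _ (is_derive_expR (L t)) (dL t ht).
  apply: (is_derive_eq (is_derive_mul dp de)).
  have := mehler_ode ht; rewrite -/s -/q => O.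
  have h0 : 1 - t ^+ 2 != 0 by rewrite gt_eqF// t1.
  set D := psum (pseries_diffs a) t in O *; set A := psum a t in O *.
  have -> : D = (t * (1 - t ^+ 2) + 2 * s * (1 + t ^+ 2) - 2 * t * q) * A / (1 - t ^+ 2) ^+ 2.
    by rewrite -O; field.
  by field.
have E0 : psum a 0 * expR (L 0) = 1.
  rewrite psum0 /a /L /hwt /= !(expr0n, mulr0, mul0r, subr0, subrr, oppr0, add0r).
  by rewrite ln1 mulr0 expR0 fact0 expr0 !mulr1 invr1.
have E1 : psum a r * expR (L r) = 1.
  have [->|rn0] := eqVneq r 0; first exact: E0.
  have rp : 0 < r by rewrite lt_neqAle eq_sym rn0.
  have [] := @MVT R (fun t => psum a t * expR (L t)) (fun=> 0) _ _ rp.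
  - move=> t; rewrite in_itv/= => /andP[t0 tr]; apply: dF; rewrite ger0_norm; lra.
  - apply: derivable_within_continuous => t; rewrite in_itv/= => /andP[t0 tr].
    by apply: (@ex_derive _ _ _ _ _ _ _ (dF t _)); rewrite ger0_norm; lra.
  by move=> c _; rewrite mul0r E0 => /eqP; rewrite subr_eq0 => /eqP.
rewrite (_ : - _ + _ = - L r); last by rewrite /L opprB addrC.
by rewrite expRN -[LHS]mulr1 -(mulfV (lt0r_neq0 (expR_gt0 (L r)))) mulrA E1 mul1r.
Qed.

End mehler.
End hermite.

(** * Hermite functions and Mehler's formula in R^d *)

Section hermite_functions.
Context {R : realType}.
Implicit Types (t : R).

Definition hf n t : R := herm n t * expR (- (t ^+ 2 / 2)).
(** The derivative of [hf n] written with the raising operator; in this form the second derivative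
    involves [hf n] alone. *)
Definition hf1 n t : R := t * hf n t - hf n.+1 t.

Lemma is_derive_gauss t :
  is_derive t (1 : R) (fun t => expR (- (t ^+ 2 / 2)) : R) (- t * expR (- (t ^+ 2 / 2))).
Proof.
have d2 : is_derive t (1 : R) (fun t => - (t ^+ 2 / 2) : R) (- t).
  have H := is_derive_opp (is_derive_mul (is_derive_mul (is_derive_id t (1:R)) (is_derive_id t (1:R)))
     (is_derive_cst (2^-1 : R) t (1:R))).
  by apply: (is_derive_eq H); rewrite /cst/=; field.
apply: (is_derive_eq (@is_derive_chain R R^o (@expR R) _ t 1 _ _ (is_derive_expR _) d2)).
by rewrite mulrC.
Qed.

Lemma is_derive_hf n t : is_derive t (1 : R) (hf n) (hf1 n t).
Proof.
apply: (is_derive_eq (is_derive_mul (is_derive_herm n t) (is_derive_gauss t))).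
by rewrite /hf1 /hf hermS; ring.
Qed.

Lemma is_derive_hf1 n t :
  is_derive t (1 : R) (hf1 n) ((t ^+ 2 - (2 * n + 1)%:R) * hf n t).
Proof.
have H := is_derive_sub (is_derive_mul (is_derive_id t (1:R)) (is_derive_hf n t)) (is_derive_hf n.+1 t).
apply: (is_derive_eq H); rewrite /hf1 /hf hermSS natrD natrM -[n.+1%:R]natr1.
by ring.
Qed.

End hermite_functions.

Section coordinates.
Context {R : realType} {d : nat}.
Implicit Types (x y v : 'rV[R]_d).

Lemma smoothR_coord (i : 'I_d) : smoothR (fun x => x ord0 i).
Proof.
apply: smoothR_linear => [|t x v]; last by rewrite !mxE.
exact: coord_continuous.
Qed.

Lemma smoothR_sqnorm : smoothR (@sqnorm R d).
Proof. by apply: smoothR_sum => i _; apply: smoothR_mul; exact: smoothR_coord. Qed.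

Lemma is_derive_coord_prod (f : 'I_d -> R -> R) i x (df : R) :
  is_derive (x ord0 i) (1 : R) (f i) df ->
  is_derive x (delta_mx ord0 i) (fun x => \prod_(j < d) f j (x ord0 j))
    (df * \prod_(j < d | j != i) f j (x ord0 j)).
Proof.
move=> Hf; apply/is_derive_line0.
rewrite (_ : (fun s : R => _) = (fun s => f i (s *: 1 + x ord0 i) *
    cst (\prod_(j < d | j != i) f j (x ord0 j)) s)); last first.
  apply/funext => s; rewrite (bigD1 i)//= !mxE !eqxx /=; congr (_ * _).
  by apply: eq_bigr => j ji; rewrite !mxE eqxx/= (negbTE ji) mulr0 add0r.
have H1 : is_derive (0 : R) (1 : R) (fun s : R => f i (s *: 1 + x ord0 i)) df.
  by apply/(@is_derive_line0 R R^o).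
apply: (is_derive_eq (is_derive_mul H1 (is_derive_cst _ _ _))).
by rewrite mulr0 addr0.
Qed.

Lemma smoothR_herm n (i : 'I_d) : smoothR (fun x => herm n (x ord0 i)).
Proof.
elim/ltn_ind: n => -[|[|n]] IH; first exact: smoothR_cst.
  by apply: smoothR_mul; [exact: smoothR_cst|exact: smoothR_coord].
have -> : (fun x : 'rV[R]_d => herm n.+2 (x ord0 i)) =
   (fun x => 2 * x ord0 i * herm n.+1 (x ord0 i) - 2 * n.+1%:R * herm n (x ord0 i)) by [].
apply: smoothR_sub; apply: smoothR_mul.
- by apply: smoothR_mul; [exact: smoothR_cst|exact: smoothR_coord].
- exact: IH.
- exact: smoothR_cst.
- by apply: IH; rewrite ltnW.
Qed.

Lemma smoothR_hf n (i : 'I_d) : smoothR (fun x => hf n (x ord0 i)).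
Proof.
apply: smoothR_mul; first exact: smoothR_herm.
apply: (@smoothR_comp R _ (fun=> expR)) => //.
apply: smoothR_opp; apply: smoothR_mul; last exact: smoothR_cst.
by apply: smoothR_mul; exact: smoothR_coord.
Qed.

Definition hermf (mu : 'I_d -> nat) x : R := \prod_(i < d) hf (mu i) (x ord0 i).

Lemma smoothR_hermf mu : smoothR (hermf mu).
Proof. by apply: smoothR_prod => i; exact: smoothR_hf. Qed.

Definition bump1 (mu : 'I_d -> nat) i j := ((j == i) + mu j)%N.

Lemma hermfD1 mu i x :
  hermf mu x = hf (mu i) (x ord0 i) * \prod_(j < d | j != i) hf (mu j) (x ord0 j).
Proof. by rewrite /hermf (bigD1 i). Qed.

Lemma hermf_bump1 mu i x : hermf (bump1 mu i) x =
  hf (mu i).+1 (x ord0 i) * \prod_(j < d | j != i) hf (mu j) (x ord0 j).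
Proof.
rewrite /hermf (bigD1 i)//= /bump1 eqxx; congr (_ * _).
by apply: eq_bigr => j /negbTE ->.
Qed.

Lemma is_derive_hermf mu i x : is_derive x (delta_mx ord0 i) (hermf mu)
  (x ord0 i * hermf mu x - hermf (bump1 mu i) x).
Proof.
apply: (is_derive_eq (@is_derive_coord_prod (fun j => hf (mu j)) i x _ (is_derive_hf _ _))).
by rewrite (hermfD1 _ i) hermf_bump1 /hf1; ring.
Qed.

Lemma is_derive_hermf2 mu i x : is_derive x (delta_mx ord0 i)
  (fun x => x ord0 i * hermf mu x - hermf (bump1 mu i) x)
  ((x ord0 i ^+ 2 - (2 * mu i + 1)%:R) * hermf mu x).
Proof.
pose f (j : 'I_d) : R -> R := if j == i then hf1 (mu j) else hf (mu j).
have fE (z : 'rV[R]_d) : \prod_(j < d | j != i) f j (z ord0 j) = \prod_(j < d | j != i) hf (mu j) (z ord0 j).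
  by apply: eq_bigr => j ji; rewrite /f (negbTE ji).
rewrite (_ : (fun x => _) = (fun x => \prod_(j < d) f j (x ord0 j))); last first.
  apply/funext => z; rewrite (hermfD1 _ i) hermf_bump1 [RHS](bigD1 i)//= fE /f eqxx /hf1.
  by ring.
have H := @is_derive_coord_prod f i x ((x ord0 i ^+ 2 - (2 * mu i + 1)%:R) * hf (mu i) (x ord0 i)).
apply: (is_derive_eq (H _)); first by rewrite /f eqxx; exact: is_derive_hf1.
by rewrite (hermfD1 _ i) mulrA fE.
Qed.

Lemma derive_hermf mu i y :
  'D_(delta_mx ord0 i) (hermf mu) y = y ord0 i * hermf mu y - hermf (bump1 mu i) y.
Proof. exact: (@derive_val _ _ _ _ _ _ _ (is_derive_hermf mu i y)). Qed.

Lemma derive2_hermf mu i x :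
  'D_(delta_mx ord0 i) (fun y => 'D_(delta_mx ord0 i) (hermf mu) y) x =
  (x ord0 i ^+ 2 - (2 * mu i + 1)%:R) * hermf mu x.
Proof.
under eq_fun do rewrite derive_hermf.
exact: (@derive_val _ _ _ _ _ _ _ (is_derive_hermf2 mu i x)).
Qed.

Lemma osc_re_hermf mu x : osc_re (hermf mu) x = (2 * (\sum_i mu i) + d)%:R * hermf mu x.
Proof.
rewrite /osc_re /laplacian (eq_bigr _ (fun i _ => derive2_hermf mu i x)).
rewrite -mulr_suml sumrB -/(sqnorm x) -natr_sum big_split/= -big_distrr/=.
by rewrite sum1_card card_ord; ring.
Qed.

(** The reciprocal of the squared [L^2] norm of [hermf mu]: in one variable that norm squared is
    [sqrt pi 2^n n!]. The value is justified afterwards by Mehler's formula and the mass of its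
    kernel, not by computing the norm. *)
Definition hw (mu : 'I_d -> nat) : R := (Num.sqrt pi ^+ d)^-1 * \prod_(i < d) hwt (mu i).

Lemma hw_gt0 mu : 0 < hw mu.
Proof.
by rewrite mulr_gt0// ?invr_gt0 ?exprn_gt0 ?sqrtr_gt0 ?pi_gt0// prodr_gt0// => i _; exact: hwt_gt0.
Qed.

(* A multi-index of degree [k] has entries less than [k.+1], which makes the sums over
   such multi-indices finite; [mi] forgets the bound. *)
Definition mi n (mu : {ffun 'I_d -> 'I_n}) (i : 'I_d) : nat := mu i.

(* The integral kernel of the projection [P_k]. *)
Definition Pk (k : nat) x y : R :=
  \sum_(mu : {ffun 'I_d -> 'I_k.+1} | (\sum_i mu i == k)%N) hw (mi mu) * hermf (mi mu) x * hermf (mi mu) y.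

Lemma Pk_ge0 k x : 0 <= Pk k x x.
Proof.
by apply: sumr_ge0 => mu _; rewrite -mulrA mulr_ge0 ?(ltW (hw_gt0 _))// -expr2 sqr_ge0.
Qed.

(** The weighted arithmetic-geometric mean inequality, term by term. The weight [l] is left free so
    that [sum_Pk_le] can keep decay in one of the two points. *)
Lemma Pk_le k x y (l : R) : 0 < l -> `|Pk k x y| <= (l * Pk k x x + l^-1 * Pk k y y) / 2.
Proof.
move=> l0; apply: (le_trans (ler_norm_sum _ _ _)).
rewrite /Pk !mulr_sumr -big_split/= mulr_suml; apply: ler_sum => mu _.
have w0 := hw_gt0 (mi mu); set w := hw _ in w0 *; set a := hermf _ x; set b := hermf _ y.
have h1 : 0 <= w * l^-1 * (l * a + b) ^+ 2 by rewrite mulr_ge0 ?sqr_ge0// mulr_ge0 ?ltW// invr_gt0.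
have h2 : 0 <= w * l^-1 * (l * a - b) ^+ 2 by rewrite mulr_ge0 ?sqr_ge0// mulr_ge0 ?ltW// invr_gt0.
have E1 : w * l^-1 * (l * a + b) ^+ 2 = l * (w * a * a) + l^-1 * (w * b * b) + 2 * (w * a * b).
  by field; rewrite gt_eqF.
have E2 : w * l^-1 * (l * a - b) ^+ 2 = l * (w * a * a) + l^-1 * (w * b * b) - 2 * (w * a * b).
  by field; rewrite gt_eqF.
by rewrite ler_norml; apply/andP; split; lra.
Qed.

(** The entries of a multi-index of degree [k] are at most [k], so their range can be enlarged;
    multi-indices of all degrees below [n] then live in one finite type. *)
Lemma sum_ffun_widen k n (F : ('I_d -> nat) -> R) : (k < n)%N ->
  \sum_(mu : {ffun 'I_d -> 'I_k.+1} | (\sum_i mu i == k)%N) F (mi mu) =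
  \sum_(mu : {ffun 'I_d -> 'I_n} | (\sum_i mu i == k)%N) F (mi mu).
Proof.
move=> kn.
pose h (mu : {ffun 'I_d -> 'I_k.+1}) : {ffun 'I_d -> 'I_n} := [ffun i => widen_ord kn (mu i)].
pose h' (mu : {ffun 'I_d -> 'I_n}) : {ffun 'I_d -> 'I_k.+1} := [ffun i => inord (mu i)].
rewrite (reindex_onto h h'); last first.
  move=> mu /eqP muk; apply/ffunP => i; apply/val_inj; rewrite !ffunE /= inordK//.
  by rewrite ltnS -muk (bigD1 i)//= leq_addr.
apply: eq_big => mu.
  have -> : h' (h mu) = mu by apply/ffunP => i; apply/val_inj; rewrite !ffunE /= inord_val.
  by rewrite eqxx andbT; congr (_ == _); apply: eq_bigr => i _; rewrite !ffunE.
by move=> _; congr F; apply/funext => i; rewrite /mi !ffunE.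
Qed.

Definition sdot x y : R := \sum_(i < d) x ord0 i * y ord0 i.

Definition mehler (r : R) x y : R := (Num.sqrt pi ^+ d)^-1 *
  expR (- (d%:R / 2 * ln (1 - r ^+ 2)) +
    (2 * r * sdot x y - r ^+ 2 * (sqnorm x + sqnorm y)) / (1 - r ^+ 2) - (sqnorm x + sqnorm y) / 2).

Section mehler_cvg.
Variables (x y : 'rV[R]_d) (r : R).
Hypothesis r01 : 0 <= r < 1.
Let a i n := hwt n * herm n (x ord0 i) * herm n (y ord0 i).
Let b (s : R) (mu : 'I_d -> nat) := \prod_(i < d) (a i (mu i) * s ^+ mu i).

Let prod_psum s n :
  \prod_(i < d) pseries (a i) s n = \sum_(mu : {ffun 'I_d -> 'I_n}) b s (mi mu).
Proof.
rewrite -(bigA_distr_bigA (fun i (j : 'I_n) => a i j * s ^+ j)).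
by apply: eq_bigr => i _; rewrite /pseries /series/= big_mkord.
Qed.

Let partial n :
  \sum_(k < n) \sum_(mu : {ffun 'I_d -> 'I_k.+1} | (\sum_i mu i == k)%N) b r (mi mu) =
  \sum_(mu : {ffun 'I_d -> 'I_n} | (\sum_i mu i < n)%N) b r (mi mu).
Proof.
under eq_bigr => k _ do rewrite (sum_ffun_widen (b r) (ltn_ord k)).
rewrite (exchange_big_dep (fun mu : {ffun 'I_d -> 'I_n} => (\sum_i mu i < n)%N))/=; last first.
  by move=> k mu _ /eqP ->; exact: ltn_ord.
apply: eq_bigr => mu mun.
rewrite (big_pred1 (Ordinal mun))// => k; rewrite /= eq_sym.
Qed.

(** An intermediate radius: the one-variable series still converge absolutely at [s], and the ratio
    [r / s < 1] produces the decay of the tail. *)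
Let s := (1 + r) / 2.

(** The product of partial sums runs over the cube of multi-indices with entries below [n], the
    partial sum in [k] over those of degree below [n]. What remains has degree at least [n], where
    [r^|mu| <= (r/s)^n s^|mu|]. *)
Let tail n : `|\prod_(i < d) pseries (a i) r n -
  \sum_(k < n) \sum_(mu : {ffun 'I_d -> 'I_k.+1} | (\sum_i mu i == k)%N) b r (mi mu)| <=
  (r / s) ^+ n * \prod_(i < d) psum (fun k => `|a i k|) s.
Proof.
have [r0 r1] := andP r01.
have s0 : 0 < s by rewrite /s; lra.
have s1 : `|s| < 1 by rewrite gtr0_norm// /s; lra.
rewrite partial prod_psum (bigID (fun mu : {ffun 'I_d -> 'I_n} => (\sum_i mu i < n)%N))/=.
rewrite addrAC subrr add0r (le_trans (ler_norm_sum _ _ _))//.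
have rs : 0 <= r / s <= 1 by rewrite divr_ge0 ?(ltW s0)//= ler_pdivrMr// mul1r /s; lra.
have [rs0 rs1] := andP rs.
apply: (@le_trans _ _ ((r / s) ^+ n * \sum_(mu : {ffun 'I_d -> 'I_n}) \prod_(i < d) (`|a i (mu i)| * s ^+ mu i))).
  rewrite mulr_sumr [leRHS](bigID (fun mu : {ffun 'I_d -> 'I_n} => (\sum_i mu i < n)%N))/=.
  rewrite ler_wpDl//.
    by apply: sumr_ge0 => mu _; rewrite mulr_ge0 ?exprn_ge0// prodr_ge0// => i _;
      rewrite mulr_ge0// exprn_ge0// ltW.
  apply: ler_sum => mu; rewrite -leqNgt => nmu.
  have -> : `|b r (mi mu)| = (r / s) ^+ (\sum_i mu i) * \prod_(i < d) (`|a i (mu i)| * s ^+ mu i).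
    rewrite /b normr_prod -prodrXr -big_split/=; apply: eq_bigr => i _.
    rewrite normrM normrX (ger0_norm r0) mulrCA -exprMn divfK// gt_eqF//.
  apply: ler_wpM2r.
    by apply: prodr_ge0 => i _; rewrite mulr_ge0// exprn_ge0// ltW.
  by apply: ler_wiXn2l.
apply: ler_wpM2l; first exact: exprn_ge0.
rewrite -(bigA_distr_bigA (fun i (j : 'I_n) => `|a i j| * s ^+ j)).
apply: ler_prod => i _; apply/andP; split.
  by apply: sumr_ge0 => j _; rewrite mulr_ge0// exprn_ge0// ltW.
have sa := subexp_norm (subexp_mehler (x ord0 i) (y ord0 i)).
rewrite -(big_mkord xpredT (fun j => `|a i j| * s ^+ j)).
apply: (nondecreasing_cvgn_le _ (subexp_cvg sa s1)).
apply/nondecreasing_seqP => m; rewrite /pseries /series/= big_nat_recr//= lerDl.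
by rewrite mulr_ge0// exprn_ge0// ltW.
Qed.

Lemma mehler_cvg : series (fun k => Pk k x y * r ^+ k) @ \oo --> mehler r x y.
Proof.
have [r0 r1] := andP r01.
have s0 : 0 < s by rewrite /s; lra.
pose c := (Num.sqrt pi ^+ d)^-1 * (expR (- (sqnorm x / 2)) * expR (- (sqnorm y / 2))) : R.
have gE (z : 'rV[R]_d) : expR (- (sqnorm z / 2)) = \prod_(i < d) expR (- (z ord0 i ^+ 2 / 2)).
  by rewrite -expR_sum sumrN -mulr_suml.
have E n : series (fun k => Pk k x y * r ^+ k) n = c *
    \sum_(k < n) \sum_(mu : {ffun 'I_d -> 'I_k.+1} | (\sum_i mu i == k)%N) b r (mi mu).
  rewrite /series/= big_mkord mulr_sumr; apply: eq_bigr => k _.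
  rewrite /Pk mulr_suml mulr_sumr; apply: eq_bigr => mu /eqP muk.
  rewrite /b /a /c /hw /hermf !gE /hf -[in r ^+ k]muk -prodrXr !big_split/=.
  rewrite ?big_split/=. ring.
have -> : mehler r x y = c * \prod_(i < d) psum (a i) r.
  rewrite /mehler /c -[RHS]mulrA; congr (_ * _).
  under eq_bigr do rewrite mehler1//.
  rewrite -expR_sum -!expRD; congr expR.
  rewrite big_split/= sumr_const card_ord -mulr_suml sumrB -!mulr_sumr big_split/=.
  by rewrite -mulr_natr /sdot /sqnorm; field; rewrite subr_eq0; apply/eqP => h; nra.
pose S n := \sum_(k < n) \sum_(mu : {ffun 'I_d -> 'I_k.+1} | (\sum_i mu i == k)%N) b r (mi mu).
rewrite (_ : series _ = (fun n => c * S n)); last exact/funext.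
have cp : (fun n => \prod_(i < d) pseries (a i) r n) @ \oo --> \prod_(i < d) psum (a i) r.
  apply: cvg_big => [z|i _]; first by apply: cvgM; [exact: cvg_fst|exact: cvg_snd].
  apply: psum_cvg; first exact: subexp_mehler.
  by rewrite ger0_norm.
have T0 : (fun n => (r / s) ^+ n * \prod_(i < d) psum (fun k => `|a i k|) s) @ \oo --> (0 : R).
  rewrite -[X in _ --> X](mul0r (\prod_(i < d) psum (fun k => `|a i k|) s)).
  apply: cvgMl; apply: cvg_expr; rewrite ger0_norm; last by apply: divr_ge0; [|exact: ltW].
  by rewrite ltr_pdivrMr// mul1r /s; lra.
apply: cvgMr.
have SE : S = (fun n => \prod_(i < d) pseries (a i) r n - (\prod_(i < d) pseries (a i) r n - S n)).
  by apply/funext => n; rewrite subKr.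
rewrite SE -[X in _ --> X]subr0; apply: cvgB cp _.
apply: squeeze_cvgr; [|by rewrite -[X in _ --> X]oppr0; apply: cvgN; exact: T0|exact: T0].
by apply: nearW => n; rewrite -ler_norml; exact: tail.
Qed.

End mehler_cvg.

(** The Gaussian prefactor [(pi (1 - r^2))^(- d/2)], which is the value of Mehler's kernel at the
    origin. *)
Definition mehler0 (r : R) : R := (Num.sqrt pi ^+ d)^-1 * expR (- (d%:R / 2 * ln (1 - r ^+ 2))).

Lemma mehler0_gt0 r : 0 < mehler0 r.
Proof. by rewrite mulr_gt0 ?expR_gt0// invr_gt0 exprn_gt0// sqrtr_gt0 pi_gt0. Qed.

Lemma mehler_diag r x : 0 <= r < 1 ->
  mehler r x x = mehler0 r * expR (- ((1 - r) / (1 + r) * sqnorm x)).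
Proof.
move=> /andP[r0 r1]; rewrite /mehler /mehler0 -[RHS]mulrA -expRD; congr (_ * expR _).
rewrite (_ : sdot x x = sqnorm x); last by apply: eq_bigr => i _; rewrite expr2.
have h1 : 1 - r ^+ 2 = (1 - r) * (1 + r) by ring.
have h2 : 1 - r != 0 by rewrite gt_eqF//; lra.
have h3 : 1 + r != 0 by rewrite gt_eqF//; lra.
rewrite -!addrA; congr (_ + _); rewrite h1; field.
by rewrite h2 h3.
Qed.

Lemma sum_Pk_diag r x n : 0 <= r < 1 ->
  \sum_(k < n) Pk k x x * r ^+ k <= mehler0 r * expR (- ((1 - r) / (1 + r) * sqnorm x)).
Proof.
move=> r01; rewrite -mehler_diag//.
have c := @mehler_cvg x x r r01; have [r0 r1] := andP r01.
rewrite -(cvg_lim (@Rhausdorff R) c) -(big_mkord xpredT (fun k => Pk k x x * r ^+ k)).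
apply: (nondecreasing_cvgn_le _ (cvgP _ c)).
apply/nondecreasing_seqP => m; rewrite /series/= big_nat_recr//= lerDl.
by rewrite mulr_ge0 ?Pk_ge0 ?exprn_ge0.
Qed.

Lemma sqnorm_ge0 x : 0 <= sqnorm x.
Proof. by apply: sumr_ge0 => i _; exact: sqr_ge0. Qed.

Lemma sum_Pk_le r x y n : 0 <= r < 1 ->
  \sum_(k < n) `|Pk k x y| * r ^+ k <=
  mehler0 r * expR (- ((1 - r) / (1 + r) / 2 * sqnorm y)).
Proof.
move=> r01; have [r0 r1] := andP r01; set c := (1 - r) / (1 + r).
have c0 : 0 <= c by rewrite divr_ge0//; lra.
(* The weight trades the decay in [x] for half of the decay in [y]. Up to the prefactor, the
   diagonal sum at [x] is at most 1 and is multiplied by [l], while that at [y] is at most [l * l]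
   and is divided by [l]. *)
set l := expR (- (c / 2 * sqnorm y)).
have l0 : 0 < l by exact: expR_gt0.
apply: (@le_trans _ _ (\sum_(k < n) (l / 2 * (Pk k x x * r ^+ k) + l^-1 / 2 * (Pk k y y * r ^+ k)))).
  apply: ler_sum => k _.
  have -> : l / 2 * (Pk k x x * r ^+ k) + l^-1 / 2 * (Pk k y y * r ^+ k) =
    (l * Pk k x x + l^-1 * Pk k y y) / 2 * r ^+ k by field; rewrite gt_eqF.
  by rewrite ler_wpM2r ?exprn_ge0// Pk_le.
rewrite big_split/= -!mulr_sumr.
have h1 := sum_Pk_diag x n r01; have h2 := sum_Pk_diag y n r01.
have e1 : expR (- (c * sqnorm x)) <= 1.
  by rewrite -expR0 ler_expR oppr_le0 mulr_ge0// sqnorm_ge0.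
have e2 : expR (- (c * sqnorm y)) = l * l.
  by rewrite /l -expRD; congr expR; field.
have m0 := mehler0_gt0 r.
have -> : mehler0 r * l = l / 2 * mehler0 r + l^-1 / 2 * (mehler0 r * expR (- (c * sqnorm y))).
  by rewrite e2; field; rewrite gt_eqF.
apply: lerD; apply: ler_wpM2l.
- by rewrite divr_ge0// ltW.
- by apply: (le_trans h1); rewrite ler_piMr// ltW.
- by rewrite divr_ge0// invr_ge0 ltW.
- exact: h2.
Qed.

(** A single term is at most the whole sum of absolute values in Mehler's series. At
    [r = (k+1)/(k+2)] the power [r^k] is at least [1/e] and [1 - r^2] at least [1/(k+2)], so the
    prefactor grows polynomially; its exponent [d/2] is rounded up to the natural number [d]. *)
Lemma Pk_growth : exists2 C : R, 0 < C & forall k x y, `|Pk k x y| <= C * k.+2%:R ^+ d.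
Proof.
exists ((Num.sqrt pi ^+ d)^-1 * expR 1).
  by rewrite mulr_gt0 ?expR_gt0// invr_gt0 exprn_gt0// sqrtr_gt0 pi_gt0.
move=> k x y; pose r : R := k.+1%:R / k.+2%:R.
have k2 : (0 : R) < k.+2%:R by [].
have r0 : 0 < r by rewrite divr_gt0.
have r1 : r < 1 by rewrite ltr_pdivrMr// mul1r ltr_nat.
have r01 : 0 <= r < 1 by rewrite ltW.
have h := sum_Pk_le x y k.+1 r01.
have h1 : `|Pk k x y| * r ^+ k <= mehler0 r.
  apply: (@le_trans _ _ (\sum_(j < k.+1) `|Pk j x y| * r ^+ j)).
    rewrite big_ord_recr/= lerDr; apply: sumr_ge0 => j _.
    by rewrite mulr_ge0// exprn_ge0// ltW.
  apply: (le_trans h); rewrite ler_piMr ?(ltW (mehler0_gt0 _))//.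
  rewrite -[leRHS]expR0 ler_expR oppr_le0 mulr_ge0 ?sqnorm_ge0// divr_ge0//.
  by apply: divr_ge0; [rewrite subr_ge0 ltW|rewrite addr_ge0// ltW].
have h2 : expR (- 1) <= r ^+ k.
  have : expR (- k.+1%:R^-1) <= r.
    rewrite expRN -[leRHS]invrK lef_pV2 ?posrE ?expR_gt0 ?invr_gt0//.
    rewrite /r invf_div (le_trans _ (expR_ge1Dx _))//.
    by rewrite -[k.+2%:R]natr1 mulrDl divff ?mul1r// gt_eqF.
  move=> /(@lerXn2r _ k) => /(_ _ _) h'.
  have {}h' := h' (expR_ge0 _) (ltW r0).
  apply: le_trans h'; rewrite -expRM_natl ler_expR mulrN lerN2 ler_pdivrMr// mul1r.
  by rewrite ler_nat.
have h3 : `|Pk k x y| <= mehler0 r * expR 1.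
  have e1 : 0 < r ^+ k by rewrite exprn_gt0.
  rewrite -(ler_pM2r e1); apply: (le_trans h1).
  rewrite -mulrA ler_peMr ?(ltW (mehler0_gt0 _))//.
  by rewrite -[leLHS](expRxMexpNx_1 1) ler_wpM2l ?expR_ge0.
apply: (le_trans h3); rewrite /mehler0 -!mulrA ler_wpM2l ?invr_ge0 ?exprn_ge0 ?sqrtr_ge0//.
rewrite mulrC ler_wpM2l ?expR_ge0//.
have -> : k.+2%:R ^+ d = expR (d%:R * ln k.+2%:R) :> R by rewrite expRM_natl lnK// posrE.
rewrite ler_expR (_ : - _ = d%:R * (- ln (1 - r ^+ 2) / 2)); last by field.
rewrite ler_wpM2l//.
have l0 : 0 <= ln k.+2%:R :> R by rewrite ln_ge0// ler1n.
have : - ln (1 - r ^+ 2) <= ln k.+2%:R.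
  have h4 : k.+2%:R^-1 <= 1 - r ^+ 2.
    have -> : k.+2%:R^-1 = 1 - r.
      have -> : r = (k.+2%:R - 1) / k.+2%:R by rewrite /r -[k.+2%:R]natr1 addrK.
      by move: (gt_eqF k2); move: (k.+2%:R) => N /negbT N0; field.
    by have := ltW r0; nra.
  have h5 : 0 < 1 - r ^+ 2 by apply: lt_le_trans h4; rewrite invr_gt0.
  rewrite -lnV ?posrE// ler_ln ?posrE ?invr_gt0//.
  by rewrite -[leRHS]invrK lef_pV2 ?posrE ?invr_gt0.
by lra.
Qed.

End coordinates.

(** * Orthogonality of eigenfunctions *)

Section gaussian_integrals.
Context {R : realType}.
Local Notation mu := (@lebesgue_measure R).

Lemma integral_gauss (c a : R) : 0 < c ->
  (\int[mu]_y (expR (- (c * (y - a) ^+ 2)))%:E = (Num.sqrt (pi / c))%:E)%E.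
Proof.
(* The normal density with exponent [c (y - a)^2] has variance [1/(2c)]. *)
move=> c0; pose s := Num.sqrt (c^-1 / 2).
have s0 : 0 < s by rewrite sqrtr_gt0 divr_gt0// invr_gt0.
have s2 : s ^+ 2 = c^-1 / 2 by rewrite sqr_sqrtr// divr_ge0// invr_ge0 ltW.
have := @integral_normal_pdf R a s => H.
have E y : expR (- (c * (y - a) ^+ 2)) = Num.sqrt (pi / c) * normal_pdf a s y.
  rewrite (normal_pdfE _ (lt0r_neq0 s0)) /normal_peak /normal_fun s2.
  have -> : c^-1 / 2 * pi *+ 2 = pi / c by rewrite mulr2n; field; rewrite gt_eqF.
  rewrite [RHS]mulrA divff ?mul1r; last by rewrite gt_eqF// sqrtr_gt0 divr_gt0// pi_gt0.
  congr expR; rewrite mulr2n; field; rewrite gt_eqF//.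
under eq_integral do rewrite E EFinM.
rewrite ge0_integralZl_EFin//; first by rewrite H mule1.
- by move=> y _; rewrite lee_fin normal_pdf_ge0.
- by apply/measurable_EFinP; exact: measurable_normal_pdf.
Qed.

Lemma expR_sqnormE d (c : R) (x : 'rV[R]_d) :
  expR (- (c * sqnorm x)) = \prod_(i < d) expR (- (c * x ord0 i ^+ 2)).
Proof. by rewrite -expR_sum sumrN mulr_sumr. Qed.

Lemma integral_gauss_rV d (c : R) (a : 'rV[R]_d) : 0 < c ->
  (\int[lebesgue_rV d]_y (expR (- (c * sqnorm (y - a))))%:E = (Num.sqrt (pi / c) ^+ d)%:E)%E.
Proof.
move=> c0.
under eq_integral => y _.
  rewrite expR_sqnormE; under eq_bigr do rewrite !mxE.
  over.
rewrite (@ge0_integral_rV_prod R d (fun i t => expR (- (c * (t - a ord0 i) ^+ 2))))//.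
  under eq_bigr do rewrite integral_gauss//.
  by rewrite prodEFin prodr_const card_ord.
move=> i; apply: measurableT_comp => //; apply: measurableT_comp => //.
apply: measurable_funM => //; apply: measurable_funX; exact: measurable_funB.
Qed.

Lemma smoothR_expR d (g : 'rV[R]_d -> R) : smoothR g -> smoothR (fun x => expR (g x)).
Proof. by move=> sg; apply: (@smoothR_comp R _ (fun=> expR)) => //. Qed.

Lemma intg_gauss_rV d (c : R) (a : 'rV[R]_d) : 0 < c ->
  (lebesgue_rV d).-integrable setT (EFin \o (fun y => expR (- (c * sqnorm (y - a))))).
Proof.
move=> c0; apply/integrableP; split.
  apply/measurable_EFinP; apply: continuous_measurable_rV; apply: smoothR_cont.
  apply: smoothR_expR; apply: smoothR_opp; apply: smoothR_mul; first exact: smoothR_cst.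
  apply: smoothR_sum => i _.
  under eq_fun do rewrite !mxE.
  by apply: smoothR_mul; apply: smoothR_sub; [exact: smoothR_coord|exact: smoothR_cst|exact: smoothR_coord|exact: smoothR_cst].
under eq_integral => y _ do rewrite /= ger0_norm ?expR_ge0//.
by rewrite integral_gauss_rV// ltry.
Qed.

Lemma intg_gauss0_rV d (c : R) : 0 < c ->
  (lebesgue_rV d).-integrable setT (EFin \o (fun y => expR (- (c * sqnorm y)))).
Proof. by move=> c0; have := @intg_gauss_rV d c 0 c0; under eq_fun do rewrite subr0. Qed.

Lemma intg_mul_L2 d1 (T : measurableType d1) (m : {measure set T -> \bar R}) (f g : T -> R) :
  measurable_fun setT f -> measurable_fun setT g ->
  m.-integrable setT (EFin \o (fun x => f x ^+ 2)) ->
  m.-integrable setT (EFin \o (fun x => g x ^+ 2)) ->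
  m.-integrable setT (EFin \o (fun x => f x * g x)).
Proof.
move=> mf mg f2 g2; apply: (@intg_le _ _ _ _ _ measurableT _ (fun x => f x ^+ 2 + g x ^+ 2)).
- exact: measurable_funM.
- by move=> x _; have := @norm_mul_le R 1 (f x) (g x) ltr01; rewrite !mul1r.
- exact: intgD.
Qed.

End gaussian_integrals.

Section continuous_pointwise.
Context {R : realType} {V : normedModType R}.
Implicit Types f g : V -> R.

Lemma continuousR_mul f g : continuous f -> continuous g -> continuous (fun x => f x * g x).
Proof. by move=> cf cg x; apply: cvgM; [exact: cf|exact: cg]. Qed.

Lemma continuousR_add f g : continuous f -> continuous g -> continuous (fun x => f x + g x).
Proof. by move=> cf cg x; apply: cvgD; [exact: cf|exact: cg]. Qed.

Lemma continuousR_cst (c : R) : continuous (fun _ : V => c).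
Proof. by move=> x; exact: cvg_cst. Qed.

End continuous_pointwise.

(** * Powers of the positive part, for the cutoff *)

Section cutoff.
Context {R : realType}.

(** A quadratic remainder determines the derivative directly, which also works at the corner of
    [pos], where the product and chain rules do not apply. *)
Lemma is_derive_quad (f : R -> R) (s l C : R) :
  (forall h, `|f (h + s) - f s - l * h| <= C * h ^+ 2) -> is_derive s (1 : R) f l.
Proof.
move=> fh.
have H : h^-1 *: (f (h *: (1:R) + s) - f s) @[h --> (0:R)^'] --> l.
  apply/cvgr_dnbhsP => u [u0 uc].
  apply/subr_cvg0; apply/norm_cvg0P.
  apply: (@squeeze_cvgr _ _ _ _ (cst 0) (fun n => C * `|u n|)).
  - apply: nearW => n; rewrite normr_ge0/= /GRing.scale/= mulr1.
    have un := u0 n; have un' : 0 < `|u n| by rewrite normr_gt0.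
    rewrite -(ler_pM2r un') -normrM mulrBl mulrAC mulVf// mul1r.
    rewrite -mulrA -normrM -expr2; apply: (le_trans (fh _)).
    by rewrite ger0_norm ?sqr_ge0.
  - exact: cvg_cst.
  - by rewrite -[X in _ --> X](mulr0 C); apply: cvgMr; move/cvg_norm : uc; rewrite normr0.
split; first by apply/cvg_ex; exists l.
exact: cvg_lim H.
Qed.

Definition pos (s : R) : R := Num.max s 0.

Lemma is_derive_pos2 s : is_derive s (1 : R) (fun s => pos s ^+ 2) (2 * pos s).
Proof.
apply: (@is_derive_quad _ _ _ 3) => h; rewrite /pos /Num.max.
rewrite ler_norml; case: ltP => h1; case: ltP => h2; apply/andP; split; nra.
Qed.

Lemma pos3E s : pos s ^+ 3 = s * pos s ^+ 2.
Proof. by rewrite /pos /Num.max; case: ltP => h; rewrite ?expr0n/= ?mulr0// exprS. Qed.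

Lemma is_derive_pos3 s : is_derive s (1 : R) (fun s => pos s ^+ 3) (3 * pos s ^+ 2).
Proof.
under [X in is_derive _ _ X]eq_fun do rewrite pos3E.
apply: (is_derive_eq (is_derive_mul (is_derive_id s 1) (is_derive_pos2 s))).
by rewrite /pos /Num.max; case: ltP => h; ring.
Qed.

Lemma pos_cont : continuous pos.
Proof.
move=> s; rewrite (_ : pos = (fun s => (s + `|s|) / 2)).
  by apply: cvgMl; apply: cvgD; [exact: cvg_id|exact: norm_continuous].
apply/funext => t; rewrite /pos /Num.max; case: ltP => h.
  by rewrite ltr0_norm//; lra.
by rewrite ger0_norm//; lra.
Qed.

End cutoff.

Section eigenfunctions.
Context {R : realType} {d : nat}.
Implicit Types (x y : 'rV[R]_d) (h : 'rV[R]_d -> R).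
Local Notation leb := (@lebesgue_rV R d).
Local Notation intg f := (leb.-integrable setT (EFin \o f)).

Lemma measurable_smoothR h : smoothR h -> measurable_fun setT h.
Proof. by move=> /smoothR_cont; exact: continuous_measurable_rV. Qed.

(** Gaussian decay is read off one term of Mehler's series on the diagonal. At [r = 1/2] the
    exponent is [(1-r)/(1+r) = 1/3], which bounds the square of the Hermite function, hence [1/6]
    after taking roots. *)
Lemma hermf_bound (mu : 'I_d -> nat) :
  exists2 C : R, 0 < C & forall x, `|hermf mu x| <= C * expR (- (6^-1 * sqnorm x)).
Proof.
pose k := (\sum_i mu i)%N; pose mu' : {ffun 'I_d -> 'I_k.+1} := [ffun i => inord (mu i)].
have mE : mi mu' = mu.
  by apply/funext => i; rewrite /mi ffunE inordK// ltnS /k (bigD1 i)//= leq_addr.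
have r01 : 0 <= (2^-1 : R) < 1 by apply/andP; split; lra.
have w0 := @hw_gt0 R d mu.
have p0 : 0 < (2^-1 : R) ^+ k by rewrite exprn_gt0.
pose C := mehler0 (R := R) (d := d) 2^-1 / (hw mu * 2^-1 ^+ k).
have C0 : 0 < C by rewrite divr_gt0 ?mehler0_gt0// mulr_gt0.
exists (Num.sqrt C); first by rewrite sqrtr_gt0.
move=> x; rewrite -(@ler_pXn2r _ 2)// ?nnegrE ?mulr_ge0 ?sqrtr_ge0 ?expR_ge0//.
rewrite real_normK ?num_real// exprMn sqr_sqrtr ?(ltW C0)// -expRM_natl.
have := sum_Pk_diag x k.+1 r01; rewrite big_ord_recr/=.
have -> : (1 - 2^-1) / (1 + 2^-1) = 3^-1 :> R by field.
set S := \sum_(_ < _) _ => H.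
have S0 : 0 <= S by apply: sumr_ge0 => i _; rewrite mulr_ge0 ?Pk_ge0// exprn_ge0.
have {S0 H}H : Pk k x x * 2^-1 ^+ k <= mehler0 (R := R) (d := d) 2^-1 * expR (- (3^-1 * sqnorm x)) by lra.
have H2 : hw mu * hermf mu x ^+ 2 <= Pk k x x.
  rewrite /Pk (bigD1 mu')/=; last first.
    by apply/eqP; rewrite /k; apply: eq_bigr => i _; have := congr1 (fun f => f i) mE.
  rewrite mE -mulrA -expr2 lerDl; apply: sumr_ge0 => nu _.
  by rewrite -mulrA -expr2 mulr_ge0 ?sqr_ge0// ltW// hw_gt0.
have -> : 2 * - (6^-1 * sqnorm x) = - (3^-1 * sqnorm x) by field.
rewrite /C mulrAC ler_pdivlMr; last exact: mulr_gt0.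
apply: le_trans H; rewrite [leLHS]mulrA ler_wpM2r ?(ltW p0)//.
by rewrite mulrC.
Qed.

Lemma intg_hermf2 mu : intg (fun x => hermf mu x ^+ 2).
Proof.
have [C C0 hC] := hermf_bound mu.
apply: (@intg_le _ _ _ _ _ measurableT _ (fun x => C ^+ 2 * expR (- (3^-1 * sqnorm x)))).
- by apply: measurable_funX; apply: measurable_smoothR; exact: smoothR_hermf.
- move=> x _; rewrite normrX.
  have -> : - (3^-1 * sqnorm x) = 2 * (- (6^-1 * sqnorm x)) by field.
  by rewrite expRM_natl -exprMn lerXn2r ?nnegrE ?mulr_ge0 ?expR_ge0 ?(ltW C0).
- by apply: intgZl => //; apply: intg_gauss0_rV; rewrite invr_gt0.
Qed.

(** The real form of [osc_eigenspace]: a complex function lies in the latter exactly when its real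
    and imaginary parts satisfy this condition ([osc_eigenspaceP]). *)
Definition eigR (k : nat) h :=
  [/\ smoothR h, intg (fun x => h x ^+ 2) & forall x, osc_re h x = (2 * k + d)%:R * h x].

Lemma eigR_hermf mu : eigR (\sum_i mu i)%N (hermf mu).
Proof. by split; [exact: smoothR_hermf|exact: intg_hermf2|move=> x; rewrite osc_re_hermf]. Qed.

Let ei (i : 'I_d) : 'rV[R]_d := delta_mx ord0 i.

Section orthogonality.
Variables (k : nat) (h : 'rV[R]_d -> R) (mu : 'I_d -> nat).
Hypothesis eh : eigR k h.
Let m := (\sum_i mu i)%N.
Let u := @hermf R d mu.
Let u1 i x := x ord0 i * u x - hermf (bump1 mu i) x.

Let p (n : nat) x : R := 1 - n.+1%:R ^- 2 * sqnorm x.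
Let p1 (n : nat) i x : R := - (n.+1%:R ^- 2 * (2 * x ord0 i)).

Let is_derive_coord i x : is_derive x (ei i) (fun y => y ord0 i) 1.
Proof.
have := @smoothR_is_derive R _ (fun y : 'rV[R]_d => y ord0 i) (ei i) x (smoothR_coord i).
move=> H; apply: (is_derive_eq H); apply: derive_val.
apply/is_derive_line0; under eq_fun do rewrite !mxE !eqxx mulr1.
have H2 := is_derive_add (is_derive_id (0:R) (1:R)) (is_derive_cst (x ord0 i) (0:R) (1:R)).
by apply: (is_derive_eq H2); rewrite addr0.
Qed.

Let is_derive_p n i x : is_derive x (ei i) (p n) (p1 n i x).
Proof.
apply/is_derive_line0.
rewrite (_ : (fun s => _) = (fun s : R => 1 - n.+1%:R ^- 2 * ((s + x ord0 i) ^+ 2 + \sum_(j < d | j != i) x ord0 j ^+ 2))); last first.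
  apply/funext => s; rewrite /p /sqnorm (bigD1 i)//= !mxE !eqxx/= mulr1.
  do 3 congr (_ _ _); congr (_ + _); apply: eq_bigr => j ji.
  by rewrite !mxE eqxx/= (negbTE ji) mulr0 add0r.
have d1 : is_derive (0:R) (1:R) (fun s => s + x ord0 i) 1.
  have H2 := is_derive_add (is_derive_id (0:R) (1:R)) (is_derive_cst (x ord0 i) (0:R) (1:R)).
  by apply: (is_derive_eq H2); rewrite addr0.
have d2 := is_derive_add (is_derive_mul d1 d1) (is_derive_cst (\sum_(j < d | j != i) x ord0 j ^+ 2) (0:R) (1:R)).
have H := is_derive_sub (is_derive_cst (1:R) (0:R) (1:R)) (is_derive_cstmul (n.+1%:R ^- 2) d2).
by apply: (is_derive_eq H); rewrite /p1; ring.
Qed.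

(* The cube makes the cutoff twice continuously differentiable; its first and second
   derivatives tend to [0] as [n] grows. *)
Let chi n x := pos (p n x) ^+ 3.
Let chi1 n i x := 3 * pos (p n x) ^+ 2 * p1 n i x.
Let chi2 n i x := 3 * (2 * pos (p n x) * p1 n i x) * p1 n i x + 3 * pos (p n x) ^+ 2 * - (n.+1%:R ^- 2 * 2).

Let is_derive_chi n i x : is_derive x (ei i) (chi n) (chi1 n i x).
Proof. exact: (is_derive_chain (is_derive_pos3 _) (is_derive_p n i x)). Qed.

Let is_derive_chi1 n i x : is_derive x (ei i) (chi1 n i) (chi2 n i x).
Proof.
have H1 := is_derive_cstmul 3 (is_derive_chain (is_derive_pos2 _) (is_derive_p n i x)).
have H2 := is_derive_opp (is_derive_cstmul (n.+1%:R ^- 2) (is_derive_cstmul 2 (is_derive_coord i x))).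
apply: (is_derive_eq (is_derive_mul H1 H2)).
by rewrite /chi2 mulr1.
Qed.

Let cont_p n : continuous (p n).
Proof.
apply: smoothR_cont; apply: smoothR_sub; first exact: smoothR_cst.
by apply: smoothR_mul; [exact: smoothR_cst|exact: smoothR_sqnorm].
Qed.

Let cont_p1 n i : continuous (p1 n i).
Proof.
apply: smoothR_cont; apply: smoothR_opp; apply: smoothR_mul; first exact: smoothR_cst.
by apply: smoothR_mul; [exact: smoothR_cst|exact: smoothR_coord].
Qed.

Let cont_pp n : continuous (fun x => pos (p n x)).
Proof. by move=> x; apply: continuous_comp; [exact: cont_p|exact: pos_cont]. Qed.

Let cont_chi n : continuous (chi n).
Proof. by apply: continuousR_mul => //; apply: continuousR_mul; exact: cont_pp. Qed.

Let cont_chi1 n i : continuous (chi1 n i).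
Proof. by apply: continuousR_mul; [apply: continuousR_mul; [exact: continuousR_cst|apply: continuousR_mul; exact: cont_pp]|exact: cont_p1]. Qed.

Let cont_chi2 n i : continuous (chi2 n i).
Proof.
apply: continuousR_add; apply: continuousR_mul => //; last 2 first.
- by apply: continuousR_mul; [exact: continuousR_cst|apply: continuousR_mul].
- exact: continuousR_cst.
- by apply: continuousR_mul; [exact: continuousR_cst|apply: continuousR_mul => //; apply: continuousR_mul => //; exact: continuousR_cst].
Qed.

Let smoothR_u1 i : smoothR (u1 i).
Proof. by apply: smoothR_sub; [apply: smoothR_mul; [exact: smoothR_coord|exact: smoothR_hermf]|exact: smoothR_hermf]. Qed.

Let chi_out n y : n.+1%:R < `|y| -> chi n y = 0.
Proof.
move=> ny; rewrite /chi /pos (_ : Num.max _ _ = 0) ?expr0n//.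
apply/max_idPr; rewrite /p subr_le0.
have n0 : (0 : R) < n.+1%:R by [].
rewrite mulrC ler_pdivlMr ?exprn_gt0// mul1r.
(* The cutoff is Euclidean while [|y|] is the sup norm. The sup norm is at most the Euclidean one,
   so the second case is contradictory. *)
have [ny2|] := leP `|y| (Num.sqrt (sqnorm y)).
  rewrite -(sqr_sqrtr (sqnorm_ge0 y)) lerXn2r ?nnegrE ?sqrtr_ge0 ?(ltW n0)//.
  by rewrite (le_trans (ltW ny)).
rewrite ltNge norm_rV_le ?sqrtr_ge0// => /negP[]; apply/forallP => i.
rewrite -sqrtr_sqr ler_sqrt ?sqnorm_ge0// /sqnorm (bigD1 i)//= lerDl.
by apply: sumr_ge0 => j _; exact: sqr_ge0.
Qed.

(** The terms of the second derivative of [chi n * u] in which the cutoff is differentiated at least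
    once. *)
Let err n i x := chi2 n i x * u x + 2 * (chi1 n i x * u1 i x).

(** The Hermite function carries the cutoff and [h] is the unrestricted factor in Green's identity,
    since nothing is known about the derivatives of [h] at infinity. *)
Let green_i n i :
  \int[leb]_x (h x * (err n i x + chi n x * ((x ord0 i ^+ 2 - (2 * mu i + 1)%:R) * u x))) =
  \int[leb]_x (chi n x * u x * 'D_(ei i) (fun y => 'D_(ei i) h y) x).
Proof.
have [sh _ _] := eh.
have := @green_rV R d (fun x => chi n x * u x)
  (fun x => chi1 n i x * u x + chi n x * u1 i x)
  (fun x => err n i x + chi n x * ((x ord0 i ^+ 2 - (2 * mu i + 1)%:R) * u x))
  h (fun x => 'D_(ei i) h x) (fun x => 'D_(ei i) (fun y => 'D_(ei i) h y) x) (ei i) n.+1%:R.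
apply.
- by move=> x; apply: is_derive_mul; [exact: is_derive_chi|exact: is_derive_hermf].
- move=> x.
  have H1 := is_derive_mul (is_derive_chi1 n i x) (is_derive_hermf mu i x).
  have H2 := is_derive_mul (is_derive_chi n i x) (is_derive_hermf2 mu i x).
  apply: (is_derive_eq (is_derive_add H1 H2)).
  by rewrite /err /u1 /u; ring.
- by move=> x; exact: smoothR_is_derive.
- by move=> x; apply: smoothR_is_derive; exact: smoothR_derive.
- by apply: continuousR_mul; [exact: cont_chi|apply: smoothR_cont; exact: smoothR_hermf].
- have cu := smoothR_cont (smoothR_hermf mu); have cu1 := smoothR_cont (smoothR_u1 i).
  by apply: continuousR_add; apply: continuousR_mul => //.
- have cu := smoothR_cont (smoothR_hermf mu); have cu1 := smoothR_cont (smoothR_u1 i).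
  apply: continuousR_add.
    apply: continuousR_add; first by apply: continuousR_mul => //; exact: cont_chi2.
    by apply: continuousR_mul; [exact: continuousR_cst|apply: continuousR_mul => //; exact: cont_chi1].
  apply: continuousR_mul; first exact: cont_chi.
  apply: continuousR_mul => //; apply: smoothR_cont; apply: smoothR_sub; last exact: smoothR_cst.
  by apply: smoothR_mul; exact: smoothR_coord.
- exact: smoothR_cont.
- by apply: smoothR_cont; exact: smoothR_derive.
- by apply: smoothR_cont; apply: smoothR_derive; exact: smoothR_derive.
- by move=> y /chi_out ->; rewrite mul0r.
Qed.

(** A majorant free of [n]: the total error is at most [W x / (n+1)] by [err_le]. The constant 36 is
    a common, generous bound for the coefficients 24 and 6 in [chi2] and 12 in [2 * chi1]. *)
Let W x := 36 * \sum_(i < d) (1 + x ord0 i ^+ 2) * (`|u x| + `|u1 i x|).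

Let pos01 n x : 0 <= pos (p n x) <= 1.
Proof.
rewrite /pos le_max lexx orbT/= ge_max ler01 andbT /p.
by rewrite lerBlDr lerDl mulr_ge0 ?sqnorm_ge0// invr_ge0 exprn_ge0.
Qed.

Let chi2_le n i x : `|chi2 n i x| <= n.+1%:R^-1 * 36 * (1 + x ord0 i ^+ 2).
Proof.
have /andP[c0 c1] := pos01 n x; set c := pos (p n x) in c0 c1.
set e : R := n.+1%:R^-1.
have e0 : 0 < e by rewrite invr_gt0.
have e1 : e <= 1 by rewrite invf_le1// ler1n.
have E : n.+1%:R ^- 2 = e * e by rewrite -exprVn expr2.
rewrite /chi2 /p1 E -/c; set a := x ord0 i.
have ee : e * e <= e by rewrite -[leRHS]mulr1 ler_pM2l.
have ee0 : 0 <= e * e by rewrite mulr_ge0 ?(ltW e0).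
have cc0 : 0 <= c ^+ 2 by exact: sqr_ge0.
have cc1 : c ^+ 2 <= 1 by rewrite expr_le1.
have a0 : 0 <= a ^+ 2 by exact: sqr_ge0.
have q1 : e * e * (e * e) <= e by rewrite -[leRHS]mulr1; apply: ler_pM => //; exact: le_trans ee e1.
have q2 : c * (e * e * (e * e)) <= e by rewrite (le_trans _ q1)// ler_piMl// mulr_ge0.
have q2' : 0 <= c * (e * e * (e * e)) by rewrite mulr_ge0// mulr_ge0.
have q3 : c ^+ 2 * (e * e) <= e by rewrite (le_trans _ ee)// ler_piMl.
have q3' : 0 <= c ^+ 2 * (e * e) by exact: mulr_ge0.
rewrite (_ : 3 * _ * _ + _ = 24 * (c * (e * e * (e * e)) * a ^+ 2) - 6 * (c ^+ 2 * (e * e))); last by ring.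
have q4 : c * (e * e * (e * e)) * a ^+ 2 <= e * a ^+ 2 by exact: ler_wpM2r.
have q4' : 0 <= c * (e * e * (e * e)) * a ^+ 2 by exact: mulr_ge0.
by rewrite ler_norml; apply/andP; split; lra.
Qed.

Let chi1_le n i x : `|2 * chi1 n i x| <= n.+1%:R^-1 * 36 * (1 + x ord0 i ^+ 2).
Proof.
have /andP[c0 c1] := pos01 n x; set c := pos (p n x) in c0 c1.
set e : R := n.+1%:R^-1.
have e0 : 0 < e by rewrite invr_gt0.
have e1 : e <= 1 by rewrite invf_le1// ler1n.
have E : n.+1%:R ^- 2 = e * e by rewrite -exprVn expr2.
rewrite /chi1 /p1 E -/c; set a := x ord0 i.
have ee : e * e <= e by rewrite -[leRHS]mulr1 ler_pM2l.
have ee0 : 0 <= e * e by rewrite mulr_ge0 ?(ltW e0).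
have cc0 : 0 <= c ^+ 2 by exact: sqr_ge0.
have cc1 : c ^+ 2 <= 1 by rewrite expr_le1.
have q3 : c ^+ 2 * (e * e) <= e by rewrite (le_trans _ ee)// ler_piMl.
have q3' : 0 <= c ^+ 2 * (e * e) by exact: mulr_ge0.
rewrite (_ : 2 * _ = - (12 * (c ^+ 2 * (e * e)) * a)); last by ring.
rewrite normrN normrM ger0_norm; last by rewrite mulr_ge0.
have aa : `|a| <= 1 + a ^+ 2 by rewrite -[a ^+ 2]real_normK ?num_real//; nra.
have q5 : c ^+ 2 * (e * e) * `|a| <= e * (1 + a ^+ 2) by apply: ler_pM.
have q6 : 0 <= e * (1 + a ^+ 2) by rewrite mulr_ge0 ?(ltW e0)// addr_ge0// sqr_ge0.
by lra.
Qed.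

Let err_le n x : `|\sum_(i < d) err n i x| <= n.+1%:R^-1 * W x.
Proof.
rewrite /W mulr_sumr mulr_sumr (le_trans (ler_norm_sum _ _ _))//; apply: ler_sum => i _.
set T := n.+1%:R^-1 * 36 * (1 + x ord0 i ^+ 2).
rewrite (_ : _ * (36 * _) = T * `|u x| + T * `|u1 i x|); last by rewrite /T; ring.
rewrite /err (le_trans (ler_normD _ _))// mulrA; apply: lerD; rewrite normrM.
  by apply: ler_wpM2r => //; exact: chi2_le.
by apply: ler_wpM2r => //; exact: chi1_le.
Qed.

(** The bound [exp(- |x|^2 / 6)] for the Hermite functions is cut into four equal factors
    [E = exp(- |x|^2 / 24)]. The weights [1 + a^2] and [|a|] consume one factor each at the price of
    24, whence [576 = 24^2], and at least one factor is left. *)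
Let W_bound : exists C : R, forall x, `|W x| <= C * expR (- (24^-1 * sqnorm x)).
Proof.
have [C C0 uC] := hermf_bound mu.
have /choice[D hD] : forall i, exists D : R, 0 < D /\ forall x, `|hermf (bump1 mu i) x| <= D * expR (- (6^-1 * sqnorm x)).
  by move=> i; have [D ? ?] := hermf_bound (bump1 mu i); exists D.
exists (36 * \sum_(i < d) 576 * (C + (C + D i))).
move=> x; rewrite ger0_norm; last first.
  rewrite mulr_ge0//; apply: sumr_ge0 => i _.
  by apply: mulr_ge0; apply: addr_ge0 => //; exact: sqr_ge0.
rewrite /W -mulrA ler_wpM2l// mulr_suml; apply: ler_sum => i _.
have [D0 uD] := hD i; set E := expR (- (24^-1 * sqnorm x)).
have E0 : 0 < E by exact: expR_gt0.
have sx := sqnorm_ge0 x.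
have E1 : E <= 1 by rewrite /E -[leRHS]expR0 ler_expR; lra.
have E6 : expR (- (6^-1 * sqnorm x)) = E * E * (E * E).
  by rewrite /E -!expRD; congr expR; field.
have xi1 : x ord0 i ^+ 2 <= sqnorm x.
  rewrite /sqnorm (bigD1 i)//= lerDl; apply: sumr_ge0 => j _; exact: sqr_ge0.
set a := x ord0 i in xi1 *; have a0 : 0 <= a ^+ 2 by exact: sqr_ge0.
have H1 : (1 + a ^+ 2) * E <= 24.
  rewrite -ler_pdivlMr// -ler_pdivrMl// mulrC.
  rewrite -expRN opprK.
  have : 1 + 24^-1 * sqnorm x <= expR (24^-1 * sqnorm x) by exact: expR_ge1Dx.
  lra.
have aa : `|a| <= 1 + a ^+ 2.
  by have := normr_ge0 a; rewrite -[a ^+ 2]real_normK ?num_real//; nra.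
have H2 : `|a| * E <= 24 by apply: le_trans H1; rewrite ler_pM2r.
have hu := uC x; have hv := uD x; rewrite E6 -/(u x) in hu hv.
have h1 : `|u1 i x| <= `|a| * `|u x| + `|hermf (bump1 mu i) x|.
  by rewrite /u1 (le_trans (ler_normB _ _))// normrM.
set v := `|hermf _ x| in hv h1; set w := `|u1 i x| in h1 *.
apply: (@le_trans _ _ ((1 + a ^+ 2) * ((C + (`|a| * C + D i)) * (E * E * (E * E))))).
  apply: ler_wpM2l; first lra.
  have : `|a| * `|u x| <= `|a| * (C * (E * E * (E * E))) by exact: ler_wpM2l.
  by rewrite mulrDl mulrDl -mulrA; lra.
set P := (1 + a ^+ 2) * E in H1; set Q := `|a| * E in H2.
have P0 : 0 <= P by rewrite mulr_ge0 ?(ltW E0)//; lra.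
have Q0 : 0 <= Q by rewrite mulr_ge0 ?(ltW E0).
have EE : E * E <= E by rewrite -[leRHS]mulr1 ler_pM2l.
have PE : P * (E * E * E) <= 576 * E.
  apply: ler_pM => //; [by rewrite !mulr_ge0 ?(ltW E0)|lra|].
  by rewrite -[leRHS]mul1r ler_pM2r//; nra.
have PQE : P * Q * (E * E) <= 576 * E.
  apply: ler_pM => //; [by rewrite mulr_ge0|by rewrite mulr_ge0 ?(ltW E0)|].
  by have := ler_pM P0 Q0 H1 H2; lra.
have -> : (1 + a ^+ 2) * ((C + (`|a| * C + D i)) * (E * E * (E * E))) =
   C * (P * (E * E * E)) + (C * (P * Q * (E * E)) + D i * (P * (E * E * E))) by rewrite /P /Q; ring.
have -> : 576 * (C + (C + D i)) * E = C * (576 * E) + (C * (576 * E) + D i * (576 * E)) by ring.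
apply: lerD; first by rewrite ler_pM2l.
by apply: lerD; rewrite ler_pM2l.
Qed.

Let intg_hu : intg (fun x => h x * u x).
Proof.
have [sh h2 _] := eh.
exact: (intg_mul_L2 (measurable_smoothR sh) (measurable_smoothR (smoothR_hermf mu)) h2 (intg_hermf2 mu)).
Qed.

Let measurable_W : measurable_fun setT W.
Proof.
apply: measurable_funM => //; apply: measurable_sum => i.
have mc := measurable_smoothR (smoothR_coord i); have mu_ := measurable_smoothR (smoothR_hermf mu).
have mu1 := measurable_smoothR (smoothR_u1 i).
apply: measurable_funM; apply: measurable_funD => //.
- exact: measurable_funX.
- exact: measurableT_comp.
- exact: measurableT_comp.
Qed.

Let intg_hW : intg (fun x => h x * W x).
Proof.
have [sh h2 _] := eh; have [C WC] := W_bound.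
apply: intg_mul_L2 => //; first exact: measurable_smoothR.
apply: (@intg_le _ _ _ _ _ measurableT _ (fun x => C ^+ 2 * expR (- (12^-1 * sqnorm x)))).
- exact: measurable_funX.
- move=> x _; rewrite normrX.
  have -> : - (12^-1 * sqnorm x) = 2 * (- (24^-1 * sqnorm x)) by field.
  rewrite expRM_natl -exprMn lerXn2r ?nnegrE//.
  by rewrite (le_trans _ (WC x)).
- by apply: intgZl => //; apply: intg_gauss0_rV; rewrite invr_gt0.
Qed.

(** Summed over the coordinates, the eigenvalue equations of [h] and of [u] cancel the potential
    [|x|^2] and leave the difference of the eigenvalues, up to the errors of the cutoff. *)
Let key n : \int[leb]_x ((2 * k%:R - 2 * m%:R) * (chi n x * (h x * u x)) + h x * \sum_(i < d) err n i x) = 0.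
Proof.
have [sh h2 oh] := eh.
have ch := smoothR_cont sh; have cu := smoothR_cont (smoothR_hermf mu).
have cs (f : 'rV[R]_d -> R) : continuous f -> (forall y, n.+1%:R < `|y| -> f y = 0) -> intg f.
  by move=> cf f0; exact: (cs_integrable_rV cf f0).
have D1 i : intg (fun x => h x * (err n i x + chi n x * ((x ord0 i ^+ 2 - (2 * mu i + 1)%:R) * u x))).
  apply: cs.
    apply: continuousR_mul => //; apply: continuousR_add.
      apply: continuousR_add; first by apply: continuousR_mul => //; exact: cont_chi2.
      by apply: continuousR_mul; [exact: continuousR_cst|apply: continuousR_mul; [exact: cont_chi1|apply: smoothR_cont]].
    apply: continuousR_mul; first exact: cont_chi.
    apply: continuousR_mul => //; apply: smoothR_cont; apply: smoothR_sub; last exact: smoothR_cst.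
    by apply: smoothR_mul; exact: smoothR_coord.
  move=> y ny; have chi0 := chi_out ny.
  have chi10 := is_derive_out (@chi_out n) ny (is_derive_chi n i y).
  have chi20 : chi2 n i y = 0.
    apply: (is_derive_out _ ny (is_derive_chi1 n i y)) => z nz.
    exact: (is_derive_out (@chi_out n) nz (is_derive_chi n i z)).
  by rewrite /err chi0 chi10 chi20 !(mul0r, mulr0) !addr0 mulr0.
have D2 i : intg (fun x => chi n x * u x * 'D_(ei i) (fun y => 'D_(ei i) h y) x).
  apply: cs => [|y /chi_out ->]; last by rewrite !mul0r.
  apply: continuousR_mul; first by apply: continuousR_mul => //; exact: cont_chi.
  by apply: smoothR_cont; apply: smoothR_derive; exact: smoothR_derive.
transitivity (\sum_(i < d) (\int[leb]_x (h x * (err n i x + chi n x * ((x ord0 i ^+ 2 - (2 * mu i + 1)%:R) * u x)))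
  - \int[leb]_x (chi n x * u x * 'D_(ei i) (fun y => 'D_(ei i) h y) x))); last first.
  by apply: big1 => i _; rewrite green_i subrr.
rewrite sumrB -!Rintegral_sum//; last first.
rewrite -RintegralB//; [|by apply: intg_sum|by apply: intg_sum].
apply: eq_Rintegral => x _.
have L : \sum_(i < d) 'D_(ei i) (fun y => 'D_(ei i) h y) x = (sqnorm x - (2 * k + d)%:R) * h x.
  by have := oh x; rewrite /osc_re /laplacian -/(ei _); lra.
have S1 : \sum_(i < d) (h x * (err n i x + chi n x * ((x ord0 i ^+ 2 - (2 * mu i + 1)%:R) * u x))) =
    h x * (\sum_(i < d) err n i x + chi n x * ((sqnorm x - (2 * m + d)%:R) * u x)).
  have S0 : \sum_(i < d) (x ord0 i ^+ 2 - (2 * mu i + 1)%:R) = sqnorm x - (2 * m + d)%:R.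
    by rewrite sumrB -/(sqnorm x) -natr_sum big_split/= -big_distrr/= sum1_card card_ord.
  by rewrite -mulr_sumr big_split/= -mulr_sumr -mulr_suml S0.
have S2 : \sum_(i < d) (chi n x * u x * 'D_(ei i) (fun y => 'D_(ei i) h y) x) =
    chi n x * u x * ((sqnorm x - (2 * k + d)%:R) * h x) by rewrite -mulr_sumr L.
rewrite S1 S2.
ring.
Qed.

(** As [n] grows, [chi n] tends to 1 boundedly and the errors are [1/(n+1)] times the integrable
    function [h * W], so the limit of [key] is [2 (k - m)] times the integral of [h * u]. *)
Lemma eigR_orth : m != k -> \int[leb]_x (h x * u x) = 0.
Proof.
move=> mk; have [sh h2 oh] := eh.
have ch := smoothR_cont sh; have cu := smoothR_cont (smoothR_hermf mu).
pose l : R := 2 * k%:R - 2 * m%:R.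
pose F n x := l * (chi n x * (h x * u x)) + h x * \sum_(i < d) err n i x.
have [] := @dominated_cvg_Rintegral _ _ R leb F (fun x => l * (h x * u x))
  (fun x => `|l| * `|h x * u x| + `|h x * W x|).
- move=> n; apply: continuous_measurable_rV; apply: continuousR_add.
    by apply: continuousR_mul; [exact: continuousR_cst|apply: continuousR_mul; [exact: cont_chi|apply: continuousR_mul]].
  apply: continuousR_mul => //.
  rewrite (_ : (fun x => \sum_(i < d) _) = (\sum_(i < d) err n i)); last first.
    by apply/funext => x; rewrite fct_sumE.
  elim/big_ind : _ => [|f g cf cg|i _]; [exact: continuousR_cst|exact: continuousR_add|].
  apply: continuousR_add; first by apply: continuousR_mul => //; exact: cont_chi2.
  by apply: continuousR_mul; [exact: continuousR_cst|apply: continuousR_mul; [exact: cont_chi1|apply: smoothR_cont]].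
- by apply: measurable_funM => //; apply: (intg_meas intg_hu).
- move=> x; rewrite -[X in _ --> X]addr0; apply: cvgD.
    apply: cvgMr; rewrite -[X in _ --> X]mul1r; apply: cvgMl.
    have c1 : p n x @[n --> \oo] --> (1 : R).
      rewrite -[X in _ --> X]subr0; apply: cvgB; first exact: cvg_cst.
      rewrite -[X in _ --> X](mul0r (sqnorm x)); apply: cvgMl.
      have hc : (n.+1%:R^-1 : R) @[n --> \oo] --> (0 : R) by exact: cvg_harmonic.
      have -> : (fun n : nat => n.+1%:R ^- 2 : R) = (fun n : nat => n.+1%:R^-1 * n.+1%:R^-1 : R).
        by apply/funext => n; rewrite -exprVn expr2.
      by rewrite -[X in _ --> X](mulr0 (0:R)); exact: cvgM.
    have c2 : pos (p n x) @[n --> \oo] --> (1 : R).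
      rewrite (_ : 1 = pos 1); last by rewrite /pos; apply/esym/max_idPl.
      by apply: (continuous_cvg _ (@pos_cont R 1)).
    rewrite -[X in _ --> X](expr1n R 3).
    by rewrite /chi exprS expr2; under eq_fun do rewrite exprS expr2; apply: cvgM => //; exact: cvgM.
  rewrite -[X in _ --> X](mulr0 (h x)); apply: cvgMr.
  apply/norm_cvg0P; apply: (@squeeze_cvgr _ _ _ _ (cst 0) (fun n => n.+1%:R^-1 * W x)).
  + by apply: nearW => n; rewrite normr_ge0 err_le.
  + exact: cvg_cst.
  + by rewrite -[X in _ --> X](mul0r (W x)); apply: cvgMl; exact: cvg_harmonic.
- apply: intgD => //; last exact: intg_abs.
  by apply: intgZl => //; exact: intg_abs.
- move=> n x; rewrite (le_trans (ler_normD _ _))//; apply: lerD.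
    rewrite normrM ler_wpM2l// normrM ler_piMl// /chi.
    have /andP[c0 c1] := pos01 n x.
    by rewrite ger0_norm ?exprn_ge0// expr_le1.
  rewrite [leLHS]normrM [leRHS]normrM ler_wpM2l// (le_trans (err_le n x))//.
  apply: (@le_trans _ _ (W x)); last exact: ler_norm.
  rewrite ler_piMl ?invf_le1 ?ler1n//.
  rewrite mulr_ge0//; apply: sumr_ge0 => i _.
  by apply: mulr_ge0; apply: addr_ge0 => //; exact: sqr_ge0.
move=> il; under eq_fun do rewrite key.
move/(cvg_lim (@Rhausdorff R)); rewrite lim_cst// RintegralZl// => /esym/eqP.
rewrite mulf_eq0 => /orP[|/eqP//]; rewrite /l -mulrBr mulf_eq0 pnatr_eq0/= subr_eq0 eqr_nat.
by rewrite eq_sym (negbTE mk).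
Qed.

End orthogonality.
End eigenfunctions.

(** * The spectral projections *)

Lemma Rintegral_lin d1 (T : measurableType d1) (R : realType) (m : {measure set T -> \bar R})
    (f g : T -> R) (a b : R) :
  m.-integrable setT (EFin \o f) -> m.-integrable setT (EFin \o g) ->
  \int[m]_x (a * f x + b * g x) = a * \int[m]_x f x + b * \int[m]_x g x.
Proof.
move=> fi gi; rewrite RintegralD//; [|exact: intgZl|exact: intgZl].
by rewrite !RintegralZl.
Qed.

(** * Mehler's kernel as [r] tends to 1 *)

Section approximate_identity.
Context {R : realType} {d : nat}.
Implicit Types (x y : 'rV[R]_d).
Local Notation leb := (@lebesgue_rV R d).
Local Notation intg f := (leb.-integrable setT (EFin \o f)).

Lemma sqnormB x y : sqnorm (x - y) = sqnorm x + sqnorm y - 2 * sdot x y.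
Proof.
rewrite /sqnorm /sdot mulr_sumr -big_split/= -sumrB; apply: eq_bigr => i _.
by rewrite !mxE; ring.
Qed.

Lemma sqnormD x y : sqnorm (x + y) = sqnorm x + sqnorm y + 2 * sdot x y.
Proof.
rewrite /sqnorm /sdot mulr_sumr -!big_split/=; apply: eq_bigr => i _.
by rewrite !mxE; ring.
Qed.

Lemma mehler_exponent r x y : 0 <= r < 1 ->
  (2 * r * sdot x y - r ^+ 2 * (sqnorm x + sqnorm y)) / (1 - r ^+ 2) - (sqnorm x + sqnorm y) / 2 =
  - (4^-1 * ((1 + r) / (1 - r) * sqnorm (x - y) + (1 - r) / (1 + r) * sqnorm (x + y))).
Proof.
move=> /andP[r0 r1]; rewrite sqnormB sqnormD.
have h1 : 1 - r ^+ 2 = (1 - r) * (1 + r) by ring.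
rewrite h1; field; apply/andP; split; rewrite gt_eqF//; lra.
Qed.

Lemma mehlerE r x y : 0 <= r < 1 -> mehler r x y = mehler0 (d := d) r *
  expR (- (4^-1 * ((1 + r) / (1 - r) * sqnorm (x - y) + (1 - r) / (1 + r) * sqnorm (x + y)))).
Proof. by move=> r01; rewrite -mehler_exponent// /mehler /mehler0 -[RHS]mulrA -expRD addrA. Qed.

(** The Ornstein-Uhlenbeck kernel: Mehler's kernel conjugated with the ground state
    [exp(- |x|^2 / 2)]. In [y] it is a Gaussian probability density centred at [r *: x]. *)
Definition mehlerOU r x y : R :=
  mehler0 (d := d) r * expR (- ((1 - r ^+ 2)^-1 * sqnorm (y - r *: x))).

Lemma mehler_OU r x y : 0 <= r < 1 ->
  mehler r x y = expR ((sqnorm y - sqnorm x) / 2) * mehlerOU r x y.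
Proof.
move=> /andP[r0 r1]; rewrite /mehlerOU mulrCA -expRD /mehler /mehler0 -[RHS]mulrA -expRD -addrA.
congr (_ * expR (_ + _)).
have h : 1 - r ^+ 2 != 0 by rewrite gt_eqF//; nra.
have -> : sqnorm (y - r *: x) = sqnorm y + r ^+ 2 * sqnorm x - 2 * r * sdot x y.
  rewrite /sqnorm /sdot !mulr_sumr -big_split/= -sumrB; apply: eq_bigr => i _.
  by rewrite !mxE; ring.
by field.
Qed.

Lemma sqrt_expR_ln (v : R) : 0 < v -> Num.sqrt v = expR (2^-1 * ln v).
Proof.
move=> v0; have -> : v = expR (2^-1 * ln v) ^+ 2.
  by rewrite -expRM_natl mulrA divff ?mul1r ?lnK.
by rewrite sqrtr_sqr ger0_norm ?expR_ge0// -expRM_natl mulrA divff ?mul1r// expRK.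
Qed.

Lemma integral_mehlerOU r x : 0 <= r < 1 ->
  intg (mehlerOU r x) /\ \int[leb]_y mehlerOU r x y = 1.
Proof.
move=> /andP[r0 r1]; have h : 0 < 1 - r ^+ 2 by nra.
have h' : 0 < (1 - r ^+ 2)^-1 by rewrite invr_gt0.
have ig := intg_gauss_rV (r *: x) h'; split; first exact: intgZl.
rewrite /mehlerOU RintegralZl// /Rintegral integral_gauss_rV//= invrK.
rewrite sqrtrM ?pi_ge0// (sqrt_expR_ln h) exprMn /mehler0 -expRM_natl.
rewrite mulrACA mulVf ?mul1r ?expf_neq0 ?gt_eqF ?sqrtr_gt0 ?pi_gt0// -expRD.
by rewrite -[RHS](@expR0 R); congr expR; field.
Qed.

(** By [mehlerE] the exponent is at least [|x - y|^2 / (4 (1 - r))]. Half of it, with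
    [|x - y|^2 >= del], gives the factor that vanishes as [r] tends to 1; from the other half a
    fixed Gaussian is kept, which makes the bound integrable against square-integrable functions. *)
Lemma mehler_far r x y (del : R) : 0 <= r < 1 -> del <= sqnorm (x - y) ->
  mehler r x y <= (Num.sqrt pi ^+ d)^-1 *
    expR (- (d%:R / 2 * ln (1 - r)) - del / (8 * (1 - r))) *
    expR (- (8^-1 * sqnorm (y - x))).
Proof.
move=> r01 xy; have [r0 r1] := andP r01; rewrite mehlerE// /mehler0 -!mulrA -!expRD.
rewrite ler_wpM2l ?invr_ge0 ?exprn_ge0 ?sqrtr_ge0// ler_expR.
have -> : sqnorm (y - x) = sqnorm (x - y).
  by apply: eq_bigr => i _; rewrite !mxE; ring.
have l1 : ln (1 - r) <= ln (1 - r ^+ 2) by rewrite ler_ln ?posrE//; nra.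
have l2 : - (d%:R / 2 * ln (1 - r ^+ 2)) <= - (d%:R / 2 * ln (1 - r)).
  by rewrite lerN2 ler_wpM2l// divr_ge0.
have s0 := sqnorm_ge0 (x + y); have s1 := sqnorm_ge0 (x - y).
set S := sqnorm (x - y) in xy s1 *.
have t0 : 0 <= (1 - r) / (1 + r) * sqnorm (x + y) by rewrite mulr_ge0// divr_ge0//; lra.
have t1 : 8^-1 * S + del / (8 * (1 - r)) <= 4^-1 * ((1 + r) / (1 - r) * S).
  have i1 : 1 <= (1 - r)^-1 by rewrite -[leLHS]invr1 lef_pV2 ?posrE//; lra.
  rewrite invfM; set e := (1 - r)^-1 in i1 *.
  have a1 : S <= e * S by rewrite ler_peMl.
  have a2 : del * e <= e * S by rewrite mulrC ler_wpM2l//; lra.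
  have a3 : e * S <= (1 + r) * e * S.
    by rewrite -mulrA ler_peMl ?mulr_ge0//; lra.
  lra.
lra.
Qed.

Lemma far_cvg0 (c : R) : 0 < c ->
  expR (- (d%:R / 2 * ln (n.+2%:R^-1)) - c * n.+2%:R) @[n --> \oo] --> (0 : R).
Proof.
(* The constant comes from [exp(u) >= u^(d+1) / (d+1)!] at [u = c (n+2)], which beats the power
   [(n+2)^d] by one factor. *)
move=> c0; pose K := d.+1`!%:R / c ^+ d.+1.
have K0 : 0 < K by rewrite divr_gt0 ?exprn_gt0// ltr0n fact_gt0.
apply: (@squeeze_cvgr _ _ _ _ (cst 0) (fun n => K * n.+1%:R^-1)).
- apply: nearW => n; rewrite expR_ge0/= expRD.
  have N0 : (0 : R) < n.+2%:R by [].
  have l0 : 0 <= ln n.+2%:R :> R by rewrite ln_ge0// ler1n.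
  have h1 : expR (- (d%:R / 2 * ln (n.+2%:R^-1))) <= n.+2%:R ^+ d :> R.
    have -> : n.+2%:R ^+ d = expR (d%:R * ln n.+2%:R) :> R by rewrite expRM_natl lnK// posrE.
    rewrite ler_expR lnV ?posrE// mulrN opprK ler_wpM2r//.
    by rewrite ler_piMr// invf_le1// ler1n.
  have h2 : expR (- (c * n.+2%:R)) <= d.+1`!%:R / (c * n.+2%:R) ^+ d.+1.
    rewrite expRN -[leRHS]invrK lef_pV2 ?posrE ?expR_gt0//; last first.
      by rewrite invr_gt0 divr_gt0// ?ltr0n ?fact_gt0// exprn_gt0// mulr_gt0.
    rewrite invf_div; have cN : 0 <= c * n.+2%:R by rewrite mulr_ge0 ?(ltW c0).
    by have := expR_ge1Dxn d cN; lra.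
  apply: (@le_trans _ _ (n.+2%:R ^+ d * (d.+1`!%:R / (c * n.+2%:R) ^+ d.+1))).
    by apply: ler_pM => //; exact: expR_ge0.
  rewrite exprMn [n.+2%:R ^+ d.+1]exprS.
  have -> : n.+2%:R ^+ d * (d.+1`!%:R / (c ^+ d.+1 * (n.+2%:R * n.+2%:R ^+ d))) = K * n.+2%:R^-1.
    rewrite /K; have cp : c ^+ d.+1 != 0 by rewrite expf_neq0// gt_eqF.
    have Np : n.+2%:R ^+ d != 0 :> R by rewrite expf_neq0// gt_eqF.
    move: (gt_eqF N0) cp Np; move: (n.+2%:R : R) (c ^+ d.+1) (d.+1`!%:R : R) => N C F /negbT N1 C1.
    move: (N ^+ d) => M M1; field.
    by rewrite N1 C1 M1.
  by rewrite ler_pM2l// lef_pV2 ?posrE// ler_nat.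
- exact: cvg_cst.
- by rewrite -[X in _ --> X](mulr0 K); apply: cvgMr; exact: cvg_harmonic.
Qed.

Lemma far_sqnorm x y (e : R) : 0 < e -> e <= `|y - x| -> e ^+ 2 <= sqnorm (x - y).
Proof.
move=> e0 exy; rewrite leNgt; apply/negP => h; move: exy; rewrite leNgt => /negP; apply.
have h1 : Num.sqrt (sqnorm (x - y)) < e.
  by rewrite -[ltRHS](ger0_norm (ltW e0)) -sqrtr_sqr ltr_sqrt// exprn_gt0.
apply: le_lt_trans h1; rewrite norm_rV_le ?sqrtr_ge0//; apply/forallP => i.
rewrite -sqrtr_sqr ler_sqrt ?sqnorm_ge0// /sqnorm (bigD1 i)//= !mxE.
rewrite (_ : (y ord0 i - x ord0 i) ^+ 2 = (x ord0 i - y ord0 i) ^+ 2); last by ring.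
by rewrite lerDl; apply: sumr_ge0 => j _; exact: sqr_ge0.
Qed.

Lemma mehler_ge0 r x y : 0 <= mehler r x y.
Proof. by rewrite mulr_ge0 ?expR_ge0// invr_ge0 exprn_ge0// sqrtr_ge0. Qed.

Lemma mehlerOU_ge0 r x y : 0 <= mehlerOU r x y.
Proof. by rewrite mulr_ge0 ?expR_ge0// ltW// mehler0_gt0. Qed.

Lemma intg_gauss_L2 (c : R) x (h : 'rV[R]_d -> R) : 0 < c -> measurable_fun setT h ->
  intg (fun y => h y ^+ 2) -> intg (fun y => expR (- (c * sqnorm (y - x))) * h y).
Proof.
move=> c0 mh h2; have c20 : 0 < 2 * c by rewrite mulr_gt0.
have ig := intg_gauss_rV x c0.
apply: intg_mul_L2 => //; first exact: intg_meas ig.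
under eq_fun => y.
  rewrite -expRM_natl (_ : 2 * _ = - ((2 * c) * sqnorm (y - x))); last by ring.
  over.
exact: intg_gauss_rV.
Qed.

Definition abel_seq (n : nat) : R := 1 - n.+2%:R^-1.

Lemma abel_seq01 n : 0 <= abel_seq n < 1.
Proof.
rewrite /abel_seq subr_ge0 invf_le1// ler1n/= ltrBlDr ltrDl invr_gt0.
by rewrite ltr0n.
Qed.

(** The value [h x] is the integral of [mehlerOU r x y * h x], the density having mass 1. Near [x]
    the difference of the integrands is the density times [g x - g y], which is small by continuity.
    Away from [x] both terms are dominated by [B n] times the fixed integrable function [k], and
    [B n] tends to 0. *)
Lemma mehler_approx (h : 'rV[R]_d -> R) x : continuous h -> intg (fun y => h y ^+ 2) ->
  (forall n, intg (fun y => mehler (abel_seq n) x y * h y)) ->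
  \int[leb]_y (mehler (abel_seq n) x y * h y) @[n --> \oo] --> h x.
Proof.
move=> ch h2 ih.
have mh := continuous_measurable_rV ch.
apply/cvgrPdist_le => e e0.
pose g y := expR ((sqnorm y - sqnorm x) / 2) * h y.
have cg : continuous g.
  apply: continuousR_mul => //; apply: smoothR_cont; apply: smoothR_expR; apply: smoothR_mul; last exact: smoothR_cst.
  by apply: smoothR_sub; [exact: smoothR_sqnorm|exact: smoothR_cst].
have gx : g x = h x by rewrite /g subrr mul0r expR0 mul1r.
have /cvgrPdist_le /(_ (e / 2)) := cg x.
rewrite divr_gt0// => /(_ isT) /nbhs_ballP[del /= del0 gdel].
pose k y := expR (- (8^-1 * sqnorm (y - x))) * (`|h y| + expR (sqnorm x / 2) * `|h x|).
have ik : intg k.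
  rewrite /k; under eq_fun do rewrite mulrDr.
  apply: intgD => //.
    apply: intg_gauss_L2 => //; first by apply: measurableT_comp.
    by under eq_fun do rewrite real_normK ?num_real//.
  by apply: intgZr => //; apply: intg_gauss_rV; rewrite invr_gt0.
pose B n : R := (Num.sqrt pi ^+ d)^-1 *
    expR (- (d%:R / 2 * ln (n.+2%:R^-1)) - (del ^+ 2 / 8) * n.+2%:R).
have B0 n : 0 <= B n by rewrite mulr_ge0 ?expR_ge0// invr_ge0 exprn_ge0// sqrtr_ge0.
have Bc : B n * \int[leb]_y k y @[n --> \oo] --> (0 : R).
  rewrite -[X in _ --> X](mul0r (\int[leb]_y k y)); apply: cvgMl.
  rewrite -[X in _ --> X](mulr0 ((Num.sqrt pi ^+ d)^-1)); apply: cvgMr.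
  by apply: far_cvg0; rewrite divr_gt0// exprn_gt0.
have /cvgrPdist_le /(_ (e / 2)) := Bc.
rewrite divr_gt0// => /(_ isT); apply: filterS => n; rewrite sub0r normrN => hB.
have r01 := abel_seq01 n; have [r0 r1] := andP r01; set r := abel_seq n in r01 r0 r1 *.
have r1E : 1 - r = n.+2%:R^-1 by rewrite /r /abel_seq opprB addrC subrK.
have [iO O1] := integral_mehlerOU x r01.
have E1 : h x = \int[leb]_y (mehlerOU r x y * h x) by rewrite RintegralZr// O1 mul1r.
have iOh : intg (fun y => mehlerOU r x y * h x) by exact: intgZr.
rewrite [X in X - _]E1 -RintegralB//; last exact: ih.
apply: (le_trans (le_normr_Rintegral _ _)) => //; first by apply: intgB => //; exact: ih.
apply: (@le_trans _ _ (\int[leb]_y (e / 2 * mehlerOU r x y + B n * k y))).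
  apply: le_Rintegral => //.
  - by apply: intg_abs => //; apply: intgB => //; exact: ih.
  - by apply: intgD => //; exact: intgZl.
  move=> y _.
  have O0 := mehlerOU_ge0 r x y.
  have k0 : 0 <= k y by rewrite mulr_ge0 ?expR_ge0// addr_ge0// mulr_ge0// expR_ge0.
  have [near|far] := ltP `|x - y| del.
    apply: (@le_trans _ _ (e / 2 * mehlerOU r x y)); last by rewrite lerDl mulr_ge0.
    have -> : mehlerOU r x y * h x - mehler r x y * h y = mehlerOU r x y * (g x - g y).
      by rewrite mehler_OU// gx /g; ring.
    rewrite normrM (ger0_norm O0) mulrC ler_wpM2r// gdel//.
    by rewrite mx_norm_ball /ball_/=.
  apply: (@le_trans _ _ (B n * k y)); last by rewrite lerDr mulr_ge0// divr_ge0// ltW.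
  have fars : del ^+ 2 <= sqnorm (x - y) by apply: far_sqnorm => //; rewrite distrC.
  have M1 := mehler_far r01 fars; rewrite r1E in M1.
  have {}M1 : mehler r x y <= B n * expR (- (8^-1 * sqnorm (y - x))).
    apply: (le_trans M1); rewrite /B; apply: ler_wpM2r; first exact: expR_ge0.
    by rewrite invfM invrK mulrA.
  (* The two kernels differ by the factor [exp((|x|^2 - |y|^2) / 2)], at most [exp(|x|^2 / 2)], so
     the bound on [mehler] also controls the density at distant [y]. *)
  have O2 : mehlerOU r x y <= expR (sqnorm x / 2) * mehler r x y.
    rewrite mehler_OU// mulrA -expRD ler_peMl// -[leLHS]expR0 ler_expR.
    have := sqnorm_ge0 y; lra.
  have m0 := mehler_ge0 r x y.
  rewrite /k; move: O0 m0 M1 O2; move: (mehlerOU r x y) (mehler r x y) (expR (- (8^-1 * _))) (expR (sqnorm x / 2)) (expR_ge0 (sqnorm x / 2)).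
  move=> O m X Y Y0 O0 m0 M1 O2.
  apply: (@le_trans _ _ (m * `|h y| + O * `|h x|)).
    by have := ler_normB (O * h x) (m * h y); rewrite !normrM (ger0_norm O0) (ger0_norm m0); lra.
  have := ler_wpM2r (normr_ge0 (h y)) M1.
  have := ler_wpM2r (normr_ge0 (h x)) O2.
  have := ler_wpM2r (normr_ge0 (h x)) (ler_wpM2l Y0 M1).
  by rewrite mulrDr; lra.
have -> := Rintegral_lin (e / 2) (B n) iO ik.
rewrite O1 mulr1.
by have := le_trans (ler_norm _) hB; lra.
Qed.

End approximate_identity.

(** * The projections on real square-integrable functions *)

Section projection.
Context {R : realType} {d : nat}.
Implicit Types (x y : 'rV[R]_d) (h v : 'rV[R]_d -> R) (k : nat).
Local Notation leb := (@lebesgue_rV R d).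
Local Notation intg f := (leb.-integrable setT (EFin \o f)).

Definition L2 v := measurable_fun setT v /\ intg (fun y => v y ^+ 2).

Lemma L2_hermf mu : L2 (@hermf R d mu).
Proof. by split; [apply: measurable_smoothR; exact: smoothR_hermf|exact: intg_hermf2]. Qed.

Lemma eigR_L2 k h : eigR k h -> L2 h.
Proof. by case=> sh h2 _; split => //; exact: measurable_smoothR. Qed.

Lemma L2_intgM v h : L2 v -> L2 h -> intg (fun y => v y * h y).
Proof. by move=> [mv v2] [mh h2]; exact: intg_mul_L2. Qed.

Definition projR k v x : R := \int[leb]_y (Pk k x y * v y).

Let PkvE k x v y : Pk k x y * v y =
  \sum_(mu : {ffun 'I_d -> 'I_k.+1} | (\sum_i mu i == k)%N)
    (hw (mi mu) * hermf (mi mu) x) * (hermf (mi mu) y * v y).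
Proof. by rewrite /Pk mulr_suml; apply: eq_bigr => mu _; rewrite mulrA. Qed.

Lemma intg_Pk k x v : L2 v -> intg (fun y => Pk k x y * v y).
Proof.
move=> v2; under eq_fun do rewrite PkvE.
apply: intg_sum => // mu _; apply: intgZl => //.
by apply: L2_intgM => //; exact: L2_hermf.
Qed.

Lemma projR_sumE k v x : L2 v -> projR k v x =
  \sum_(mu : {ffun 'I_d -> 'I_k.+1} | (\sum_i mu i == k)%N)
    (hw (mi mu) * hermf (mi mu) x) * \int[leb]_y (hermf (mi mu) y * v y).
Proof.
move=> v2; rewrite /projR; under eq_Rintegral do rewrite PkvE.
rewrite Rintegral_sum//; last first.
  by move=> mu _; apply: intgZl => //; apply: L2_intgM => //; exact: L2_hermf.
by apply: eq_bigr => mu _; rewrite RintegralZl//; apply: L2_intgM => //; exact: L2_hermf.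
Qed.

Lemma projR_eq0 j k h x : eigR k h -> j != k -> projR j h x = 0.
Proof.
move=> eh jk; have h2 := eigR_L2 eh; rewrite projR_sumE//; apply: big1 => mu /eqP muj.
under eq_Rintegral do rewrite mulrC.
rewrite (eigR_orth eh); first by rewrite mulr0.
by rewrite (_ : (\sum_i _)%N = j).
Qed.

(** Integrated term by term against [h], Mehler's series keeps only the term of index [k], because
    [h] is orthogonal to the Hermite functions of every other degree; the partial sums are constant
    from [k+1] on. *)
Lemma integral_mehler k h x r : eigR k h -> 0 <= r < 1 ->
  intg (fun y => mehler r x y * h y) /\ \int[leb]_y (mehler r x y * h y) = r ^+ k * projR k h x.
Proof.
move=> eh r01; have [r0 r1] := andP r01; have [mh h2] := eigR_L2 eh.
pose F n y := (\sum_(0 <= j < n) Pk j x y * r ^+ j) * h y.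
have iF n : \int[leb]_y F n y = \sum_(0 <= j < n) r ^+ j * projR j h x.
  rewrite /F.
  under eq_Rintegral => y _.
    rewrite mulr_suml; under eq_bigr do rewrite mulrAC mulrC.
    over.
  rewrite Rintegral_sum//; last by move=> j _; apply: intgZl => //; exact: intg_Pk.
  by apply: eq_bigr => j _; rewrite RintegralZl//; exact: intg_Pk.
have c0 : 0 < (1 - r) / (1 + r) / 2 by rewrite !divr_gt0//; lra.
have [] := @dominated_cvg_Rintegral _ _ R leb F (fun y => mehler r x y * h y)
  (fun y => mehler0 (d := d) r * (expR (- ((1 - r) / (1 + r) / 2 * sqnorm (y - 0))) * `|h y|)).
- move=> n; apply: measurable_funM => //; apply: measurable_sum => j.
  apply: measurable_funM => //; apply: measurable_smoothR; apply: smoothR_sum => mu _.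
  by apply: smoothR_mul; [exact: smoothR_cst|exact: smoothR_hermf].
- apply: measurable_funM => //; apply: measurable_funM => //.
  apply: measurableT_comp => //; apply: measurable_smoothR.
  have ss := @smoothR_sqnorm R d; have sd : smoothR (fun y => sdot x y).
    by apply: smoothR_sum => i _; apply: smoothR_mul; [exact: smoothR_cst|exact: smoothR_coord].
  apply: smoothR_sub; last by apply: smoothR_mul; [apply: smoothR_add; [exact: smoothR_cst|]|exact: smoothR_cst].
  apply: smoothR_add; first exact: smoothR_cst.
  apply: smoothR_mul; last exact: smoothR_cst.
  apply: smoothR_sub; first by apply: smoothR_mul => //; exact: smoothR_cst.
  by apply: smoothR_mul; [exact: smoothR_cst|apply: smoothR_add => //; exact: smoothR_cst].
- by move=> y; apply: cvgMl; exact: mehler_cvg.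
- apply: intgZl => //; apply: intg_gauss_L2 => //; first by apply: measurableT_comp.
  by under eq_fun do rewrite real_normK ?num_real//.
- move=> n y; rewrite normrM mulrA subr0 ler_wpM2r//.
  rewrite big_mkord (le_trans (ler_norm_sum _ _ _))// (le_trans _ (sum_Pk_le x y n r01))//.
  by apply: ler_sum => j _; rewrite normrM (ger0_norm (exprn_ge0 _ r0)).
move=> im cv; split => //; apply: (cvg_unique (@Rhausdorff R) cv).
apply: cvg_near_cst; exists k.+1 => // n /= kn; rewrite iF big_mkord.
rewrite (bigD1 (Ordinal kn))//= big1 ?addr0// => j jk.
by rewrite (projR_eq0 _ eh) ?mulr0.
Qed.

Lemma eigR_repr k h x : eigR k h -> projR k h x = h x.
Proof.
move=> eh; have [sh h2 _] := eh.
have c1 : \int[leb]_y (mehler (abel_seq n) x y * h y) @[n --> \oo] --> h x.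
  apply: mehler_approx => //; first exact: smoothR_cont.
  by move=> n; have [] := integral_mehler x eh (abel_seq01 n).
have E : (fun n => \int[leb]_y (mehler (abel_seq n) x y * h y)) = (fun n => abel_seq n ^+ k * projR k h x).
  by apply/funext => n; exact: (integral_mehler x eh (abel_seq01 n)).2.
have hr : (abel_seq n : R) @[n --> \oo] --> (1 : R).
  rewrite -[X in _ --> X]subr0; apply: cvgB; first exact: cvg_cst.
  by have := @cvg_harmonic R; rewrite -cvg_shiftS.
have hk : (abel_seq n ^+ k : R) @[n --> \oo] --> (1 : R).
  elim: (k) => [|j IH]; first by under eq_fun do rewrite expr0; exact: cvg_cst.
  have -> : (fun n => abel_seq n ^+ j.+1 : R) = (fun n => abel_seq n * abel_seq n ^+ j).
    by apply/funext => n; rewrite exprS.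
  by rewrite -[X in _ --> X]mul1r; exact: cvgM.
have c2 : (abel_seq n ^+ k * projR k h x) @[n --> \oo] --> projR k h x.
  by rewrite -[X in _ --> X]mul1r; exact: cvgMl.
rewrite E in c1; exact: (cvg_unique (@Rhausdorff R) c2 c1).
Qed.

Lemma osc_reZ (c : R) h x : smoothR h -> osc_re (fun y => c * h y) x = c * osc_re h x.
Proof.
move=> sh; rewrite /osc_re /laplacian mulrDr mulrN mulr_sumr mulrCA; congr (- _ + _).
apply: eq_bigr => i _.
rewrite (_ : (fun y => 'D_(delta_mx ord0 i) (fun y => c * h y) y) =
  (fun y => c * 'D_(delta_mx ord0 i) h y)); last first.
  by apply/funext => y; apply: derive_val; apply: is_derive_cstmul; exact: smoothR_is_derive.
by apply: derive_val; apply: is_derive_cstmul; apply: smoothR_is_derive; exact: smoothR_derive.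
Qed.

Lemma osc_reD h v x : smoothR h -> smoothR v -> osc_re (fun y => h y + v y) x = osc_re h x + osc_re v x.
Proof.
move=> sh sv.
have L : laplacian (fun y => h y + v y) x = laplacian h x + laplacian v x.
  rewrite -big_split; apply: eq_bigr => i _ /=.
  rewrite (_ : (fun y => 'D_(delta_mx ord0 i) (fun y => h y + v y) y) =
    (fun y => 'D_(delta_mx ord0 i) h y + 'D_(delta_mx ord0 i) v y)); last first.
    by apply/funext => y; apply: derive_val; apply: is_derive_add; exact: smoothR_is_derive.
  by apply: derive_val; apply: is_derive_add; apply: smoothR_is_derive; exact: smoothR_derive.
rewrite /osc_re L; move: (laplacian h x) (laplacian v x) (sqnorm x) (h x) (v x) => a b c e f.
by ring.
Qed.

Lemma eigR0 k : eigR k (fun _ : 'rV[R]_d => 0).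
Proof.
split; first exact: smoothR_cst.
  by under eq_fun do rewrite expr0n; exact: integrable0.
move=> x; rewrite mulr0 -[in LHS](mulr0 0).
by rewrite (@osc_reZ 0 (fun=> 0)) ?mul0r//; exact: smoothR_cst.
Qed.

Lemma eigRZ k c h : eigR k h -> eigR k (fun y => c * h y).
Proof.
move=> [sh h2 oh]; split; first by apply: smoothR_mul => //; exact: smoothR_cst.
  by under eq_fun do rewrite exprMn; exact: intgZl.
by move=> x; rewrite osc_reZ// oh; ring.
Qed.

Lemma eigRD k h v : eigR k h -> eigR k v -> eigR k (fun y => h y + v y).
Proof.
move=> eh ev; have h2 := eigR_L2 eh; have v2 := eigR_L2 ev.
case: eh => sh hh oh; case: ev => sv vv ov.
split; first exact: smoothR_add.
  under eq_fun do rewrite sqrrD -mulr_natr.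
  apply: intgD => //; apply: intgD => //; apply: intgZr => //.
  exact: L2_intgM.
by move=> x; rewrite osc_reD// oh ov mulrDr.
Qed.

Lemma eigR_projR k v : L2 v -> eigR k (projR k v).
Proof.
move=> v2; rewrite (_ : projR k v = fun x => \sum_(mu : {ffun 'I_d -> 'I_k.+1} | (\sum_i mu i == k)%N)
    (hw (mi mu) * \int[leb]_y (hermf (mi mu) y * v y)) * hermf (mi mu) x); last first.
  by apply/funext => x; rewrite projR_sumE//; apply: eq_bigr => mu _; rewrite mulrAC.
elim: (index_enum _) => [|mu s IH].
  by under eq_fun do rewrite big_nil; exact: eigR0.
under eq_fun do rewrite big_cons; case muk : (_ == k) => //.
apply: eigRD => //; apply: eigRZ; have := @eigR_hermf R d (mi mu).
by rewrite (_ : (\sum_i mi mu i)%N = k)//; exact/eqP.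
Qed.

(** Replacing [h] by [projR k h], which equals it by [eigR_repr], turns both integrals into the same
    finite sum of products of Hermite coefficients. This is the symmetry of the kernel and takes the
    place of orthonormality. *)
Lemma projR_orth k v h : L2 v -> eigR k h ->
  \int[leb]_y ((v y - projR k v y) * h y) = 0.
Proof.
move=> v2 eh; have h2 := eigR_L2 eh; have ep := eigR_projR k v2; have p2 := eigR_L2 ep.
under eq_Rintegral do rewrite mulrBl.
rewrite RintegralB//; [|exact: L2_intgM|exact: L2_intgM].
apply/eqP; rewrite subr_eq0; apply/eqP.
pose b (mu : {ffun 'I_d -> 'I_k.+1}) := \int[leb]_y (hermf (mi mu) y * h y).
pose a (mu : {ffun 'I_d -> 'I_k.+1}) := \int[leb]_y (hermf (mi mu) y * v y).
transitivity (\sum_(mu : {ffun 'I_d -> 'I_k.+1} | (\sum_i mu i == k)%N) (hw (mi mu) * b mu) * a mu).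
  transitivity (\int[leb]_y \sum_(mu : {ffun 'I_d -> 'I_k.+1} | (\sum_i mu i == k)%N)
    (hw (mi mu) * b mu) * (hermf (mi mu) y * v y)).
    apply: eq_Rintegral => y _; rewrite -[in LHS](eigR_repr y eh) projR_sumE// mulr_sumr.
    by apply: eq_bigr => mu _; rewrite /b; ring.
  rewrite Rintegral_sum//; last first.
    by move=> mu _; apply: intgZl => //; apply: L2_intgM => //; exact: L2_hermf.
  by apply: eq_bigr => mu _; rewrite RintegralZl//; apply: L2_intgM => //; exact: L2_hermf.
transitivity (\int[leb]_y \sum_(mu : {ffun 'I_d -> 'I_k.+1} | (\sum_i mu i == k)%N)
    (hw (mi mu) * a mu) * (hermf (mi mu) y * h y)).
  rewrite Rintegral_sum//; last first.
    by move=> mu _; apply: intgZl => //; apply: L2_intgM => //; exact: L2_hermf.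
  apply: eq_bigr => mu _; rewrite RintegralZl//; last by apply: L2_intgM => //; exact: L2_hermf.
  by rewrite -/(b mu); ring.
apply: eq_Rintegral => y _; rewrite projR_sumE// mulr_suml.
by apply: eq_bigr => mu _; rewrite /a; ring.
Qed.

End projection.

(** * Complex-valued functions *)

Section complex_facts.
Context {R : realType}.
Local Notation Re := (@complex.Re R).
Local Notation Im := (@complex.Im R).

Lemma cReM (a b : R[i]) : Re (a * b) = Re a * Re b - Im a * Im b.
Proof. by case: a b => [a1 a2] [b1 b2]. Qed.
Lemma cImM (a b : R[i]) : Im (a * b) = Re a * Im b + Im a * Re b.
Proof. by case: a b => [a1 a2] [b1 b2]. Qed.
Lemma ReDc (a b : R[i]) : Re (a + b) = Re a + Re b.
Proof. by case: a b => [a1 a2] [b1 b2]. Qed.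
Lemma ImDc (a b : R[i]) : Im (a + b) = Im a + Im b.
Proof. by case: a b => [a1 a2] [b1 b2]. Qed.
Lemma ReBc (a b : R[i]) : Re (a - b) = Re a - Re b.
Proof. by case: a b => [a1 a2] [b1 b2]. Qed.
Lemma ImBc (a b : R[i]) : Im (a - b) = Im a - Im b.
Proof. by case: a b => [a1 a2] [b1 b2]. Qed.
Lemma Re_conjc (a : R[i]) : Re (conjc a) = Re a.
Proof. by case: a. Qed.
Lemma Im_conjc (a : R[i]) : Im (conjc a) = - Im a.
Proof. by case: a. Qed.
Lemma complexE (a : R[i]) : a = Re a +i* Im a.
Proof. by case: a. Qed.
Lemma normc_sq (a : R[i]) : Normc.normc a ^+ 2 = Re a ^+ 2 + Im a ^+ 2.
Proof. by case: a => a b; rewrite /Normc.normc sqr_sqrtr// addr_ge0 ?sqr_ge0. Qed.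
Lemma normc_ge0 (a : R[i]) : 0 <= Normc.normc a.
Proof. by case: a => a b; exact: sqrtr_ge0. Qed.
Lemma Re_nat n : Re (n%:R : R[i]) = n%:R.
Proof. by elim: n => [//|n IH]; rewrite -!natr1 ReDc IH. Qed.
Lemma Im_nat n : Im (n%:R : R[i]) = 0.
Proof. by elim: n => [//|n IH]; rewrite -!natr1 ImDc IH addr0. Qed.
Lemma cReM_nat n (a : R[i]) : Re (n%:R * a) = n%:R * Re a.
Proof. by rewrite cReM Re_nat Im_nat mul0r subr0. Qed.
Lemma cImM_nat n (a : R[i]) : Im (n%:R * a) = n%:R * Im a.
Proof. by rewrite cImM Re_nat Im_nat mul0r addr0. Qed.
Lemma normc_Re (a : R[i]) : `|Re a| <= Normc.normc a.
Proof.
by case: a => a b; rewrite -sqrtr_sqr ler_sqrt ?addr_ge0 ?sqr_ge0// lerDl sqr_ge0.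
Qed.
Lemma normc_Im (a : R[i]) : `|Im a| <= Normc.normc a.
Proof.
by case: a => a b; rewrite -sqrtr_sqr ler_sqrt ?addr_ge0 ?sqr_ge0// lerDr sqr_ge0.
Qed.
Lemma normc_le (a : R[i]) : Normc.normc a <= `|Re a| + `|Im a|.
Proof.
rewrite -(@ler_pXn2r _ 2)// ?nnegrE ?normc_ge0 ?addr_ge0//.
rewrite normc_sq sqrrD !real_normK ?num_real// mulr2n.
have := normr_ge0 (Re a); have := normr_ge0 (Im a); nra.
Qed.

Section measurable_normc.
Context d1 (T : measurableType d1).

Lemma measurable_normc (g : T -> R[i]) : measurable_fun setT (Re \o g) ->
  measurable_fun setT (Im \o g) -> measurable_fun setT (fun x => Normc.normc (g x)).
Proof.
move=> mr mi_; rewrite (_ : (fun x => _) = (fun x => Num.sqrt (Re (g x) ^+ 2 + Im (g x) ^+ 2))).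
  apply: (@measurableT_comp _ _ _ _ _ _ (@Num.sqrt R)).
    by apply: continuous_measurable_fun; exact: sqrt_continuous.
  by apply: measurable_funD; apply: measurable_funX.
by apply/funext => x; case: (g x).
Qed.

Lemma inLp2P (mu : {measure set T -> \bar R}) (g : T -> R[i]) :
  inLp mu 2%:E g <->
  [/\ measurable_fun setT (Re \o g), measurable_fun setT (Im \o g),
   mu.-integrable setT (EFin \o (fun x => Re (g x) ^+ 2)) &
   mu.-integrable setT (EFin \o (fun x => Im (g x) ^+ 2))].
Proof.
have E : (\int[mu]_x (`|(Normc.normc (g x))%:E| `^ 2) = \int[mu]_x (Re (g x) ^+ 2 + Im (g x) ^+ 2)%:E)%E.
  apply: eq_integral => x _; rewrite gee0_abs ?lee_fin ?normc_ge0// poweR_EFin.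
  by rewrite powR_mulrn ?normc_ge0// normc_sq.
have ge x : 0 <= Re (g x) ^+ 2 + Im (g x) ^+ 2 by rewrite addr_ge0 ?sqr_ge0.
split=> [[mr mi_]|[mr mi_ ir ii]].
  rewrite /cLnorm unlock /= => /lty_poweRy; rewrite invr_eq0 => /(_ (lt0r_neq0 _)) H.
  have {}H := H (ltr0Sn _ 1).
  have I : mu.-integrable setT (EFin \o (fun x => Re (g x) ^+ 2 + Im (g x) ^+ 2)).
    apply/integrableP; split.
      by apply/measurable_EFinP; apply: measurable_funD; exact: measurable_funX.
    rewrite (le_lt_trans _ H)// E; apply: ge0_le_integral => //.
    - by apply: measurableT_comp => //; apply/measurable_EFinP; apply: measurable_funD; exact: measurable_funX.
    - by apply/measurable_EFinP; apply: measurable_funD; exact: measurable_funX.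
    - by move=> x _; rewrite /= ger0_norm.
  split => //; apply: (intg_le _ _ _ I) => //; try exact: measurable_funX.
    by move=> x _; rewrite ger0_norm ?sqr_ge0// lerDl sqr_ge0.
  by move=> x _; rewrite ger0_norm ?sqr_ge0// lerDr sqr_ge0.
split => //; rewrite /cLnorm unlock /=; apply: poweR_lty; rewrite E.
have I := intgD measurableT ir ii.
by rewrite -(intgE _ I) ?ltry.
Qed.

End measurable_normc.
End complex_facts.

Section osc_proj_formula.
Context {R : realType} {d : nat}.
Local Notation leb := (@lebesgue_rV R d).
Local Notation Re := (@complex.Re R).
Local Notation Im := (@complex.Im R).
Implicit Types (u g h : 'rV[R]_d -> R[i]).

Lemma osc_eigenspaceP k g : osc_eigenspace k g <->
  eigR k (fun x => Re (g x)) /\ eigR k (fun x => Im (g x)).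
Proof.
split.
  move=> [sg /inLp2P[mr mi_ ir ii] og].
  split; split => //.
  - by move=> n; have [] := sg n.
  - by move=> x; have /(congr1 Re) := og x; rewrite cReM_nat.
  - by move=> n; have [] := sg n.
  - by move=> x; have /(congr1 Im) := og x; rewrite cImM_nat.
move=> [[sr ir or] [si ii oi]]; split.
- by move=> n; split; [exact: sr|exact: si].
- by apply/inLp2P; split => //; exact: measurable_smoothR.
- move=> x; rewrite [RHS]complexE cReM_nat cImM_nat /osc; congr (_ +i* _); [exact: or|exact: oi].
Qed.

Lemma cinner_eq0 u h : L2 (Re \o u) -> L2 (Im \o u) -> L2 (Re \o h) -> L2 (Im \o h) ->
  \int[leb]_x (Re (u x) * Re (h x)) = 0 -> \int[leb]_x (Re (u x) * Im (h x)) = 0 ->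
  \int[leb]_x (Im (u x) * Re (h x)) = 0 -> \int[leb]_x (Im (u x) * Im (h x)) = 0 ->
  cinner leb u h = 0.
Proof.
move=> ur ui hr hi rr ri ir ii; rewrite /cinner /cintegral.
have Irr := L2_intgM ur hr; have Iri := L2_intgM ur hi.
have Iir := L2_intgM ui hr; have Iii := L2_intgM ui hi.
under eq_Rintegral do rewrite cReM Re_conjc Im_conjc mulrN opprK.
under [X in _ +i* X]eq_Rintegral do rewrite cImM Re_conjc Im_conjc mulrN addrC.
rewrite RintegralD// RintegralB//.
by rewrite [X in X + _]rr [X in _ + X]ii [X in X - _]ir [X in _ - X]ri addr0 subr0.
Qed.

(** [osc_proj] is a choice from a set, so that set must be shown to contain exactly one function.
    Existence is given by [projR] on the real and imaginary parts. *)
Lemma osc_projE k u x : L2 (Re \o u) -> L2 (Im \o u) ->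
  osc_proj k u x = projR k (Re \o u) x +i* projR k (Im \o u) x.
Proof.
move=> ur ui.
have er := eigR_projR k ur; have ei := eigR_projR k ui.
pose g x := projR k (Re \o u) x +i* projR k (Im \o u) x.
have pr := eigR_L2 er; have pi_ := eigR_L2 ei.
have L2B (v w : 'rV[R]_d -> R) : L2 v -> L2 w -> L2 (fun y => v y - w y).
  move=> v2 w2; have vw := L2_intgM v2 w2; case: v2 w2 => mv v2 [mw w2].
  split; first exact: measurable_funB.
  under eq_fun do rewrite sqrrB -mulr_natr.
  by apply: intgD => //; apply: intgB => //; exact: intgZr.
have gP : [set g | osc_eigenspace k g /\ forall h, osc_eigenspace k h ->
      cinner leb (fun x => u x - g x) h = 0] g.
  split; first exact/osc_eigenspaceP.
  move=> h /osc_eigenspaceP[hr hi].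
  have hr2 := eigR_L2 hr; have hi2 := eigR_L2 hi.
  have uE1 y : Re (u y - g y) = (Re \o u) y - projR k (Re \o u) y by rewrite ReBc.
  have uE2 y : Im (u y - g y) = (Im \o u) y - projR k (Im \o u) y by rewrite ImBc.
  apply: cinner_eq0 => //.
  - rewrite (_ : _ \o _ = fun y => (Re \o u) y - projR k (Re \o u) y); first exact: L2B.
    by apply/funext => y; exact: uE1.
  - rewrite (_ : _ \o _ = fun y => (Im \o u) y - projR k (Im \o u) y); first exact: L2B.
    by apply/funext => y; exact: uE2.
  - by under eq_Rintegral do rewrite uE1; exact: projR_orth.
  - by under eq_Rintegral do rewrite uE1; exact: projR_orth.
  - by under eq_Rintegral do rewrite uE2; exact: projR_orth.
  - by under eq_Rintegral do rewrite uE2; exact: projR_orth.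
rewrite /osc_proj.
set P := (X in xget _ X).
have -> : xget (fun=> 0) P = g; last by [].
(* Tested against [hermf mu], another candidate has the same Hermite coefficients of degree [k] as
   [u]; being an eigenfunction it reproduces itself through [projR], so it coincides with [g]. *)
apply: xget_unique => // g' [/osc_eigenspaceP[gr gi] go].
have gr2 := eigR_L2 gr; have gi2 := eigR_L2 gi.
have H mu : (\sum_i mu i)%N = k ->
   \int[leb]_y (hermf mu y * Re (g' y)) = \int[leb]_y (hermf mu y * Re (u y)) /\
   \int[leb]_y (hermf mu y * Im (g' y)) = \int[leb]_y (hermf mu y * Im (u y)).
  move=> muk; have h2 := @L2_hermf R d mu.
  pose hm : 'rV[R]_d -> R[i] := fun y => hermf mu y +i* 0.
  have eh : osc_eigenspace k hm.
    apply/osc_eigenspaceP; split; last exact: eigR0.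
    by rewrite -muk; exact: eigR_hermf.
  move: (go _ eh); rewrite /cinner /cintegral.
  under eq_Rintegral do rewrite cReM Re_conjc Im_conjc /= oppr0 mulr0 subr0 ReBc mulrBl.
  under [X in _ +i* X]eq_Rintegral do rewrite cImM Re_conjc Im_conjc /= oppr0 mulr0 add0r ImBc mulrBl.
  rewrite RintegralB//; [|exact: (L2_intgM ur h2)|exact: (L2_intgM gr2 h2)].
  rewrite RintegralB//; [|exact: (L2_intgM ui h2)|exact: (L2_intgM gi2 h2)].
  case=> /eqP; rewrite subr_eq0 => /eqP E1 /eqP; rewrite subr_eq0 => /eqP E2.
  by split; [under eq_Rintegral do rewrite mulrC; rewrite -E1|
    under eq_Rintegral do rewrite mulrC; rewrite -E2];
    apply: eq_Rintegral => y _; rewrite mulrC.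
apply/funext => y; rewrite [LHS]complexE /g; congr (_ +i* _).
  rewrite -(eigR_repr y gr) !projR_sumE//; apply: eq_bigr => mu /eqP muk; congr (_ * _).
  exact: (H _ muk).1.
rewrite -(eigR_repr y gi) !projR_sumE//; apply: eq_bigr => mu /eqP muk; congr (_ * _).
exact: (H _ muk).2.
Qed.

End osc_proj_formula.

(** * Schur's test *)

(* Replaces Hoelder's inequality in Schur's test: integrate it against the kernel, then
   optimize over [l]. *)
Lemma powR_tradeoff (R : realType) (p l a : R) : 1 <= p -> 0 < l -> 0 <= a ->
  a <= l + l `^ (1 - p) * a `^ p.
Proof.
move=> p1 l0 a0; have [al|la] := leP a l.
  by rewrite (le_trans al)// lerDl mulr_ge0 ?powR_ge0.
have a0' : 0 < a by exact: lt_trans la.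
rewrite (@le_trans _ _ (l `^ (1 - p) * a `^ p))//; last by rewrite lerDr ltW.
have aE : a `^ (1 - p) * a `^ p = a.
  by rewrite -powRD ?subrK ?powRr1// (gt_eqF a0') implybT.
rewrite -[leLHS]aE ler_wpM2r ?powR_ge0//.
rewrite -opprB !powRN lef_pV2 ?posrE ?powR_gt0//.
by apply: ge0_ler_powR; rewrite ?nnegrE ?subr_ge0 ?(ltW l0) ?(ltW a0') ?(ltW la).
Qed.

Lemma fine_abs_le (R : realType) (x : \bar R) : (0 <= x)%E -> (`|fine x|%:E <= x)%E.
Proof. by case: x => [r| |] // r0; [rewrite lee_fin ger0_norm|rewrite leey]. Qed.

Section schur.
Context d (T : measurableType d) (R : realType) (mu : {sigma_finite_measure set T -> \bar R}).
Variables (K : T -> T -> \bar R) (A : R).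
Hypothesis mK : measurable_fun setT (fun z => K z.1 z.2).
Hypothesis K0 : forall z w, (0 <= K z w)%E.
Hypothesis A0 : 0 < A.
Hypothesis row : forall z, (\int[mu]_w K z w <= A%:E)%E.
Hypothesis col : forall w, (\int[mu]_z K z w <= A%:E)%E.
Local Notation Re := (@complex.Re R).
Local Notation Im := (@complex.Im R).
Implicit Types f g : T -> R[i].

Definition schur_op f z : R[i] := cintegral mu (fun w => (fine (K z w))%:C * f w).
Definition schur_int f z : Prop :=
  mu.-integrable setT (fun w => K z w * (Normc.normc (f w))%:E)%E.

Let cmeas f := measurable_fun setT (Re \o f) /\ measurable_fun setT (Im \o f).
Let Iabs f z : \bar R := (\int[mu]_w (K z w * (Normc.normc (f w))%:E))%E.

Let mKz z : measurable_fun setT (K z).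
Proof. exact: (measurableT_comp mK (pair1_measurable z)). Qed.

Let mKw w : measurable_fun setT (K ^~ w).
Proof. exact: (measurableT_comp mK (pair2_measurable w)). Qed.

Let mKf f z : cmeas f -> measurable_fun setT (fun w => K z w * (Normc.normc (f w))%:E)%E.
Proof.
move=> [mr mi_]; apply: emeasurable_funM => //.
by apply/measurable_EFinP; exact: measurable_normc.
Qed.

Let Kf_ge0 f z w : (0 <= K z w * (Normc.normc (f w))%:E)%E.
Proof. by rewrite mule_ge0// lee_fin normc_ge0. Qed.

Let schur_intP f z : cmeas f -> schur_int f z <-> (Iabs f z < +oo)%E.
Proof.
move=> mf; rewrite /schur_int; split=> [/integrableP[_]|] h.
  by rewrite /Iabs; under eq_integral do rewrite -(gee0_abs (Kf_ge0 f z _)).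
apply/integrableP; split; first exact: mKf.
by under eq_integral do rewrite (gee0_abs (Kf_ge0 f z _)).
Qed.

Lemma schur_fineM (g : T -> R) f z : measurable_fun setT g ->
  (forall w, `|g w| <= Normc.normc (f w)) -> schur_int f z ->
  mu.-integrable setT (EFin \o (fun w => fine (K z w) * g w)).
Proof.
move=> mg gf; apply: le_integrable => //.
  apply/measurable_EFinP; apply: measurable_funM => //.
  exact: (measurableT_comp (fine_measurable measurableT)).
move=> w _; rewrite /= normrM EFinM abseM lee_pmul//.
  by rewrite (gee0_abs (K0 _ _)); exact: fine_abs_le.
by rewrite lee_fin (ger0_norm (normc_ge0 _)); exact: gf.
Qed.

Let ReKf f z w : Re ((fine (K z w))%:C * f w) = fine (K z w) * Re (f w).
Proof. by rewrite cReM /= mul0r subr0. Qed.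

Let ImKf f z w : Im ((fine (K z w))%:C * f w) = fine (K z w) * Im (f w).
Proof. by rewrite cImM /= mul0r addr0. Qed.

Lemma schur_opE f z : schur_op f z =
  (\int[mu]_w (fine (K z w) * Re (f w))) +i* (\int[mu]_w (fine (K z w) * Im (f w))).
Proof.
rewrite /schur_op /cintegral; congr (_ +i* _); apply: eq_Rintegral => w _; [exact: ReKf|exact: ImKf].
Qed.

(** The modulus is at most the sum of the moduli of the real and imaginary parts, and each of these
    integrals is at most [Iabs f z]; when the latter is infinite, so is the right-hand side. *)
Let schur_op_le f z : cmeas f -> ((Normc.normc (schur_op f z))%:E <= 2%:E * Iabs f z)%E.
Proof.
move=> mf; have [mr mi_] := mf.
have I0 : (0 <= Iabs f z)%E by apply: integral_ge0.
have [->|] := eqVneq (Iabs f z) +oo%E; first by rewrite gt0_muley ?lte_fin// leey.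
rewrite -ltey => Ioo; have Iint := (schur_intP z mf).2 Ioo.
have key (g : T -> R) : measurable_fun setT g -> (forall w, `|g w| <= Normc.normc (f w)) ->
    (`|\int[mu]_w (fine (K z w) * g w)|%:E <= Iabs f z)%E.
  move=> mg gf; have ig := schur_fineM mg gf Iint.
  rewrite EFin_normr_Rintegral// (le_trans (le_abse_integral _ _ _))//.
    by move/integrableP : ig => [].
  apply: ge0_le_integral => //.
  - by apply: measurableT_comp => //; move/integrableP : ig => [].
  - exact: mKf.
  move=> w _; rewrite /= normrM EFinM lee_pmul// ?lee_fin//.
  exact: fine_abs_le.
have kr := key _ mr (fun w => normc_Re (f w)); have ki := key _ mi_ (fun w => normc_Im (f w)).
have /fineK <- : Iabs f z \is a fin_num by rewrite ge0_fin_numE.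
rewrite -EFinM lee_fin (le_trans (normc_le _))// schur_opE /=.
rewrite mulrDl mul1r lerD// -lee_fin fineK ?ge0_fin_numE//.
Qed.

Let measurable_fine_int (g : T -> R) : measurable_fun setT g ->
  measurable_fun setT (fun z => \int[mu]_w (fine (K z w) * g w)).
Proof.
move=> mg; pose G (z : T * T) : \bar R := (fine (K z.1 z.2) * g z.2)%:E.
have mG : measurable_fun setT G.
  apply/measurable_EFinP; apply: measurable_funM; last exact: measurableT_comp.
  exact: (measurableT_comp (fine_measurable measurableT) mK).
rewrite /Rintegral; apply: (measurableT_comp (fine_measurable measurableT)).
rewrite (_ : (fun z => _) = (fun z => \int[mu]_w (G^\+ (z, w)) - \int[mu]_w (G^\- (z, w)))%E); last first.
  apply/funext => z; rewrite integralE; congr (_ - _)%E; apply: eq_integral => w _.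
    by rewrite !funeposE.
  by rewrite !funenegE.
apply: emeasurable_funB.
- by apply: measurable_fun_fubini_tonelli_F => //; exact: measurable_funepos.
- by apply: measurable_fun_fubini_tonelli_F => //; exact: measurable_funeneg.
Qed.

Let cmeas_op f : cmeas f -> cmeas (schur_op f).
Proof.
move=> [mr mi_]; split.
  rewrite (_ : _ \o _ = (fun z => \int[mu]_w (fine (K z w) * (Re \o f) w))).
    exact: measurable_fine_int.
  by apply/funext => z; rewrite [LHS]/comp schur_opE.
rewrite (_ : _ \o _ = (fun z => \int[mu]_w (fine (K z w) * (Im \o f) w))).
  exact: measurable_fine_int.
by apply/funext => z; rewrite [LHS]/comp schur_opE.
Qed.

Section finite_p.
Variables (p : R) (f : T -> R[i]).
Hypothesis p1 : 1 <= p.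
Hypothesis mf : cmeas f.
Let F w := Normc.normc (f w) `^ p.
Let Conv z : \bar R := (\int[mu]_w (K z w * (F w)%:E))%E.

Let mF : measurable_fun setT F.
Proof.
apply: (measurableT_comp (measurable_powR p)).
by have [mr mi_] := mf; exact: measurable_normc.
Qed.

Let mKF z : measurable_fun setT (fun w => K z w * (F w)%:E)%E.
Proof. by apply: emeasurable_funM => //; exact/measurable_EFinP. Qed.

Let Conv_ge0 z : (0 <= Conv z)%E.
Proof. by apply: integral_ge0 => w _; rewrite mule_ge0// lee_fin powR_ge0. Qed.

Let mKF2 : measurable_fun setT (fun z : T * T => K z.1 z.2 * (F z.2)%:E)%E.
Proof.
apply: emeasurable_funM => //; apply/measurable_EFinP; exact: (measurableT_comp mF).
Qed.

Let mConv : measurable_fun setT Conv.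
Proof.
apply: (measurable_fun_fubini_tonelli_F (fun z : T * T => K z.1 z.2 * (F z.2)%:E)%E) => //.
by move=> z; rewrite mule_ge0// lee_fin powR_ge0.
Qed.

Let int_Conv : (\int[mu]_z Conv z <= A%:E * \int[mu]_w (F w)%:E)%E.
Proof.
rewrite (fubini_tonelli (fun z : T * T => K z.1 z.2 * (F z.2)%:E)%E)//; last first.
  by move=> z; rewrite mule_ge0// lee_fin powR_ge0.
rewrite -ge0_integralZl_EFin ?(ltW A0)//; last 2 first.
- by move=> w _; rewrite lee_fin powR_ge0.
- exact/measurable_EFinP.
apply: ge0_le_integral; first exact: measurableT.
- by move=> w _; apply: integral_ge0 => z _; rewrite mule_ge0// lee_fin powR_ge0.
- apply: (measurable_fun_fubini_tonelli_G (fun z : T * T => K z.1 z.2 * (F z.2)%:E)%E) => //.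
  by move=> z; rewrite mule_ge0// lee_fin powR_ge0.
- by apply: emeasurable_funM => //; exact/measurable_EFinP.
- move=> w _ /=; rewrite ge0_integralZr//; last by rewrite lee_fin powR_ge0.
  by rewrite lee_wpmul2r// lee_fin powR_ge0.
Qed.

Let Iabs_le z (l : R) : 0 < l -> (Iabs f z <= (l * A)%:E + (l `^ (1 - p))%:E * Conv z)%E.
Proof.
move=> l0.
have lA : (l%:E * \int[mu]_w K z w <= (l * A)%:E)%E.
  by rewrite EFinM lee_wpmul2l// lee_fin ltW.
rewrite (le_trans _ (leeD lA (lexx _)))//.
rewrite -ge0_integralZl_EFin ?(ltW l0)//.
rewrite -ge0_integralZl_EFin ?powR_ge0//; last first.
  by move=> w _; rewrite mule_ge0// lee_fin powR_ge0.
rewrite -ge0_integralD//; last 4 first.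
- by move=> w _; rewrite mule_ge0// lee_fin ltW.
- by apply: emeasurable_funM.
- by move=> w _; rewrite mule_ge0 ?lee_fin ?powR_ge0// mule_ge0// lee_fin powR_ge0.
- by apply: emeasurable_funM.
apply: ge0_le_integral => //.
- exact: mKf.
- by apply: emeasurable_funD; apply: emeasurable_funM.
move=> w _; rewrite [X in (_ <= X + _)%E]muleC muleCA -ge0_muleDr ?lee_fin ?(ltW l0)//; last first.
  by rewrite ?lee_fin ?mulr_ge0 ?powR_ge0.
rewrite lee_wpmul2l// -EFinM -EFinD lee_fin.
by apply: powR_tradeoff => //; exact: normc_ge0.
Qed.

Let Iabs_powR z : (Iabs f z `^ p <= ((2 * A) `^ p / A)%:E * Conv z)%E.
Proof.
have p0 : 0 < p := lt_le_trans ltr01 p1.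
have c0 : 0 < (2 * A) `^ p / A by rewrite divr_gt0// powR_gt0// mulr_gt0.
have I0 : (0 <= Iabs f z)%E by apply: integral_ge0.
have [->|] := eqVneq (Conv z) +oo%E; first by rewrite gt0_muley ?lte_fin// leey.
rewrite -ltey => Coo.
have Cfin : Conv z \is a fin_num by rewrite ge0_fin_numE.
pose v := fine (Conv z).
have vE : Conv z = v%:E by rewrite /v fineK.
have v0 : 0 <= v by rewrite -lee_fin -vE.
have Ile l : 0 < l -> (Iabs f z <= (l * A + l `^ (1 - p) * v)%:E)%E.
  by move=> l0; rewrite EFinD EFinM (le_trans (Iabs_le z l0))// vE.
(* For [v = 0] the optimal [l] would be 0; letting [l = e / A] tend to 0 shows that [Iabs f z]
   vanishes too. *)
have [v00|vn0] := eqVneq v 0.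
  have I00 : Iabs f z = 0%E.
    apply/eqP; rewrite eq_le I0 andbT; apply/lee_addgt0Pr => e e0; rewrite add0e.
    have := Ile (e / A) (divr_gt0 e0 A0).
    by rewrite v00 mulr0 addr0 divfK// gt_eqF.
  by rewrite I00 poweR0r ?gt_eqF// mule_ge0// lee_fin ltW.
have vp : 0 < v by rewrite lt_neqAle eq_sym vn0.
(* At this [l] the two terms of the bound coincide, both being [l A]. *)
pose l := (v / A) `^ p^-1.
have l0 : 0 < l by rewrite powR_gt0// divr_gt0.
have lp : l `^ p = v / A by rewrite -powRrM mulVf ?gt_eqF// powRr1// divr_ge0// ltW.
have l1 : l `^ (1 - p) * v = l * A.
  have -> : l `^ (1 - p) = l / (v / A).
    by rewrite powRB ?(gt_eqF l0) ?implybT// lp powRr1// ltW.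
  by field; rewrite vn0 gt_eqF.
have {Ile}Ile := Ile l l0; rewrite l1 -mulr2n -mulr_natl in Ile.
apply: (@le_trans _ _ ((2 * (l * A))%:E `^ p)%E).
  apply: gt0_ler_poweR => //; first exact: ltW.
    by rewrite in_itv/= I0 leey.
  by rewrite in_itv/= lee_fin !mulr_ge0 ?(ltW l0) ?(ltW A0)// leey.
rewrite poweR_EFin vE -EFinM lee_fin.
rewrite (_ : 2 * (l * A) = 2 * A * l); last by ring.
rewrite powRM ?mulr_ge0 ?(ltW l0) ?(ltW A0)// lp.
by rewrite mulrA mulrAC.
Qed.

Let Conv_lty z : (Conv z < +oo)%E -> schur_int f z.
Proof.
move=> Coo; apply/schur_intP => //; apply: (le_lt_trans (Iabs_le z ltr01)).
by rewrite powR1 mul1e lte_add_pinfty// ltry.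
Qed.

(** [Conv] has finite integral, hence is finite almost everywhere, and a finite [Conv z] forces a
    finite [Iabs f z] by the tradeoff at [l = 1]. *)
Lemma schur_ae_int : (\int[mu]_w (F w)%:E < +oo)%E -> {ae mu, forall z, schur_int f z}.
Proof.
move=> Foo.
have iC : mu.-integrable setT Conv.
  apply/integrableP; split => //.
  under eq_integral do rewrite (gee0_abs (Conv_ge0 _)).
  by apply: (le_lt_trans int_Conv); rewrite lte_mul_pinfty// lee_fin ltW.
move/integrable_ae : iC => /(_ measurableT); apply: filterS => z /(_ I) Cz.
by apply: Conv_lty; rewrite -ge0_fin_numE.
Qed.

(** The constant collects [2^p] from the splitting into real and imaginary parts, [(2 A)^p / A] from
    [Iabs_powR] and [A] from the column bound in [int_Conv]. *)
Lemma schur_Lp : (cLnorm mu p%:E (schur_op f) <=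
  ((2 `^ p * ((2 * A) `^ p)) `^ p^-1)%:E * cLnorm mu p%:E f)%E.
Proof.
have p0 : 0 < p := lt_le_trans ltr01 p1.
have E g : cLnorm mu p%:E g = ((\int[mu]_x (Normc.normc (g x) `^ p)%:E) `^ p^-1)%E.
  rewrite /cLnorm unlock /=; congr poweR.
  by apply: eq_integral => x _; rewrite ger0_norm// normc_ge0.
rewrite !E -poweR_EFin -poweRM ?lee_fin ?mulr_ge0 ?powR_ge0//; last first.
  by apply: integral_ge0 => x _; rewrite lee_fin powR_ge0.
apply: gt0_ler_poweR; first by rewrite invr_ge0 ltW.
- rewrite in_itv/= leey andbT; apply: integral_ge0 => x _; by rewrite lee_fin powR_ge0.
- rewrite in_itv/= leey andbT mule_ge0 ?lee_fin ?mulr_ge0 ?powR_ge0//.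
  apply: integral_ge0 => x _; by rewrite lee_fin powR_ge0.
apply: (@le_trans _ _ (\int[mu]_z ((2 `^ p * ((2 * A) `^ p / A))%:E * Conv z))%E).
  apply: ge0_le_integral => //.
  - by move=> z _; rewrite lee_fin powR_ge0.
  - apply/measurable_EFinP; apply: (measurableT_comp (measurable_powR p)).
    by have [mr mi_] := cmeas_op mf; exact: measurable_normc.
  - exact: emeasurable_funM.
  move=> z _; rewrite EFinM -muleA (@le_trans _ _ ((2 `^ p)%:E * Iabs f z `^ p)%E)//.
    rewrite -!poweR_EFin -poweRM ?lee_fin//; last by apply: integral_ge0.
    apply: gt0_ler_poweR; first exact: ltW.
    + by rewrite in_itv/= leey andbT lee_fin sqrtr_ge0.
    + by rewrite in_itv/= leey andbT mule_ge0// integral_ge0.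
    exact: schur_op_le.
  by rewrite lee_wpmul2l ?lee_fin ?powR_ge0.
rewrite ge0_integralZl_EFin//; last by rewrite mulr_ge0 ?powR_ge0// divr_ge0 ?powR_ge0// ltW.
apply: (@le_trans _ _ ((2 `^ p * ((2 * A) `^ p / A))%:E * (A%:E * \int[mu]_w (F w)%:E))%E).
  by rewrite lee_wpmul2l// lee_fin mulr_ge0 ?powR_ge0// divr_ge0 ?powR_ge0// ltW.
rewrite muleA -EFinM lee_wpmul2r//; first by apply: integral_ge0 => x _; rewrite lee_fin powR_ge0.
by rewrite lee_fin -!mulrA mulVf ?mulr1// gt_eqF.
Qed.

End finite_p.

Let Lnorm_lty (p : R) f : 1 <= p -> inLp mu p%:E f -> (\int[mu]_w (Normc.normc (f w) `^ p)%:E < +oo)%E.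
Proof.
move=> p1 [_ _]; rewrite /cLnorm unlock /= => /lty_poweRy H.
have p0 : 0 < p := lt_le_trans ltr01 p1.
have := H (invr_neq0 (lt0r_neq0 p0)).
by under eq_integral do rewrite ger0_norm ?normc_ge0//.
Qed.

Let ae_mu0 (P : T -> Prop) : mu setT = 0%E -> {ae mu, forall x, P x}.
Proof. by move=> m0; exists setT; split. Qed.

Let Iabs_infty f (N : R) z : cmeas f -> 0 <= N ->
  {ae mu, forall w, ((Normc.normc (f w))%:E <= N%:E)%E} -> (Iabs f z <= (A * N)%:E)%E.
Proof.
move=> mf N0 fN.
apply: (@le_trans _ _ (\int[mu]_w (K z w * N%:E))%E).
  apply: ae_ge0_le_integral => //.
  - exact: mKf.
  - by move=> w _; rewrite mule_ge0.
  - exact: emeasurable_funM.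
  by apply: filterS fN => w h _; rewrite lee_wpmul2l.
by rewrite ge0_integralZr// EFinM lee_wpmul2r.
Qed.

Let ess_bound f : inLp mu +oo%E f -> mu setT != 0%E -> exists N : R,
  [/\ 0 <= N, cLnorm mu +oo%E f = N%:E & {ae mu, forall w, ((Normc.normc (f w))%:E <= N%:E)%E}].
Proof.
move=> [_ _]; rewrite /cLnorm unlock /= => foo m0.
have mp : (0 < mu setT)%E by rewrite lt_neqAle eq_sym m0 measure_ge0.
rewrite mp in foo *.
set e := ess_sup _ _ in foo *.
have e0 : (0 <= e)%E by apply: ess_sup_gee => //; apply: nearW => x /=.
have efin : e \is a fin_num by rewrite ge0_fin_numE.
exists (fine e); split; [by rewrite fine_ge0|by rewrite fineK|].
rewrite fineK//; apply: filterS (ess_sup_ge mu (abse \o (fun x : T => (Normc.normc (f x))%:E))) => w /=.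
by rewrite ger0_norm// normc_ge0.
Qed.

Lemma schur_integrable_ae (p : \bar R) f : (1 <= p)%E -> inLp mu p f ->
  {ae mu, forall z, schur_int f z}.
Proof.
move=> p1 fp; have [mr mi_ _] := fp; have mf : cmeas f by split.
case: p p1 fp => [p| |//] p1 fp.
  by rewrite lee_fin in p1; apply: (@schur_ae_int p) => //; exact: Lnorm_lty.
have [m0|m0] := eqVneq (mu setT) 0%E; first exact: ae_mu0.
have [N [N0 _ fN]] := ess_bound fp m0.
apply: nearW => z; apply/schur_intP => //.
by apply: (le_lt_trans (Iabs_infty z mf N0 fN)); rewrite ltry.
Qed.

Lemma schur_bounded (p : \bar R) : (1 <= p)%E -> bounded_linear_on_Lp mu p schur_op.
Proof.
move=> p1; split.
- move=> f g [mfr mfi _] [mgr mgi _] fg; apply: nearW => z; rewrite !schur_opE.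
  have mfK := measurableT_comp (fine_measurable measurableT) (mKz z).
  congr (_ +i* _); congr fine; apply: ae_eq_integral => //.
  + by apply/measurable_EFinP; exact: measurable_funM.
  + by apply/measurable_EFinP; exact: measurable_funM.
  + by apply: filterS fg => w -> _.
  + by apply/measurable_EFinP; exact: measurable_funM.
  + by apply/measurable_EFinP; exact: measurable_funM.
  + by apply: filterS fg => w -> _.
- move=> c f g fp gp.
  have [mfr mfi _] := fp; have [mgr mgi _] := gp.
  (* Linearity is obtained at the points where both integrals converge absolutely, which is almost
     everywhere. *)
  apply: filterS2 (schur_integrable_ae p1 fp) (schur_integrable_ae p1 gp) => z fi gi.
  rewrite !schur_opE [c in RHS]complexE.
  have ifr := schur_fineM mfr (fun w => normc_Re (f w)) fi.
  have ifi := schur_fineM mfi (fun w => normc_Im (f w)) fi.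
  have igr := schur_fineM mgr (fun w => normc_Re (g w)) gi.
  have igi := schur_fineM mgi (fun w => normc_Im (g w)) gi.
  set a := Re c; set b := Im c.
  have E1 : \int[mu]_w (fine (K z w) * Re (c * f w + g w)) =
      a * \int[mu]_w (fine (K z w) * Re (f w)) - b * \int[mu]_w (fine (K z w) * Im (f w)) +
      \int[mu]_w (fine (K z w) * Re (g w)).
    rewrite -!RintegralZl// -RintegralB//; [|exact: intgZl|exact: intgZl].
    rewrite -RintegralD//; last by apply: intgB => //; exact: intgZl.
    by apply: eq_Rintegral => w _; rewrite ReDc cReM; ring.
  have E2 : \int[mu]_w (fine (K z w) * Im (c * f w + g w)) =
      a * \int[mu]_w (fine (K z w) * Im (f w)) + b * \int[mu]_w (fine (K z w) * Re (f w)) +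
      \int[mu]_w (fine (K z w) * Im (g w)).
    rewrite -!RintegralZl// -RintegralD//; [|exact: intgZl|exact: intgZl].
    rewrite -RintegralD//; last by apply: intgD => //; exact: intgZl.
    by apply: eq_Rintegral => w _; rewrite ImDc cImM; ring.
  rewrite E1 E2; apply/eqP; rewrite eq_complex /=; apply/andP; split; apply/eqP; ring.
- case: p p1 => [p| |//] p1.
    rewrite lee_fin in p1.
    exists ((2 `^ p * ((2 * A) `^ p)) `^ p^-1); first exact: powR_ge0.
    move=> f fp; have [mr mi_ foo] := fp; have mf : cmeas f by split.
    have h := schur_Lp p1 mf; split => //.
    have [mor moi] := cmeas_op mf; split => //; apply: (le_lt_trans h).
    by rewrite lte_mul_pinfty// lee_fin powR_ge0.
  exists (2 * A); first by rewrite mulr_ge0// ltW.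
  move=> f fp; have [mr mi_ foo] := fp; have mf : cmeas f by split.
  have [mor moi] := cmeas_op mf.
  have h : (cLnorm mu +oo%E (schur_op f) <= (2 * A)%:E * cLnorm mu +oo%E f)%E.
    (* On a space of measure zero the [L^oo] norm is 0 by definition; otherwise it is an essential
       supremum. *)
    have [m0|m0] := eqVneq (mu setT) 0%E.
      rewrite /cLnorm unlock /= m0 ltxx mule0//.
    have [N [N0 NE fN]] := ess_bound fp m0; rewrite NE.
    have mp : (0 < mu setT)%E by rewrite lt_neqAle eq_sym m0 measure_ge0.
    rewrite /cLnorm unlock /= mp; apply/ess_supP; apply: nearW => z /=.
    rewrite ger0_norm ?normc_ge0// (le_trans (schur_op_le z mf))//.
    rewrite -EFinM -mulrA EFinM lee_wpmul2l//.
    exact: Iabs_infty.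
  split => //; split => //; apply: (le_lt_trans h).
  by rewrite lte_mul_pinfty// lee_fin mulr_ge0// ltW.
Qed.

End schur.

(** * The Gamma integral *)

Section gamma.
Context {R : realType}.
Local Notation mu := (@lebesgue_measure R).

Definition dilation (c : R) (x : measurableTypeR R) : measurableTypeR R := c * x.

Lemma measurable_dilation c : measurable_fun setT (dilation c).
Proof. by apply: measurable_funM. Qed.

HB.instance Definition _ c :=
  isMeasurableFun.Build _ _ _ _ (dilation c) (measurable_dilation c).

Lemma lebesgue_measureM (A : set R) (c : R) (c0 : 0 < c) : measurable A ->
  pushforward (mscale (NngNum (ltW c0)) mu) (dilation c) A = mu A.
Proof.
move=> mA; apply/esym/lebesgue_measure_unique => //= _ [[a b]] _ <-.
rewrite /pushforward /mscale/=.
rewrite (_ : _ @^-1` _ = `]a / c, b / c]%classic); last first.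
  by apply/seteqP; split => x /=; rewrite !in_itv/= ltr_pdivrMr// ler_pdivlMr// mulrC.
rewrite !lebesgue_measure_itv/= !lte_fin ltr_pM2r ?invr_gt0//; case: ifPn => [_|]; last by rewrite mule0.
by rewrite -!EFinD -EFinM; congr EFin; field; rewrite gt_eqF.
Qed.

Lemma ge0_integral_dilation (f : R -> \bar R) c : 0 < c ->
  measurable_fun setT f -> (forall x, 0 <= f x)%E ->
  (\int[mu]_x f (c * x)%R = c^-1%:E * \int[mu]_x f x)%E.
Proof.
move=> c0 mf f0.
have -> : (\int[mu]_x f x = c%:E * \int[mu]_x f (c * x)%R)%E.
  transitivity (\int[pushforward (mscale (NngNum (ltW c0)) mu) (dilation c)]_x f x)%E.
    by apply: eq_measure_integral => A mA _; apply/esym; exact: lebesgue_measureM.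
  rewrite ge0_integral_pushforward//= preimage_setT ge0_integral_mscale//.
  exact: (measurableT_comp mf (measurable_dilation c)).
  
by rewrite muleA -EFinM mulVf ?mul1e// gt_eqF.
Qed.

(* Extended by [0], so that integrals over the half-line become integrals over the line. *)
Definition powpos (a t : R) : R := if 0 < t then t `^ (a - 1) else 0.

Lemma powpos_ge0 a t : 0 <= powpos a t.
Proof. by rewrite /powpos; case: ifP => // _; exact: powR_ge0. Qed.

Lemma powpos_gt0 a t : 0 < t -> 0 < powpos a t.
Proof. by move=> t0; rewrite /powpos t0 powR_gt0. Qed.

Lemma measurable_powpos a : measurable_fun setT (powpos a).
Proof.
rewrite /powpos; apply: measurable_fun_ifT => //.
exact: measurable_fun_ltr.
Qed.

Lemma integral_powpos a (F : R -> R) :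
  (\int[mu]_(t in `]0%R, +oo[) (t `^ (a - 1) * F t)%:E = \int[mu]_t (powpos a t * F t)%:E)%E.
Proof.
rewrite integral_mkcond; apply: eq_integral => t _; rewrite patchE /powpos.
have [t0|t0] := ltP 0 t; first by rewrite mem_set//= in_itv/= t0.
by rewrite memNset ?mul0r//= in_itv/= andbT ltNge t0.
Qed.

Lemma GammaE a : Gamma a = \int[mu]_t (powpos a t * expR (- t)).
Proof. by rewrite /Gamma /Rintegral integral_powpos. Qed.

Variable a : R.
Hypothesis a0 : 0 < a.

(** For [a < 1] the antiderivative [t^a / a] has no derivative at 0, so the fundamental theorem is
    applied on [[1/(n+2), 1]] and these intervals exhaust []0, 1]]. *)
Let integral_powR01 : (\int[mu]_(t in `]0%R, 1%R]) (t `^ (a - 1))%:E <= (a^-1)%:E)%E.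
Proof.
pose F (n : nat) := `[n.+2%:R^-1, 1]%classic : set R.
have FE : `]0, 1]%classic = \bigcup_n F n.
  apply/seteqP; split => [t|t [n _]]; rewrite /F /= !in_itv/=; last first.
    by move=> /andP[h t1]; apply/andP; split; [rewrite (lt_le_trans _ h)// invr_gt0|exact: t1].
  move=> /andP[t0 t1]; exists (Num.truncn t^-1) => //=; rewrite /F /= in_itv/= t1 andbT.
  rewrite invf_ple ?posrE// ltW// (lt_trans (truncnS_gt _))//.
  by rewrite ltr_nat.
rewrite FE; have mp : measurable_fun setT (fun t : R => (t `^ (a - 1))%:E).
  by apply/measurable_EFinP; exact: measurable_powR.
have ndF : nondecreasing_seq F.
  move=> m n mn; rewrite subsetEset => t; rewrite /F /= !in_itv/= => /andP[h t1].
  apply/andP; split; last exact: t1.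
  by rewrite (le_trans _ h)// lef_pV2 ?posrE// ler_nat.
have := @ge0_nondecreasing_set_cvg_integral _ (measurableTypeR R) R F (fun t => (t `^ (a - 1))%:E) mu ndF
  (fun n => measurable_itv _) (fun n => measurable_funTS mp).
move=> c; apply: (cvge_to_le (c _)); first by move=> n x _; exact: powR_ge0.
apply: nearW => n.
have n1 : n.+2%:R^-1 < 1 :> R by rewrite invf_lt1// ltr1n.
have n0 : 0 < n.+2%:R^-1 :> R by rewrite invr_gt0.
have dpw (t : R) : 0 < t -> is_derive t (1:R) (fun t => a^-1 * t `^ a) (t `^ (a - 1)).
  move=> t0; apply: (is_derive_eq (is_derive_cstmul a^-1 (_ : is_derive t (1 : R) (fun t => t `^ a) (a * t `^ (a - 1))))).
    split; first by apply: derivable_powR; rewrite in_itv/= t0.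
    by rewrite -derive1E powR_derive1// in_itv/= t0.
  by rewrite mulrA mulVf ?mul1r// gt_eqF.
have cpw (t : R) : 0 < t -> {for t, continuous (fun t => a^-1 * t `^ a)}.
  move=> t0; apply: differentiable_continuous; apply/derivable1_diffP.
  exact: (@ex_derive _ _ _ _ _ _ _ (dpw t t0)).
rewrite (@continuous_FTC2 _ _ (fun t => a^-1 * t `^ a))//.
- by rewrite -EFinB lee_fin powR1 mulr1 gerBl mulr_ge0 ?powR_ge0// invr_ge0 ltW.
- apply: derivable_within_continuous => t; rewrite in_itv/= => /andP[nt _].
  by apply: derivable_powR; rewrite in_itv/= andbT (lt_le_trans n0).
- split.
  + move=> t; rewrite in_itv/= => /andP[nt _].
    exact: (@ex_derive _ _ _ _ _ _ _ (dpw t (lt_trans n0 nt))).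
  + by apply: cvg_at_right_filter; exact: (cpw _ n0).
  + by apply: cvg_at_left_filter; exact: (cpw _ ltr01).
- move=> t; rewrite in_itv/= => /andP[nt _].
  rewrite derive1E; exact: (@derive_val _ _ _ _ _ _ _ (dpw t (lt_trans n0 nt))).
Qed.

Let powR_le_expR : exists2 C : R, 0 <= C & forall t, 1 <= t -> t `^ (a - 1) <= C * expR (t / 2).
Proof.
(* For [t >= 1] the power [t^(a-1)] is at most [t^(m+1)], which one term of the exponential series
   at [t/2] dominates. *)
pose m := Num.truncn a.
exists (m.+1`!%:R * 2 ^+ m.+1); first by rewrite mulr_ge0// exprn_ge0.
move=> t t1; have t0 : 0 < t by exact: lt_le_trans t1.
apply: (@le_trans _ _ (t ^+ m.+1)).
  rewrite -powR_mulrn ?(ltW t0)//; apply: ler_powR => //.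
  by rewrite lerBlDr (le_trans (ltW (truncnS_gt a)))// lerDl.
have h : (t / 2) ^+ m.+1 / m.+1`!%:R <= expR (t / 2).
  have h2 : 0 <= t / 2 by rewrite divr_ge0// ltW.
  by apply: le_trans (expR_ge1Dxn m h2); rewrite lerDr.
move: h; rewrite ler_pdivrMr// expr_div_n ler_pdivrMr ?exprn_gt0// => h.
by rewrite (le_trans h)// -mulrA mulrC.
Qed.

Lemma integrable_gamma : mu.-integrable setT (EFin \o (fun t => powpos a t * expR (- t))).
Proof.
have mg : measurable_fun setT (fun t : R => powpos a t * expR (- t)).
  apply: measurable_funM; first exact: measurable_powpos.
  by apply: measurableT_comp => //; exact: measurableT_comp.
apply/integrableP; split; first exact/measurable_EFinP.
have [C C0 hC] := powR_le_expR.
pose G t : \bar R := ((fun t : R => (t `^ (a - 1))%:E) \_ `]0%R, 1%R]) t.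
(* The factor 2 cancels the rate [1/2] in the exponential density, so that [H] is [C exp(- t/2)] on
   the half-line. *)
pose H (t : R) : \bar R := (C * 2 * exponential_pdf 2^-1 t)%:E.
have mG : measurable_fun setT G.
  apply/(measurable_restrictT (fun t => (t `^ (a - 1))%:E)) => //; apply/measurable_EFinP; apply: measurable_funTS.
  exact: measurable_powR.
have mH : measurable_fun setT H.
  apply/measurable_EFinP; apply: measurable_funM => //; exact: measurable_exponential_pdf.
have G0 t : (0 <= G t)%E by rewrite /G patchE; case: ifP => //; rewrite lee_fin powR_ge0.
have H0 t : (0 <= H t)%E.
  by rewrite lee_fin mulr_ge0 ?mulr_ge0// exponential_pdf_ge0.
apply: (@le_lt_trans _ _ (\int[mu]_t (G t + H t))%E).
  apply: ge0_le_integral => //.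
  - by apply: measurableT_comp => //; exact/measurable_EFinP.
  - exact: emeasurable_funD.
  move=> t _; rewrite gee0_abs ?lee_fin ?mulr_ge0 ?powpos_ge0 ?expR_ge0//.
  rewrite /= /powpos; have [t0|t0] := ltP 0 t; last by rewrite mul0r adde_ge0.
  have [t1|t1] := leP t 1.
    rewrite (le_trans _ (leeDl _ (H0 t)))// /G patchE mem_set/= ?in_itv/= ?t0//.
    by rewrite lee_fin ler_piMr ?powR_ge0// expR_le1 oppr_le0 ltW.
  rewrite (le_trans _ (leeDr _ (G0 t)))// /H lee_fin exponential_pdfE ?(ltW t0)//.
  rewrite -mulrA (mulrA 2) divff// mul1r (_ : expR (- t) = (expR (t / 2))^-1 * expR (- 2^-1 * t)); last first.
    by rewrite -expRN -expRD; congr expR; field.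
  by rewrite mulrA ler_wpM2r ?expR_ge0// ler_pdivrMr ?expR_gt0// hC// ltW.
rewrite ge0_integralD//; apply: lte_add_pinfty.
  by rewrite /G -integral_mkcond (le_lt_trans integral_powR01)// ltry.
rewrite /H; under eq_integral do rewrite EFinM.
rewrite ge0_integralZl_EFin//.
- by rewrite integral_exponential_pdf// mule1 ltry.
- by move=> t _; rewrite lee_fin exponential_pdf_ge0.
- by apply/measurable_EFinP; exact: measurable_exponential_pdf.
- by rewrite mulr_ge0.
Qed.

(** A vanishing integral would make the integrand vanish almost everywhere, although it is positive
    on []0, 1[], a set of measure 1. *)
Lemma Gamma_gt0 : 0 < Gamma a.
Proof.
rewrite GammaE lt_neqAle Rintegral_ge0 ?andbT; last first.
  by move=> t _; rewrite mulr_ge0 ?powpos_ge0// expR_ge0.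
rewrite eq_sym; apply/eqP => h.
have : (\int[mu]_t (powpos a t * expR (- t))%:E = 0)%E by rewrite -(intgE measurableT integrable_gamma) h.
move=> h0; have : ae_eq mu setT (EFin \o (fun t => powpos a t * expR (- t))) (cst 0%E).
  apply/ae_eq_integral_abs => //; first by move/integrableP : integrable_gamma => [].
  rewrite -[RHS]h0; apply: eq_integral => t _.
  by rewrite gee0_abs ?lee_fin ?mulr_ge0 ?powpos_ge0 ?expR_ge0.
move=> [N [mN N0 hN]].
have : (mu `]0%R, 1%R[%classic <= mu N)%E.
  apply: le_measure; rewrite ?inE// => t /= t01; apply: hN => /= /(_ I).
  move: t01; rewrite in_itv/= => /andP[t0 _] /eqP.
  by rewrite eqe gt_eqF// mulr_gt0 ?powpos_gt0 ?expR_gt0.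
by rewrite N0 lebesgue_measure_itv/= lte_fin ltr01 oppr0 adde0 lee_fin ler10.

Qed.

Lemma integral_powpos_expR c : 0 < c ->
  (\int[mu]_t (powpos a t * expR (- (c * t)))%:E = (c `^ (- a) * Gamma a)%:E)%E.
Proof.
move=> c0; pose f t : \bar R := (powpos a t * expR (- t))%:E.
have mf : measurable_fun setT f.
  by move/integrableP : integrable_gamma => [].
have f0 t : (0 <= f t)%E by rewrite lee_fin mulr_ge0 ?powpos_ge0 ?expR_ge0.
have E t : f (c * t) = ((c `^ (a - 1))%:E * (powpos a t * expR (- (c * t)))%:E)%E.
  rewrite /f /powpos pmulr_rgt0//; case: ifPn => t0; last by rewrite !mul0r mule0.
  by rewrite powRM ?(ltW c0) ?(ltW t0)// -EFinM mulrA.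
have := ge0_integral_dilation c0 mf f0.
under eq_integral do rewrite E.
rewrite ge0_integralZl_EFin ?powR_ge0//; last 2 first.
- by move=> t _; rewrite lee_fin mulr_ge0 ?powpos_ge0 ?expR_ge0.
- apply/measurable_EFinP; apply: measurable_funM; first exact: measurable_powpos.
  by apply: measurableT_comp => //; apply: measurableT_comp => //; exact: measurable_funM.
rewrite /f -(intgE measurableT integrable_gamma) -GammaE => h.
have p0 : c `^ (a - 1) != 0 by rewrite gt_eqF// powR_gt0.
rewrite -[LHS]mul1e -(mulVf p0) EFinM -muleA h -!EFinM; congr EFin.
rewrite mulrA; congr (_ * _); rewrite -powRN opprB.
rewrite -(powR_inv1 (ltW c0)). rewrite -powRD; last by rewrite (gt_eqF c0) implybT.
by rewrite addrAC subrr sub0r.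
Qed.

End gamma.

(** * The heat kernel *)

Section heat_kernel_factorization.
Context {R : realType} {d : nat}.
Local Notation mu := (@lebesgue_measure R).
Implicit Types (t s u v : R) (z : R * 'rV[R]_d).

(** The inverse is discontinuous at 0; the product [x * (x^2)^(-1)] with a real power has the same
    value everywhere and is built from measurable functions. *)
Lemma measurable_inv : measurable_fun setT (fun x : R => x^-1).
Proof.
rewrite (_ : (fun x => _) = (fun x : R => x * (x ^+ 2) `^ (-1))); last first.
  apply/funext => x; rewrite powR_inv1 ?sqr_ge0//.
  have [->|x0] := eqVneq x 0; first by rewrite invr0 mul0r.
  by field.
apply: measurable_funM => //; apply: (measurableT_comp (measurable_powR _)).
exact: measurable_funX.
Qed.

(** The heat kernel [(4 pi t)^(-1/2) exp(- s^2 / (4 t))] of the line, with its constant in the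
    exponent. *)
Definition line_heat t s : R :=
  expR (- (ln 2 + 2^-1 * ln pi + 2^-1 * ln t)) * expR (- (s ^+ 2 / (4 * t))).

(** With [q = exp(- 2 t)], [ct t] is [coth t] and [th t] is [tanh t], in the form of the
    coefficients of [mehlerE] at [r = q]. *)
Let q t : R := expR (- (2 * t)).
Let ct t : R := (1 + q t) / (1 - q t).
Let th t : R := (1 - q t) / (1 + q t).

Lemma expRN2_01 t : 0 < t -> 0 <= q t < 1.
Proof. by move=> t0; rewrite /q expR_ge0 expR_lt1 oppr_lt0 mulr_gt0. Qed.

(* [u] and [v] stand for [|x - x'|^2] and [|x + x'|^2]. *)
Definition heat_factor t s u v : R := line_heat t s * (expR (- (d%:R * t)) *
  (mehler0 (d := d) (q t) * expR (- (4^-1 * (ct t * u + th t * v))))).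

Lemma line_heat_ge0 t s : 0 <= line_heat t s.
Proof. by rewrite mulr_ge0 ?expR_ge0. Qed.

Lemma heat_factor_ge0 t s u v : 0 <= heat_factor t s u v.
Proof.
apply: mulr_ge0; first exact: line_heat_ge0.
apply: mulr_ge0; first exact: expR_ge0.
by apply: mulr_ge0; [exact: ltW (mehler0_gt0 _)|exact: expR_ge0].
Qed.

Lemma heat_factor_le t s u v : 0 < t -> 0 <= v -> heat_factor t s u v <= heat_factor t s u 0.
Proof.
move=> t0 v0; have /andP[q0 q1] := expRN2_01 t0.
rewrite /heat_factor ler_wpM2l ?line_heat_ge0// ler_wpM2l ?expR_ge0// ler_wpM2l ?(ltW (mehler0_gt0 _))//.
rewrite ler_expR lerN2 ler_wpM2l// lerD2l ler_wpM2l//.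
by rewrite divr_ge0 ?subr_ge0 ?addr_ge0// ltW.
Qed.

Lemma heat_factorN t s u v : heat_factor t (- s) u v = heat_factor t s u v.
Proof. by rewrite /heat_factor /line_heat sqrrN. Qed.

Section measurability.
Context d1 (S : measurableType d1).

Lemma measurable_line_heat (t s : S -> R) : measurable_fun setT t -> measurable_fun setT s ->
  measurable_fun setT (fun w => line_heat (t w) (s w)).
Proof.
move=> mt ms; apply: measurable_funM.
  apply: (measurableT_comp (@measurable_expR R)).
  apply: (measurableT_comp (@oppr_measurable R setT)).
  apply: measurable_funD => //; apply: measurable_funM => //.
  exact: (measurableT_comp (@measurable_ln R)).
apply: (measurableT_comp (@measurable_expR R)).
apply: (measurableT_comp (@oppr_measurable R setT)).
apply: measurable_funM; first exact: measurable_funX.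
by apply: (measurableT_comp measurable_inv); exact: measurable_funM.
Qed.

Lemma measurable_heat_factor (t s u v : S -> R) : measurable_fun setT t -> measurable_fun setT s ->
  measurable_fun setT u -> measurable_fun setT v ->
  measurable_fun setT (fun w => heat_factor (t w) (s w) (u w) (v w)).
Proof.
move=> mt ms mu_ mv.
have mE (f : S -> R) : measurable_fun setT f -> measurable_fun setT (fun w => expR (- f w)).
  move=> mf; apply: (measurableT_comp (@measurable_expR R)).
  exact: (measurableT_comp (@oppr_measurable R setT)).
have mq : measurable_fun setT (fun w => q (t w)) by apply: mE; exact: measurable_funM.
apply: measurable_funM; first exact: measurable_line_heat.
apply: measurable_funM; first by apply: mE; exact: measurable_funM.
apply: measurable_funM.
  apply: measurable_funM => //; apply: mE; apply: measurable_funM => //.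
  apply: (measurableT_comp (@measurable_ln R)).
  by apply: measurable_funB => //; exact: measurable_funX.
apply: mE; apply: measurable_funM => //; apply: measurable_funD; apply: measurable_funM => //.
- apply: measurable_funM; first exact: measurable_funD.
  by apply: (measurableT_comp measurable_inv); exact: measurable_funB.
- apply: measurable_funM; first exact: measurable_funB.
  by apply: (measurableT_comp measurable_inv); exact: measurable_funD.
Qed.

End measurability.

(** The identities are [2 coth 2t - tanh t = coth t] and [sinh 2t = exp(2 t) (1 - q^2) / 2]. Of the
    power of 2 in front, [2^(- d/2)] cancels against this last denominator and the remaining [1/2]
    belongs to the heat kernel of the line. *)
Lemma heat_kernelE t z z' : 0 < t -> heat_kernel t z z' =
  heat_factor t (z.1 - z'.1) (sqnorm (z.2 - z'.2)) (sqnorm (z.2 + z'.2)).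
Proof.
move=> t0; have /andP[q0 q1] := expRN2_01 t0.
have E0 : 0 < expR t by exact: expR_gt0.
have qE : q t = (expR t)^-1 ^+ 2.
  by rewrite /q -expRN -expRM_natl; congr expR; ring.
have EE : expR (2 * t) = expR t ^+ 2 by rewrite -expRM_natl.
have E1 : 1 < expR t by rewrite expR_gt1.
have thE : tanh t = th t.
  rewrite /tanh /sinh /cosh /th qE expRN; field.
  by rewrite !gt_eqF//; nra.
have cth : 2 * coth (2 * t) - tanh t = ct t.
  rewrite thE /coth /sinh /cosh /ct /th qE expRN EE; field.
  move: (expR t) E1 => E E1; have E2 : 1 < E * E by nra.
  by rewrite !gt_eqF//= ?expr2 //; move: (E * E) E2 => F F1; nra.
have shE : sinh (2 * t) = expR (2 * t + ln (1 - q t ^+ 2) - ln 2).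
  rewrite expRD expRN !expRD !lnK ?posrE//; last by nra.
  rewrite /sinh expRN EE qE; field.
  by rewrite gt_eqF.
have -> : heat_kernel t z z' = expR (- (ln 2 + 2^-1 * ln pi + 2^-1 * ln t) +
    (- (d%:R * t)) + - (d%:R * (2^-1 * ln pi)) + - (d%:R / 2 * ln (1 - q t ^+ 2)))
    * expR (- heat_exponent t z z').
  rewrite /heat_kernel; congr (_ * _); rewrite shE.
  by rewrite /powR !gt_eqF ?pi_gt0 ?expR_gt0//= expRK -!expRD; congr expR; field.
have -> : heat_exponent t z z' = 4^-1 * (ct t * sqnorm (z.2 - z'.2) + th t * sqnorm (z.2 + z'.2)) +
    (z.1 - z'.1) ^+ 2 / (4 * t).
  by rewrite /heat_exponent cth thE; field; rewrite gt_eqF.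
rewrite /heat_factor /line_heat /mehler0.
have -> : (Num.sqrt pi ^+ d)^-1 = expR (- (d%:R * (2^-1 * ln pi))) :> R.
  by rewrite sqrt_expR_ln ?pi_gt0// -expRM_natl expRN.
rewrite -!expRD; congr expR.
ring.
Qed.

Lemma integral_line_heat t a : 0 < t -> (\int[mu]_s (line_heat t (s - a))%:E = 1)%E.
Proof.
move=> t0; have c0 : 0 < (4 * t)^-1 by rewrite invr_gt0 mulr_gt0.
rewrite /line_heat; under eq_integral do rewrite EFinM [(_ - a) ^+ 2 / _]mulrC.
rewrite ge0_integralZl_EFin ?expR_ge0//; last first.
  apply/measurable_EFinP; apply: (measurableT_comp (@measurable_expR R)).
  apply: (measurableT_comp (@oppr_measurable R setT)); apply: measurable_funM => //.
  by apply: measurable_funX; exact: measurable_funB.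
rewrite integral_gauss// -EFinM invrK sqrt_expR_ln; last by rewrite !mulr_gt0 ?pi_gt0.
rewrite !lnM ?posrE ?pi_gt0 ?mulr_gt0// -expRD (_ : 4 = 2 * 2); last by ring.
rewrite lnM ?posrE//; congr EFin.
by rewrite -[RHS]expR0; congr expR; field.
Qed.

(** The Gaussian integral evaluates to [2^d (1 + q)^(- d)], the powers of [1 - q] cancelling. *)
Lemma mehler0_int t (a : 'rV[R]_d) : 0 < t ->
  (\int[lebesgue_rV d]_w (mehler0 (d := d) (q t) * expR (- (4^-1 * (ct t * sqnorm (w - a)))))%:E <=
   (2 ^+ d)%:E)%E.
Proof.
move=> t0; have /andP[q0 q1] := expRN2_01 t0.
have c0 : 0 < 4^-1 * ct t by rewrite mulr_gt0 ?invr_gt0// divr_gt0 ?subr_gt0// ltr_wpDr.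
under eq_integral do rewrite mulrA EFinM.
rewrite ge0_integralZl_EFin ?(ltW (mehler0_gt0 _))//; last first.
  by have /integrableP[] := intg_gauss_rV a c0.
rewrite integral_gauss_rV// -EFinM lee_fin.
have v0 : 0 < pi / (4^-1 * ct t) by rewrite divr_gt0// pi_gt0.
have Eq : 1 - q t ^+ 2 = (1 - q t) * (1 + q t) by ring.
rewrite /mehler0 Eq sqrt_expR_ln ?pi_gt0// sqrt_expR_ln// -!expRM_natl -expRN -!expRD.
have -> : 2 ^+ d = expR (d%:R * ln 2) :> R by rewrite expRM_natl lnK ?posrE.
have a1 : 0 < 1 - q t by rewrite subr_gt0.
have a2 : 0 < 1 + q t by rewrite ltr_wpDr.
have c1 : 0 < ct t by rewrite divr_gt0.
rewrite ler_expR [ln (pi / _)]lnM ?posrE ?invr_gt0 ?pi_gt0// [ln (_ * ct t)^-1]lnV ?posrE//.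
rewrite [ln (4^-1 * _)]lnM ?posrE ?invr_gt0// [ln 4^-1]lnV ?posrE// (_ : 4 = 2 * 2); last by ring.
rewrite [ln (2 * 2)]lnM ?posrE// [ln (ct t)]lnM ?posrE ?invr_gt0// [ln (1 - q t)^-1]lnV ?posrE//.
rewrite lnM ?posrE//.
have d0 : (0 : R) <= d%:R by [].
have l0 : 0 <= ln (1 + q t) by rewrite ln_ge0// lerDl.
move: (ln pi) (ln 2) (ln (1 - q t)) (ln (1 + q t)) l0 => A B C D l0.
nra.
Qed.

Lemma heat_factor_mehler t s (x y : 'rV[R]_d) : 0 < t -> heat_factor t s (sqnorm (x - y)) (sqnorm (x + y)) =
  line_heat t s * (expR (- (d%:R * t)) * mehler (q t) x y).
Proof. by move=> t0; rewrite mehlerE// expRN2_01. Qed.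

Lemma integral_heat_factor t (a : R * 'rV[R]_d) : 0 < t ->
  (\int[lebesgue_RxRd d]_w (heat_factor t (w.1 - a.1) (sqnorm (w.2 - a.2)) 0)%:E <=
   (2 ^+ d * expR (- (d%:R * t)))%:E)%E.
Proof.
move=> t0; have msq : measurable_fun setT (fun x : 'rV[R]_d => sqnorm (x - a.2)).
  apply: continuous_measurable_rV; apply: smoothR_cont; apply: smoothR_sum => i _.
  under eq_fun do rewrite !mxE expr2.
  by apply: smoothR_mul; apply: smoothR_sub; [exact: smoothR_coord|exact: smoothR_cst|exact: smoothR_coord|exact: smoothR_cst].
have mx : measurable_fun setT (fun x : 'rV[R]_d =>
    mehler0 (d := d) (q t) * expR (- (4^-1 * (ct t * sqnorm (x - a.2))))).
  apply: measurable_funM => //; apply: (measurableT_comp (@measurable_expR R)).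
  apply: (measurableT_comp (@oppr_measurable R setT)).
  by apply: measurable_funM => //; exact: measurable_funM.
rewrite tonelli_RxRd; last 2 first.
- apply/measurable_EFinP; apply: measurable_heat_factor => //; last exact: (measurableT_comp msq).
  exact: measurable_funB.
- by move=> w; rewrite lee_fin heat_factor_ge0.
pose I2 := (\int[lebesgue_rV d]_x (mehler0 (d := d) (q t) *
  expR (- (4^-1 * (ct t * sqnorm (x - a.2)))))%:E)%E.
have I20 : (0 <= I2)%E by apply: integral_ge0 => x _; rewrite lee_fin mulr_ge0 ?expR_ge0// ltW// mehler0_gt0.
have E r : (\int[lebesgue_rV d]_x (heat_factor t (r - a.1) (sqnorm (x - a.2)) 0)%:E =
    (expR (- (d%:R * t)))%:E * I2 * (line_heat t (r - a.1))%:E)%E.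
  rewrite muleC /I2 muleA -EFinM -ge0_integralZl_EFin ?mulr_ge0 ?line_heat_ge0 ?expR_ge0//; last 2 first.
  - by move=> x _; rewrite lee_fin mulr_ge0 ?expR_ge0// ltW// mehler0_gt0.
  - exact/measurable_EFinP.
  by apply: eq_integral => x _; rewrite /heat_factor mulr0 addr0 -EFinM !mulrA.
under eq_integral do rewrite E.
have mh : measurable_fun setT (fun r : R => line_heat t (r - a.1)).
  by apply: measurable_line_heat => //; exact: measurable_funB.
rewrite ge0_integralZl//; last 3 first.
- exact/measurable_EFinP.
- by move=> r _; rewrite lee_fin line_heat_ge0.
- by rewrite mule_ge0// lee_fin expR_ge0.
by rewrite integral_line_heat// mule1 muleC EFinM lee_wpmul2r ?lee_fin ?expR_ge0// mehler0_int.
Qed.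

End heat_kernel_factorization.

(** * The integrable majorant *)

Lemma measurable_sqnorm d1 (S : measurableType d1) (R : realType) d (f : S -> 'rV[R]_d) :
  (forall i, measurable_fun setT (fun s => f s ord0 i)) ->
  measurable_fun setT (fun s => sqnorm (f s)).
Proof.
by move=> mf; apply: measurable_sum => i; exact: measurable_funX.
Qed.

Section kernel_bounds.
Context {R : realType} {d : nat}.
Hypothesis d1 : (1 <= d)%N.
Variable alpha : R.
Hypothesis alpha0 : 0 < alpha.
Local Notation mu := (@lebesgue_measure R).
Local Notation V := (measurableTypeR R * 'rV[R]_d)%type.
Implicit Types (z w a : R * 'rV[R]_d).

(** Agrees with [heat_kernel] for positive [t], while its factorized form makes joint measurability
    in all variables direct; [powpos] removes the other values of [t]. *)
Definition heat_ext (t : R) z w : R :=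
  heat_factor (d := d) t (z.1 - w.1) (sqnorm (z.2 - w.2)) (sqnorm (z.2 + w.2)).

Lemma heat_ext_ge0 t z w : 0 <= heat_ext t z w.
Proof. exact: heat_factor_ge0. Qed.

Lemma powpos_heat t z w : powpos alpha t * heat_kernel t z w = powpos alpha t * heat_ext t z w.
Proof.
rewrite /powpos; have [t0|t0] := ltP 0 t; last by rewrite !mul0r.
by rewrite heat_kernelE.
Qed.

Lemma KparE z w : Kpar alpha z w =
  ((Gamma alpha)^-1%:E * \int[mu]_t (powpos alpha t * heat_ext t z w)%:E)%E.
Proof.
rewrite /Kpar integral_powpos; congr (_ * _)%E.
by apply: eq_integral => t _; rewrite powpos_heat.
Qed.

(** Extended-real valued, since the integral diverges at the origin when [alpha <= (d+1)/2]. *)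
Definition Psi w : \bar R := (\int[mu]_t (powpos alpha t * heat_factor (d := d) t w.1 (sqnorm w.2) 0)%:E)%E.

Lemma sqnormN (x : 'rV[R]_d) : sqnorm (- x) = sqnorm x.
Proof. by apply: eq_bigr => i _; rewrite mxE sqrrN. Qed.

Lemma PsiN w : Psi (- w) = Psi w.
Proof. by apply: eq_integral => t _; rewrite /= heat_factorN sqnormN. Qed.

Lemma Psi_ge0 w : (0 <= Psi w)%E.
Proof. by apply: integral_ge0 => t _; rewrite lee_fin mulr_ge0 ?powpos_ge0 ?heat_factor_ge0. Qed.

Let Ginv0 : 0 <= (Gamma alpha)^-1.
Proof. by rewrite invr_ge0 ltW// Gamma_gt0. Qed.

Lemma measurable_powpos_heat_factor d2 (S : measurableType d2) (t s u v : S -> R) :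
  measurable_fun setT t -> measurable_fun setT s ->
  measurable_fun setT u -> measurable_fun setT v ->
  measurable_fun setT (fun w : S => (powpos alpha (t w) * heat_factor (d := d) (t w) (s w) (u w) (v w))%:E).
Proof.
move=> mt ms mu_ mv; apply/measurable_EFinP; apply: measurable_funM; last exact: measurable_heat_factor.
exact: (measurableT_comp (measurable_powpos _)).
Qed.

Lemma measurable_powpos_heat_ext z w : measurable_fun setT (fun t : R => (powpos alpha t * heat_ext t z w)%:E).
Proof. exact: measurable_powpos_heat_factor. Qed.

Lemma Kpar_le z w : (Kpar alpha z w <= (Gamma alpha)^-1%:E * Psi (z - w)%R)%E.
Proof.
rewrite KparE lee_wpmul2l//; apply: ge0_le_integral => //.
- by move=> t _; rewrite lee_fin mulr_ge0 ?powpos_ge0 ?heat_ext_ge0.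
- exact: measurable_powpos_heat_ext.
- exact: measurable_powpos_heat_factor.
move=> t _; rewrite lee_fin /powpos; have [t0|t0] := ltP 0 t; last by rewrite !mul0r.
by rewrite ler_wpM2l ?powR_ge0// heat_factor_le// sqnorm_ge0.
Qed.

Lemma Kpar_ge0 z w : (0 <= Kpar alpha z w)%E.
Proof.
rewrite KparE mule_ge0//; apply: integral_ge0 => t _.
by rewrite lee_fin mulr_ge0 ?powpos_ge0 ?heat_ext_ge0.
Qed.

Let mcoord2 d2 (S : measurableType d2) (f : S -> V) i : measurable_fun setT f ->
  measurable_fun setT (fun s => (f s).2 ord0 i).
Proof.
move=> mf; apply: (measurableT_comp (measurable_coord i)).
exact: (measurableT_comp measurable_snd mf).
Qed.

Let msqB d2 (S : measurableType d2) (f g : S -> V) : measurable_fun setT f -> measurable_fun setT g ->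
  measurable_fun setT (fun s => sqnorm ((f s).2 - (g s).2)).
Proof.
move=> mf mg; apply: measurable_sqnorm => i; under eq_fun do rewrite !mxE.
by apply: measurable_funB; exact: mcoord2.
Qed.

Let msqD d2 (S : measurableType d2) (f g : S -> V) : measurable_fun setT f -> measurable_fun setT g ->
  measurable_fun setT (fun s => sqnorm ((f s).2 + (g s).2)).
Proof.
move=> mf mg; apply: measurable_sqnorm => i; under eq_fun do rewrite !mxE.
by apply: measurable_funD; exact: mcoord2.
Qed.

Let mB1 d2 (S : measurableType d2) (f g : S -> V) : measurable_fun setT f -> measurable_fun setT g ->
  measurable_fun setT (fun s => (f s).1 - (g s).1 : R).
Proof.
by move=> mf mg; apply: measurable_funB; exact: (measurableT_comp measurable_fst).
Qed.

Lemma measurable_heat_ext d2 (S : measurableType d2) (t : S -> R) (f g : S -> V) :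
  measurable_fun setT t -> measurable_fun setT f -> measurable_fun setT g ->
  measurable_fun setT (fun s => (powpos alpha (t s) * heat_ext (t s) (f s) (g s))%:E).
Proof. by move=> mt mf mg; apply: measurable_powpos_heat_factor => //; [exact: mB1|exact: msqB|exact: msqD]. Qed.

Lemma measurable_Kpar : measurable_fun [set: V * V] (fun z : V * V => Kpar alpha z.1 z.2).
Proof.
under eq_fun do rewrite KparE.
apply: emeasurable_funM => //.
apply: (measurable_fun_fubini_tonelli_F
  (fun p : (V * V) * measurableTypeR R => (powpos alpha p.2 * heat_ext p.2 p.1.1 p.1.2)%:E)).
- apply: measurable_heat_ext => //.
  + exact: (measurableT_comp measurable_fst measurable_fst).
  + exact: (measurableT_comp measurable_snd measurable_fst).
- by move=> p; rewrite lee_fin mulr_ge0 ?powpos_ge0 ?heat_ext_ge0.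
Qed.

Lemma measurable_Psi_sub a : measurable_fun [set: V] (fun w => Psi (w - a)).
Proof.
apply: (measurable_fun_fubini_tonelli_F (fun p : V * measurableTypeR R =>
  (powpos alpha p.2 * heat_factor (d := d) p.2 (p.1.1 - a.1) (sqnorm (p.1.2 - a.2)) 0)%:E)).
- apply: measurable_powpos_heat_factor => //.
  + by apply: (mB1 (g := fun=> a)) => //.
  + by apply: (msqB (g := fun=> a)) => //.
- by move=> p; rewrite lee_fin mulr_ge0 ?powpos_ge0 ?heat_factor_ge0.
Qed.

(** By Tonelli the inner mass is at most [2^d exp(- d t)], and [d >= 1] bounds this by
    [2^d exp(- t)], which leaves the Gamma integral. The centre [a] is arbitrary because the row
    bound needs every translate. *)
Lemma integral_Psi_le a :
  (\int[lebesgue_RxRd d]_w Psi (w - a)%R <= (2 ^+ d * Gamma alpha)%:E)%E.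
Proof.
have mF : measurable_fun [set: V * measurableTypeR R] (fun p : V * measurableTypeR R =>
    (powpos alpha p.2 * heat_factor (d := d) p.2 (p.1.1 - a.1) (sqnorm (p.1.2 - a.2)) 0)%:E).
  apply: measurable_powpos_heat_factor => //.
  + by apply: (mB1 (g := fun=> a)) => //.
  + by apply: (msqB (g := fun=> a)) => //.
have F0 (p : V * measurableTypeR R) :
    (0 <= (powpos alpha p.2 * heat_factor (d := d) p.2 (p.1.1 - a.1) (sqnorm (p.1.2 - a.2)) 0)%:E)%E.
  by rewrite lee_fin mulr_ge0 ?powpos_ge0 ?heat_factor_ge0.
rewrite /Psi /= (fubini_tonelli (fun p : V * measurableTypeR R =>
    (powpos alpha p.2 * heat_factor (d := d) p.2 (p.1.1 - a.1) (sqnorm (p.1.2 - a.2)) 0)%:E))//=.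
have -> : (2 ^+ d * Gamma alpha)%:E = (\int[mu]_t (2 ^+ d * (powpos alpha t * expR (- t)))%:E)%E.
  under eq_integral do rewrite EFinM.
  rewrite ge0_integralZl_EFin ?exprn_ge0//.
  - by rewrite -(intgE measurableT (integrable_gamma alpha0)) -GammaE.
  - by move=> t _; rewrite lee_fin mulr_ge0 ?powpos_ge0 ?expR_ge0.
  - by move/integrableP : (integrable_gamma alpha0) => [].
apply: ge0_le_integral => //.
- by move=> t _; apply: integral_ge0 => w _; exact: (F0 (w, t)).
- apply: (measurable_fun_fubini_tonelli_G (fun p : V * measurableTypeR R =>
    (powpos alpha p.2 * heat_factor (d := d) p.2 (p.1.1 - a.1) (sqnorm (p.1.2 - a.2)) 0)%:E)) => //.
- apply/measurable_EFinP; apply: measurable_funM => //; apply/measurable_EFinP.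
  by move/integrableP : (integrable_gamma alpha0) => [].
move=> t _; under eq_integral do rewrite EFinM.
rewrite ge0_integralZl_EFin ?powpos_ge0//; last 2 first.
- by move=> w _; rewrite lee_fin heat_factor_ge0.
- apply/measurable_EFinP; apply: measurable_heat_factor => //.
  + by apply: (mB1 (f := id) (g := fun=> a)) => //.
  + by apply: (msqB (f := id) (g := fun=> a)) => //.
have [t0|t0] := ltP 0 t; last by rewrite /powpos ltNge t0 /= mul0e mul0r mulr0.
rewrite mulrCA EFinM lee_wpmul2l ?lee_fin ?powpos_ge0//.
apply: (le_trans (integral_heat_factor a t0)); rewrite lee_fin ler_wpM2l ?exprn_ge0//.
by rewrite ler_expR lerN2 ler_peMl ?(ltW t0)// ler1n.
Qed.

Lemma integrable_Psi : (lebesgue_RxRd d).-integrable setT Psi.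
Proof.
apply/integrableP; split.
  by have := measurable_Psi_sub 0; under eq_fun do rewrite subr0.
under eq_integral do rewrite (gee0_abs (Psi_ge0 _)).
apply: le_lt_trans (ltry (2 ^+ d * Gamma alpha)); apply: le_trans (integral_Psi_le 0).
by rewrite le_eqVlt; apply/orP; left; apply/eqP; apply: eq_integral => w _; rewrite subr0.
Qed.

Let A := (Gamma alpha)^-1 * (2 ^+ d * Gamma alpha).

Lemma Kpar_row z : (\int[lebesgue_RxRd d]_w Kpar alpha z w <= A%:E)%E.
Proof.
apply: (@le_trans _ _ (\int[lebesgue_RxRd d]_w ((Gamma alpha)^-1%:E * Psi (w - z)%R))%E).
  apply: ge0_le_integral => //.
  - by move=> w _; exact: Kpar_ge0.
  - exact: (measurableT_comp measurable_Kpar (pair1_measurable z)).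
  - by apply: emeasurable_funM => //; exact: measurable_Psi_sub.
  by move=> w _; rewrite -PsiN opprB; exact: Kpar_le.
rewrite ge0_integralZl_EFin//; last exact: measurable_Psi_sub.
  by rewrite /A EFinM lee_wpmul2l// integral_Psi_le.
by move=> w _; exact: Psi_ge0.
Qed.

Lemma KparC z w : Kpar alpha z w = Kpar alpha w z.
Proof.
rewrite (KparE z w) (KparE w z); congr (_ * _)%E; apply: eq_integral => t _.
by rewrite /heat_ext -opprB heat_factorN -(opprB w.2) sqnormN [z.2 + _]addrC.
Qed.

Lemma Kpar_col w : (\int[lebesgue_RxRd d]_z Kpar alpha z w <= A%:E)%E.
Proof. by under eq_integral do rewrite KparC; exact: Kpar_row. Qed.

Lemma Kpar_bnd_gt0 : 0 < A.
Proof. by rewrite /A mulr_gt0 ?invr_gt0 ?mulr_gt0 ?exprn_gt0 ?Gamma_gt0. Qed.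

Lemma Kpar_ae_integrable p f : (1 <= p)%E -> inLp (lebesgue_RxRd d) p f ->
  {ae lebesgue_RxRd d, forall z, Kpar_integrable alpha f z}.
Proof.
exact: (schur_integrable_ae measurable_Kpar Kpar_ge0 Kpar_bnd_gt0 Kpar_row Kpar_col).
Qed.

Lemma Kpar_bounded p : (1 <= p)%E ->
  bounded_linear_on_Lp (lebesgue_RxRd d) p (@Kpar_op R d alpha).
Proof.
exact: (schur_bounded measurable_Kpar Kpar_ge0 Kpar_bnd_gt0 Kpar_row Kpar_col).
Qed.

End kernel_bounds.

(** * Fubini and the Fourier transform of the Gaussian *)

Section fubini_real.
Context d1 d2 (T1 : measurableType d1) (T2 : measurableType d2) (R : realType).
Variables (m1 : {sigma_finite_measure set T1 -> \bar R}) (m2 : {sigma_finite_measure set T2 -> \bar R}).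
Variable F : T1 -> T2 -> R.
Hypothesis mF : measurable_fun setT (fun z => F z.1 z.2).
Hypothesis Foo : (\int[m1]_s \int[m2]_u `|F s u|%:E < +oo)%E.

Let G (z : T1 * T2) : \bar R := (F z.1 z.2)%:E.

Let iG : (m1 \x m2)%E.-integrable setT G.
Proof.
apply: (proj2 (@integrable12ltyP _ _ _ _ _ m1 m2 G _)) => //; exact/measurable_EFinP.
Qed.

(** The real inner integral agrees with the extended one only almost everywhere: on a null set
    [fine] may replace an infinite value by 0. *)
Let fG1 : ae_eq m1 setT (EFin \o (fun s => \int[m2]_u F s u)) (fun s => \int[m2]_u G (s, u))%E.
Proof.
apply: filterS (ae_integrable1 iG) => s si _ /=.
by rewrite /Rintegral fineK//; exact: integrable_fin_num.
Qed.

Let fG2 : ae_eq m2 setT (EFin \o (fun u => \int[m1]_s F s u)) (fun u => \int[m1]_s G (s, u))%E.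
Proof.
apply: filterS (ae_integrable2 iG) => s si _ /=.
by rewrite /Rintegral fineK//; exact: integrable_fin_num.
Qed.

Let mG1 : measurable_fun setT (EFin \o (fun s => \int[m2]_u F s u)).
Proof.
apply/measurable_EFinP; apply: (measurableT_comp (fine_measurable measurableT)).
exact: (measurable_fubini_F iG).
Qed.

Let mG2 : measurable_fun setT (EFin \o (fun u => \int[m1]_s F s u)).
Proof.
apply/measurable_EFinP; apply: (measurableT_comp (fine_measurable measurableT)).
exact: (measurable_fubini_G iG).
Qed.

Lemma Rfubini_integrable1 : m1.-integrable setT (EFin \o (fun s => \int[m2]_u F s u)).
Proof.
have i1 := integrable_fubini_F iG; apply: le_integrable i1 => // s _ /=.
rewrite /Rintegral /fubini_F /G.
by case: (\int[m2]_u _)%E => //=; rewrite normr0 leey.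
Qed.

Lemma Rintegral_prod2 : \int[m2]_u \int[m1]_s F s u = \int[(m1 \x m2)%E]_z F z.1 z.2.
Proof.
rewrite /Rintegral; congr fine.
have mF2 := measurable_fubini_G iG.
transitivity (\int[m2]_u \int[m1]_s G (s, u))%E; first exact: ae_eq_integral.
exact: integral21_prod_meas1.
Qed.

Lemma Rfubini : \int[m1]_s \int[m2]_u F s u = \int[m2]_u \int[m1]_s F s u.
Proof.
rewrite /Rintegral; congr fine.
have mF1 := measurable_fubini_F iG; have mF2 := measurable_fubini_G iG.
transitivity (\int[m1]_s \int[m2]_u G (s, u))%E; first exact: ae_eq_integral.
transitivity (\int[m2]_u \int[m1]_s G (s, u))%E; last by apply: ae_eq_integral => //; exact: ae_eq_sym.
exact: Fubini.
Qed.

End fubini_real.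

Lemma Rfubini_integrable2 d1 d2 (T1 : measurableType d1) (T2 : measurableType d2) (R : realType)
    (m1 : {sigma_finite_measure set T1 -> \bar R}) (m2 : {sigma_finite_measure set T2 -> \bar R})
    (F : T1 -> T2 -> R) :
  measurable_fun setT (fun z => F z.1 z.2) -> (\int[m1]_s \int[m2]_u `|F s u|%:E < +oo)%E ->
  m2.-integrable setT (EFin \o (fun u => \int[m1]_s F s u)).
Proof.
move=> mF Foo.
have mFs : measurable_fun setT (fun z : T2 * T1 => F z.2 z.1).
  rewrite (_ : (fun z => _) = (fun z => F z.1 z.2) \o (fun z : T2 * T1 => (z.2, z.1)))//.
  by apply: measurableT_comp => //; exact: measurable_fun_pair.
apply: (@Rfubini_integrable1 _ _ _ _ _ m2 m1 (fun u s => F s u)) => //.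
rewrite -(@fubini_tonelli _ _ _ _ _ m1 m2 (fun z => `|F z.1 z.2|%:E))//.
by apply/measurable_EFinP; exact: measurableT_comp.
Qed.

Lemma fubini_dom d1 d2 (T1 : measurableType d1) (T2 : measurableType d2) (R : realType)
    (m1 : {sigma_finite_measure set T1 -> \bar R}) (m2 : {sigma_finite_measure set T2 -> \bar R})
    (F : T1 -> T2 -> R) (A : T1 -> R) (B : T2 -> R) :
  measurable_fun setT (fun z => F z.1 z.2) -> (forall s u, `|F s u| <= A s * B u) ->
  (forall s, 0 <= A s) -> (forall u, 0 <= B u) ->
  m1.-integrable setT (EFin \o A) -> m2.-integrable setT (EFin \o B) ->
  (\int[m1]_s \int[m2]_u `|F s u|%:E < +oo)%E.
Proof.
move=> mF FAB A0 B0 iA iB.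
have [mA Aoo] := integrableP _ _ _ iA; have [mB Boo] := integrableP _ _ _ iB.
have mFa : measurable_fun setT (fun z => `|F z.1 z.2|%:E).
  by apply/measurable_EFinP; exact: measurableT_comp.
have {}Aoo : (\int[m1]_s (A s)%:E < +oo)%E.
  by move: Aoo; under eq_integral do rewrite /= ger0_norm//.
have {}Boo : (\int[m2]_s (B s)%:E < +oo)%E.
  by move: Boo; under eq_integral do rewrite /= ger0_norm//.
have b0 : (0 <= \int[m2]_u (B u)%:E)%E by apply: integral_ge0 => u _; rewrite lee_fin.
apply: (@le_lt_trans _ _ (\int[m1]_s ((A s)%:E * \int[m2]_u (B u)%:E))%E).
  apply: ge0_le_integral => //.
  - by move=> s _; apply: integral_ge0 => u _; rewrite lee_fin.
  - apply: (measurable_fun_fubini_tonelli_F (fun z => `|F z.1 z.2|%:E)%E) => //.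
  - by apply: emeasurable_funM.
  move=> s _; rewrite -ge0_integralZl_EFin//; last by move=> u _; rewrite lee_fin.
  apply: ge0_le_integral => //.
  - exact: (measurableT_comp mFa (pair1_measurable s)).
  - exact: emeasurable_funM.
  - by move=> u _; rewrite -EFinM lee_fin.
rewrite ge0_integralZr//; last by move=> s _; rewrite lee_fin.
by rewrite lte_mul_pinfty// ?ge0_fin_numE//; apply: integral_ge0 => s _; rewrite lee_fin.
Qed.

Section gaussian_fourier.
Context {R : realType}.
Local Notation mu := (@lebesgue_measure R).
Local Notation intg f := (mu.-integrable setT (EFin \o f)).

Lemma integral_gauss0 (c : R) : 0 < c ->
  (\int[mu]_y (expR (- (c * y ^+ 2)))%:E = (Num.sqrt (pi / c))%:E)%E.
Proof. by move=> c0; have := integral_gauss 0 c0; under eq_integral do rewrite subr0. Qed.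

Lemma intg_gauss1 (c : R) : 0 < c -> intg (fun x => expR (- (c * x ^+ 2))).
Proof.
move=> c0; apply/integrableP; split.
  apply/measurable_EFinP; apply: (measurableT_comp (@measurable_expR R)).
  apply: (measurableT_comp (@oppr_measurable R setT)); apply: measurable_funM => //.
under eq_integral do rewrite /= (ger0_norm (expR_ge0 _)).
by rewrite integral_gauss0// ltry.
Qed.

Variable t : R.
Hypothesis t0 : 0 < t.
Let g x := expR (- (t * x ^+ 2)).

Let mg : measurable_fun setT g.
Proof. by move/integrableP : (intg_gauss1 t0) => [/measurable_EFinP]. Qed.

(** Half of the Gaussian absorbs the polynomial, with constant [1 + 2/t]. This one majorant serves
    for the cosine integral, for its derivative in [s] and for the integration by parts. *)
Lemma intg_gauss_poly : intg (fun x => (1 + x ^+ 2) * g x).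
Proof.
have t20 : 0 < t / 2 by rewrite divr_gt0.
apply: (@intg_le _ (measurableTypeR R) R mu setT measurableT _ (fun x : R => (1 + 2 / t) * expR (- (t / 2 * x ^+ 2)))).
- apply: measurable_funM => //; apply: measurable_funD => //.
- move=> x _; rewrite ger0_norm ?mulr_ge0 ?expR_ge0 ?addr_ge0 ?sqr_ge0//.
  have -> : g x = expR (- (t / 2 * x ^+ 2)) * expR (- (t / 2 * x ^+ 2)).
    by rewrite -expRD; congr expR; field.
  rewrite mulrA ler_wpM2r ?expR_ge0// expRN ler_pdivrMr ?expR_gt0//.
  have h := expR_ge1Dx (t / 2 * x ^+ 2).
  have c1 : 0 <= 1 + 2 / t by rewrite addr_ge0// divr_ge0// ltW.
  rewrite (le_trans _ (ler_wpM2l c1 h))//.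
  have -> : (1 + 2 / t) * (1 + t / 2 * x ^+ 2) = 1 + x ^+ 2 + (2 / t + t / 2 * x ^+ 2).
    by field; rewrite gt_eqF.
  rewrite lerDl; apply: addr_ge0; first by apply: divr_ge0 => //; exact: ltW.
  by apply: mulr_ge0; [exact: ltW|exact: sqr_ge0].
- by apply: intgZl => //; exact: intg_gauss1.
Qed.

Let abs_le (x : R) : `|x| <= 1 + x ^+ 2.
Proof. by rewrite ler_norml; apply/andP; split; nra. Qed.

Let one_le (x : R) : 1 <= 1 + x ^+ 2.
Proof. by rewrite lerDl sqr_ge0. Qed.

Let mtrig (h : R -> R) s : continuous h -> measurable_fun setT (fun x : R => h (s * x)).
Proof.
move=> ch; apply: (measurableT_comp (continuous_measurable_fun ch)).
exact: measurable_funM.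
Qed.

Let intg_dom (f : R -> R) (C : R) : measurable_fun setT f -> (forall x, `|f x| <= C * (1 + x ^+ 2)) ->
  intg (fun x => f x * g x).
Proof.
move=> mf fC; apply: (@intg_le _ (measurableTypeR R) R mu setT measurableT _ (fun x : R => C * ((1 + x ^+ 2) * g x))).
- exact: measurable_funM.
- by move=> x _; rewrite normrM (ger0_norm (expR_ge0 _)) mulrA ler_wpM2r ?expR_ge0.
- by apply: intgZl => //; exact: intg_gauss_poly.
Qed.

Let cos_le1 (x : R) : `|cos x| <= 1.
Proof. by rewrite ler_norml cos_geN1 cos_le1. Qed.

Let sin_le1 (x : R) : `|sin x| <= 1.
Proof. by rewrite ler_norml sin_geN1 sin_le1. Qed.

Let phi s : R := \int[mu]_x (cos (s * x) * g x).
Let psi s : R := \int[mu]_x (x * sin (s * x) * g x).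

Let intg_cos s : intg (fun x => cos (s * x) * g x).
Proof.
apply: (@intg_dom _ 1); first exact: (mtrig s (@continuous_cos R)).
by move=> x; rewrite mul1r (le_trans (cos_le1 _)).
Qed.

Let intg_sin s : intg (fun x => x * sin (s * x) * g x).
Proof.
apply: (@intg_dom _ 1).
  by apply: measurable_funM => //; exact: (mtrig s (@continuous_sin R)).
move=> x; rewrite normrM mul1r (le_trans _ (abs_le x))//.
by rewrite ler_piMr// sin_le1.
Qed.

Let d_g x : is_derive x (1 : R) g (- (2 * t * x) * g x).
Proof.
have h : is_derive x (1 : R) (fun x => - (t * (x * x))) (- (t * (1 * x + x * 1))).
  by apply: is_derive_opp; apply: is_derive_cstmul; apply: is_derive_mul; exact: is_derive_id.
have := is_derive_chain (is_derive_expR _) h; rewrite (_ : (fun y => expR _) = g); last first.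
  by apply/funext => y; rewrite /g expr2.
by move=> H; apply: (is_derive_eq H); rewrite /g expr2; ring.
Qed.

Let d_sin s x : is_derive x (1 : R) (fun x => sin (s * x)) (s * cos (s * x)).
Proof.
have h : is_derive x (1 : R) (fun x => s * x) (s * 1) by apply: is_derive_cstmul; exact: is_derive_id.
by apply: (is_derive_eq (is_derive_chain (is_derive_sin _) h)); ring.
Qed.

Let d_cos x s : is_derive s (1 : R) (fun s => cos (s * x)) (- (x * sin (s * x))).
Proof.
have h : is_derive s (1 : R) (fun s => s * x) (1 * x + s * 0).
  by apply: is_derive_mul.
by apply: (is_derive_eq (is_derive_chain (is_derive_cos _) h)); ring.
Qed.

Let H s x := sin (s * x) * g x.
Let H' s x := s * (cos (s * x) * g x) - 2 * t * (x * sin (s * x) * g x).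

Let d_H s x : is_derive x (1 : R) (H s) (H' s x).
Proof. by apply: (is_derive_eq (is_derive_mul (d_sin s x) (d_g x))); rewrite /H'; ring. Qed.

Let is_derive_continuous (f f' : R -> R) : (forall x, is_derive x (1 : R) f (f' x)) -> continuous f.
Proof.
move=> df x; apply: differentiable_continuous; apply/derivable1_diffP.
exact: (@ex_derive _ _ _ _ _ _ _ (df x)).
Qed.

Let c_H' s : continuous (H' s).
Proof.
have ci : continuous (fun x : R => x) by move=> ?; exact: cvg_id.
have cg := is_derive_continuous d_g; have cs := is_derive_continuous (d_sin s).
have cc : continuous (fun x : R => cos (s * x)).
  apply: (@is_derive_continuous _ (fun x => - sin (s * x) * s)) => x.
  have h : is_derive x (1 : R) (fun x => s * x) (s * 1) by apply: is_derive_cstmul; exact: is_derive_id.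
  by apply: (is_derive_eq (is_derive_chain (is_derive_cos _) h)); ring.
rewrite (_ : H' s = fun x => s * (cos (s * x) * g x) + - (2 * t) * (x * sin (s * x) * g x)).
  by apply: continuousR_add; apply: continuousR_mul; [exact: continuousR_cst|exact: continuousR_mul|exact: continuousR_cst|apply: continuousR_mul => //; exact: continuousR_mul].
by apply/funext => x; rewrite /H' mulNr.
Qed.

Let intg_H' s : intg (H' s).
Proof. by apply: intgB => //; apply: intgZl. Qed.

Let g_le n : g n.+1%:R <= t^-1 * n.+1%:R^-1.
Proof.
have n0 : 0 < n.+1%:R :> R by [].
have n1 : 1 <= n.+1%:R :> R by rewrite ler1n.
rewrite /g expRN -invfM lef_pV2 ?posrE ?mulr_gt0 ?expR_gt0//.
apply: (le_trans _ (expR_ge1Dx _)).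
move: (n.+1%:R) n0 n1 => N N0 N1.
have h : 0 <= t * N * (N - 1) by rewrite !mulr_ge0 ?subr_ge0// ltW.
nra.
Qed.

(** On [[-(n+1), n+1]] the integral is a boundary term of [sin(s x) g(x)], which tends to 0 by
    [g_le]. *)
Let integral_H' s : \int[mu]_x H' s x = 0.
Proof.
pose D n := `[- n.+1%:R, n.+1%:R]%classic : set R.
have c1 : \int[mu]_x ((H' s \_ (D n)) x) @[n --> \oo] --> \int[mu]_x H' s x.
  have mH : measurable_fun setT (H' s) by apply: (intg_meas (intg_H' s)).
  refine (proj2 (@dominated_cvg_Rintegral _ (measurableTypeR R) R mu (fun n => H' s \_ (D n)) (H' s)
    (fun x => `|H' s x|) _ mH _ _ _)).
  - move=> n; apply/measurable_restrict => //; first exact: measurable_itv.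
    by rewrite setTI; exact: (measurable_funTS mH).
  - move=> x; apply: cvg_near_cst; exists (Num.truncn `|x|) => // n /= xn.
    rewrite patchE mem_set// /D /= in_itv/= -ler_norml.
    by rewrite ltW// (lt_le_trans (truncnS_gt _))// ler_nat.
  - exact: intg_abs.
  - by move=> n x; rewrite patchE; case: ifP => // _; rewrite normr0.
have E n : \int[mu]_x ((H' s \_ (D n)) x) = H s n.+1%:R - H s (- n.+1%:R).
  rewrite -Rintegral_mkcond /Rintegral (@continuous_FTC2 _ _ (H s))//.
  - by rewrite (@lt_trans _ _ 0)// oppr_lt0.
  - by apply: continuous_subspaceT; exact: c_H'.
  - have cH := is_derive_continuous (d_H s); split.
    + by move=> x _; exact: (@ex_derive _ _ _ _ _ _ _ (d_H s x)).
    + by apply: cvg_at_right_filter; exact: cH.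
    + by apply: cvg_at_left_filter; exact: cH.
  - by move=> x _; rewrite derive1E; exact: (@derive_val _ _ _ _ _ _ _ (d_H s x)).
rewrite (_ : (fun n => _) = (fun n => H s n.+1%:R - H s (- n.+1%:R))) in c1; last exact/funext.
have c2 : H s n.+1%:R - H s (- n.+1%:R) @[n --> \oo] --> (0 : R).
  apply/cvgr0Pnorm_le => e e0.
  have : 2 / t * harmonic n @[n --> \oo] --> (2 / t * 0 : R) by apply: cvgMr; exact: cvg_harmonic.
  rewrite mulr0 => /cvgr0Pnorm_le /(_ _ e0).
  apply: filterS => n; rewrite ger0_norm; last by rewrite mulr_ge0 ?divr_ge0 ?(ltW t0)// invr_ge0.
  apply: le_trans; apply: (le_trans (ler_normB _ _)).
  have h x : `|H s x| <= g x.
    by rewrite normrM (ger0_norm (expR_ge0 _)) ler_piMl ?expR_ge0.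
  have gN : g (- n.+1%:R) = g n.+1%:R by rewrite /g sqrrN.
  apply: (le_trans (lerD (h _) (h _))); rewrite gN.
  apply: (le_trans (lerD (g_le n) (g_le n))).
  by rewrite -mulr2n -[leLHS]mulr_natl /harmonic /= -mulrA.
exact: (cvg_unique _ c1 c2).
Qed.

Let psiE s : psi s = s / (2 * t) * phi s.
Proof.
have := integral_H' s; rewrite /H' RintegralB//; [|exact: intgZl|exact: intgZl].
rewrite !RintegralZl// -/(phi s) -/(psi s) => h.
have -> : psi s = (2 * t * psi s) / (2 * t) by field; rewrite gt_eqF.
have -> : 2 * t * psi s = s * phi s by lra.
by field; rewrite gt_eqF.
Qed.

Let d_phi s : is_derive s (1 : R) phi (- psi s).
Proof.
have D1 x y : partial1of2 (fun s x => cos (s * x) * g x) x y = - (y * sin (x * y)) * g y.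
  rewrite partial1of2E.
  have h := is_derive_mul (d_cos y x) (is_derive_cst (g y) x (1:R)).
  by rewrite (@derive_val _ _ _ _ _ _ _ h) mulr0 addr0.
have dr (x y : R) : derivable (fun s : R => cos (s * y) * g y) x 1.
  exact: (@ex_derive _ _ _ _ _ _ _ (is_derive_mul (d_cos y x) (is_derive_cst (g y) x (1:R)))).
have bnd x y : `|partial1of2 (fun s x => cos (s * x) * g x) x y| <= (1 + y ^+ 2) * g y.
  rewrite D1 normrM normrN (ger0_norm (expR_ge0 _)) ler_wpM2r ?expR_ge0//.
  rewrite normrM (le_trans _ (abs_le y))//.
  by rewrite ler_piMr// sin_le1.
have s1 : `]s - 1, s + 1[%classic s.
  by rewrite /= in_itv/= ltrBlDr ltrDl ltr01.
have g0 y : 0 <= (1 + y ^+ 2) * g y by rewrite mulr_ge0 ?expR_ge0// addr_ge0// sqr_ge0.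
split.
  exact: (derivable_under_integral measurableT s1 (fun x _ => intg_cos x) (fun x y _ _ => dr x y)
    g0 intg_gauss_poly (fun x y _ _ => bnd x y)).
rewrite -derive1E (differentiation_under_integral measurableT s1 (fun x _ => intg_cos x) (fun x y _ _ => dr x y)
    g0 intg_gauss_poly (fun x y _ _ => bnd x y)).
rewrite /psi -mulN1r -RintegralZl//; apply: eq_Rintegral => y _; rewrite D1; ring.
Qed.

(** Differentiation under the integral and integration by parts give [phi' = - s / (2 t) phi]. Hence
    [phi s * exp(s^2 / (4 t))] is constant, equal to the Gaussian integral [phi 0]. *)
Lemma gaussian_fourier s :
  \int[mu]_x (cos (s * x) * expR (- (t * x ^+ 2))) = 2 * pi * line_heat t s.
Proof.
pose E s := phi s * expR (s * s / (4 * t)).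
have dE u : is_derive u (1 : R) E 0.
  have h : is_derive u (1 : R) (fun s => (4 * t)^-1 * (s * s)) ((4 * t)^-1 * (1 * u + u * 1)).
    by apply: is_derive_cstmul; apply: is_derive_mul; exact: is_derive_id.
  have := is_derive_mul (d_phi u) (is_derive_chain (is_derive_expR _) h).
  rewrite (_ : (fun y => phi y * _) = E); last by apply/funext => y; rewrite /E [_ / _]mulrC.
  move=> H0; apply: (is_derive_eq H0); rewrite psiE.
  by move: (phi u) (expR _) => a b; field; rewrite gt_eqF.
have := is_derive_0_is_cst s 0 dE; rewrite /E !mul0r expR0 mulr1 => h.
have p0 : phi 0 = Num.sqrt (pi / t).
  rewrite /phi; under eq_Rintegral do rewrite mul0r cos0 mul1r.
  by rewrite /Rintegral integral_gauss0.
rewrite -[LHS]/(phi s); have -> : phi s = phi 0 * expR (- (s ^+ 2 / (4 * t))).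
  by rewrite -h -mulrA -expRD expr2 subrr expR0 mulr1.
rewrite /line_heat mulrA; congr (_ * _); rewrite p0 sqrt_expR_ln ?divr_gt0 ?pi_gt0//.
rewrite lnM ?posrE ?invr_gt0 ?pi_gt0// lnV ?posrE//.
have -> : 2 * pi = expR (ln 2 + ln pi) :> R by rewrite expRD !lnK ?posrE ?pi_gt0.
by rewrite -expRD; congr expR; field.
Qed.

End gaussian_fourier.

(** * A single mode *)

Section odd_integral.
Context {R : realType}.
Local Notation mu := (@lebesgue_measure R).

Lemma ge0_integralN (f : R -> \bar R) :
  measurable_fun setT f -> (forall x, 0 <= f x)%E ->
  (\int[mu]_x f (- x)%R = \int[mu]_x f x)%E.
Proof.
move=> mf f0; have mN : measurable_fun setT (-%R : R -> measurableTypeR R) by exact: oppr_measurable.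
transitivity (\int[pushforward mu (-%R : R -> measurableTypeR R)]_x f x)%E; last first.
  by apply: eq_measure_integral => A mA _; exact: lebesgue_measureN.
by rewrite ge0_integral_pushforward//= preimage_setT.
Qed.

Lemma Rintegral_odd (h : R -> R) : measurable_fun setT h -> (forall x, h (- x) = - h x) ->
  \int[mu]_x h x = 0.
Proof.
move=> mh odd; rewrite /Rintegral integralE.
have -> : (\int[mu]_x (EFin \o h)^\- x = \int[mu]_x (EFin \o h)^\+ x)%E.
  rewrite -[RHS]ge0_integralN//; last by apply: measurable_funepos; exact/measurable_EFinP.
  by apply: eq_integral => x _; rewrite funeposE funenegE /= odd.
(* If the common value of the two parts is infinite, the difference is infinite as well and [fine]
   yields 0. *)
by case: (\int[mu]_x _)%E => [r| |] //=; rewrite subrr.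
Qed.

End odd_integral.

Section mode.
Context {R : realType} {d : nat}.
Local Notation mu := (@lebesgue_measure R).
Local Notation V := (measurableTypeR R * 'rV[R]_d)%type.
Local Notation L := (@lebesgue_RxRd R d).
Variables (rho : R) (G : V -> R).
Hypothesis iG : L.-integrable setT (EFin \o G).

(* The phase [phi] is [0] for the cosine and [- pi / 2] for the sine. *)
Definition wave (phi tau : R) : R := \int[L]_w (cos ((rho - w.1) * tau + phi) * G w).

Let mG : measurable_fun setT G.
Proof. exact: (intg_meas iG). Qed.

Let cosabs (x : R) : `|cos x| <= 1.
Proof. by rewrite ler_norml cos_geN1 cos_le1. Qed.

Let mc d1 (S : measurableType d1) (f : S -> V) (t : S -> R) phi : measurable_fun setT f ->
  measurable_fun setT t -> measurable_fun setT (fun s => cos ((rho - (f s).1) * t s + phi)).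
Proof.
move=> mf mt; apply: (measurableT_comp (continuous_measurable_fun (@continuous_cos R))).
apply: measurable_funD => //; apply: measurable_funM => //.
by apply: measurable_funB => //; exact: (measurableT_comp measurable_fst).
Qed.

Let icG phi tau : L.-integrable setT (EFin \o (fun w => cos ((rho - w.1) * tau + phi) * G w)).
Proof.
apply: (intg_le measurableT _ _ (intg_abs iG)).
- by apply: measurable_funM => //; exact: mc.
- by move=> w _; rewrite normrM ler_piMl// cosabs.
Qed.

Lemma wave_le phi tau : `|wave phi tau| <= \int[L]_w `|G w|.
Proof.
apply: (le_trans (le_normr_Rintegral _ (icG phi tau))) => //.
apply: le_Rintegral => //; [exact: (intg_abs (icG _ _))|exact: (intg_abs iG)|].
by move=> w _; rewrite normrM ler_piMl// cosabs.
Qed.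

Lemma measurable_wave phi : measurable_fun setT (wave phi).
Proof.
have mF : measurable_fun setT (fun z : R * V => (cos ((rho - z.2.1) * z.1 + phi) * G z.2)%:E).
  apply/measurable_EFinP; apply: measurable_funM; first exact: mc.
  exact: measurableT_comp.
apply: (measurableT_comp (fine_measurable measurableT)).
rewrite (_ : (fun tau => _) = (fun tau => \int[L]_w (fun z : R * V => (cos ((rho - z.2.1) * z.1 + phi) * G z.2)%:E)^\+ (tau, w) -
   \int[L]_w (fun z : R * V => (cos ((rho - z.2.1) * z.1 + phi) * G z.2)%:E)^\- (tau, w))%E); last first.
  apply/funext => z; rewrite integralE; congr (_ - _)%E; apply: eq_integral => w _.
    by rewrite !funeposE.
  by rewrite !funenegE.
apply: emeasurable_funB.
- by apply: measurable_fun_fubini_tonelli_F => //; exact: measurable_funepos.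
- by apply: measurable_fun_fubini_tonelli_F => //; exact: measurable_funeneg.
Qed.

Definition avg (t : R) : R := \int[L]_w (line_heat t (rho - w.1) * G w).

Let gexp0 (t tau : R) : 0 <= expR (- (t * tau ^+ 2)). Proof. exact: expR_ge0. Qed.

Lemma measurable_avg : measurable_fun setT avg.
Proof.
have mH : measurable_fun setT (fun z : R * V => (line_heat z.1 (rho - z.2.1) * G z.2)%:E).
  apply/measurable_EFinP; apply: measurable_funM; last exact: measurableT_comp.
  apply: measurable_line_heat => //; apply: measurable_funB => //.
  exact: (measurableT_comp measurable_fst measurable_snd).
apply: (measurableT_comp (fine_measurable measurableT)).
rewrite (_ : (fun tau => _) = (fun tau => \int[L]_w (fun z : R * V => (line_heat z.1 (rho - z.2.1) * G z.2)%:E)^\+ (tau, w) -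
   \int[L]_w (fun z : R * V => (line_heat z.1 (rho - z.2.1) * G z.2)%:E)^\- (tau, w))%E); last first.
  apply/funext => z; rewrite integralE; congr (_ - _)%E; apply: eq_integral => w _.
    by rewrite !funeposE.
  by rewrite !funenegE.
apply: emeasurable_funB.
- by apply: measurable_fun_fubini_tonelli_F => //; exact: measurable_funepos.
- by apply: measurable_fun_fubini_tonelli_F => //; exact: measurable_funeneg.
Qed.

Lemma wave_gauss t : 0 < t -> \int[mu]_tau (expR (- (t * tau ^+ 2)) * wave 0 tau) = 2 * pi * avg t.
Proof.
move=> t0.
pose F (tau : measurableTypeR R) (w : V) : R :=
  cos ((rho - w.1) * tau + 0) * expR (- (t * tau ^+ 2)) * G w.
have mF : measurable_fun setT (fun z => F z.1 z.2).
  apply: measurable_funM; last exact: (measurableT_comp mG).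
  apply: measurable_funM; first exact: mc.
  have := intg_meas (intg_gauss1 t0) => h; exact: (measurableT_comp h).
have iabs := intg_abs iG.
have Foo : (\int[mu]_s \int[L]_u `|F s u|%:E < +oo)%E.
  apply: (@fubini_dom _ _ (measurableTypeR R) V R mu L F (fun tau => expR (- (t * tau ^+ 2))) (fun w => `|G w|)) => //.
    move=> s u; rewrite /F !normrM (ger0_norm (gexp0 _ _)) ler_wpM2r//.
    by rewrite ler_piMl// cosabs.
  exact: intg_gauss1.
have := @Rfubini _ _ (measurableTypeR R) V R mu L F mF Foo.
have -> : \int[mu]_s \int[L]_u F s u = \int[mu]_tau (expR (- (t * tau ^+ 2)) * wave 0 tau).
  apply: eq_Rintegral => tau _; rewrite /wave -RintegralZl//.
  by apply: eq_Rintegral => w _; rewrite /F; ring.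
move=> ->; rewrite /avg -RintegralZl//; last first.
  apply: (intg_le measurableT _ _ (intgZl measurableT (line_heat t 0) iabs)).
  - apply: measurable_funM => //; apply: measurable_line_heat => //.
    by apply: measurable_funB => //; exact: measurable_fst.
  - move=> w _; rewrite normrM (ger0_norm (line_heat_ge0 _ _)) ler_wpM2r//.
    rewrite /line_heat ler_wpM2l ?expR_ge0// ler_expR lerN2 expr0n mul0r.
    by rewrite divr_ge0 ?sqr_ge0// mulr_ge0// ltW.
apply: eq_Rintegral => w _; rewrite mulrA -gaussian_fourier//.
rewrite /F RintegralZr//; last first.
  apply: (intg_le measurableT _ _ (intg_gauss1 t0)).
    apply: measurable_funM; last exact: (intg_meas (intg_gauss1 t0)).
    exact: (mc 0 (f := fun=> w)).
  by move=> s _; rewrite normrM (ger0_norm (gexp0 _ _)) ler_piMl// cosabs.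
by congr (_ * _); apply: eq_Rintegral => s _; rewrite addr0.
Qed.

Definition cauchy_mass : R := \int[mu]_(tau in setT) (1 + tau ^+ 2)^-1.

Lemma intg_oneDsqrV : mu.-integrable setT (EFin \o (fun tau : R => (1 + tau ^+ 2)^-1)).
Proof.
have c : continuous (fun tau : R => (1 + tau ^+ 2)^-1) by exact: (@continuous_oneDsqrV R).
have p (tau : R) : 0 <= (1 + tau ^+ 2)^-1 by rewrite invr_ge0 addr_ge0// sqr_ge0.
apply/integrableP; split; first by apply/measurable_EFinP; exact: continuous_measurable_fun.
under eq_integral do rewrite /= ger0_norm//.
rewrite ge0_symfun_integralT//; last by move=> x /=; rewrite sqrrN.
have -> : [set x : R | 0 <= x] = `[0, +oo[%classic.
  by apply/seteqP; split => x /=; rewrite in_itv/= andbT.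
by rewrite (@integral0y_oneDsqr R) -EFinM ltry.
Qed.

Variable B : R.
Hypothesis B0 : 0 <= B.
Hypothesis waveB : forall phi tau, `|wave phi tau| <= B * (1 + tau ^+ 2)^-1.

Lemma intg_wave phi : mu.-integrable setT (EFin \o wave phi).
Proof.
apply: (intg_le measurableT _ _ (intgZl measurableT B intg_oneDsqrV)); first exact: measurable_wave.
by move=> tau _; exact: waveB.
Qed.

(** The size of [line_heat] alone only gives [t^(-1/2)]. On the frequency side, reached by
    [wave_gauss], the Gaussian is at most 1 and [wave] is integrable in [tau], so the bound is
    uniform in [t]. *)
Lemma avg_le t : 0 < t -> `|avg t| <= B * cauchy_mass.
Proof.
move=> t0.
have pi1 : 1 <= 2 * pi :> R by have := @pi_ge2 R; lra.
have -> : avg t = (2 * pi)^-1 * \int[mu]_tau (expR (- (t * tau ^+ 2)) * wave 0 tau).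
  by rewrite wave_gauss// mulrA mulVf ?mul1r// gt_eqF// (lt_le_trans ltr01).
have iF : mu.-integrable setT (EFin \o (fun tau => expR (- (t * tau ^+ 2)) * wave 0 tau)).
  apply: (intg_le measurableT _ _ (intg_abs (intg_wave 0))).
    apply: measurable_funM; last exact: measurable_wave.
    exact: (intg_meas (intg_gauss1 t0)).
  move=> tau _; rewrite normrM (ger0_norm (gexp0 _ _)) ler_piMl//.
  by rewrite expR_le1 oppr_le0 mulr_ge0 ?sqr_ge0// ltW.
rewrite normrM ger0_norm ?invr_ge0 ?(le_trans ler01)// ler_pdivrMl ?(lt_le_trans ltr01)//.
apply: (@le_trans _ _ (B * cauchy_mass)); last first.
  rewrite ler_peMl// mulr_ge0// /cauchy_mass; apply: Rintegral_ge0 => tau _.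
  by rewrite invr_ge0 addr_ge0// sqr_ge0.
apply: (le_trans (le_normr_Rintegral _ iF)) => //.
rewrite /cauchy_mass -RintegralZl//; last exact: intg_oneDsqrV.
apply: le_Rintegral => //; [exact: (intg_abs iF)|apply: intgZl => //; exact: intg_oneDsqrV|].
move=> tau _; rewrite (le_trans _ (waveB 0 tau))// normrM (ger0_norm (gexp0 _ _)) ler_piMl//.
by rewrite expR_le1 oppr_le0 mulr_ge0 ?sqr_ge0// ltW.
Qed.

Variables (alpha lam : R).
Hypothesis alpha0 : 0 < alpha.
Hypothesis lam1 : 1 <= lam.

Let lamt (tau : R) : 1 <= tau ^+ 2 + lam.
Proof. by rewrite (le_trans lam1)// lerDr sqr_ge0. Qed.

Let lam0 (tau : R) : 0 < tau ^+ 2 + lam.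
Proof. exact: lt_le_trans (lamt tau). Qed.

Lemma measurable_powN : measurable_fun setT (fun tau : R => (tau ^+ 2 + lam) `^ (- alpha)).
Proof.
apply: (measurableT_comp (measurable_powR _)); exact: measurable_funD.
Qed.

Lemma intg_pow_wave phi :
  mu.-integrable setT (EFin \o (fun tau => (tau ^+ 2 + lam) `^ (- alpha) * wave phi tau)).
Proof.
apply: (intg_le measurableT _ _ (intg_abs (intg_wave phi))).
  by apply: measurable_funM; [exact: measurable_powN|exact: measurable_wave].
move=> tau _; rewrite normrM ger0_norm ?powR_ge0// ler_piMl// powRN.
rewrite invf_le1 ?powR_gt0//.
by rewrite -{1}(powRr0 (tau ^+ 2 + lam)) ler_powR// ltW.
Qed.

(** The phase turns the cosine into a sine, so the wave is odd in [tau] while the power is even. *)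
Lemma integral_pow_wave_sin :
  \int[mu]_tau ((tau ^+ 2 + lam) `^ (- alpha) * wave (- (pi / 2)) tau) = 0.
Proof.
apply: Rintegral_odd; first by apply: measurable_funM; [exact: measurable_powN|exact: measurable_wave].
move=> tau; rewrite sqrrN.
suff -> : wave (- (pi / 2)) (- tau) = - wave (- (pi / 2)) tau by rewrite mulrN.
rewrite -[RHS]mulN1r /wave -RintegralZl//; apply: eq_Rintegral => w _.
have E x : cos (x - pi / 2) = sin x :> R.
  by rewrite cosB cos_pihalf sin_pihalf mulr0 mulr1 add0r.
by rewrite !E mulrN sinN mulNr mulN1r.
Qed.

Lemma intg_powpos_expR c : 0 < c -> mu.-integrable setT (EFin \o (fun t => powpos alpha t * expR (- (c * t)))).
Proof.
move=> c0; apply/integrableP; split.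
  apply/measurable_EFinP; apply: measurable_funM; first exact: measurable_powpos.
  by apply: measurableT_comp => //; apply: measurableT_comp => //; exact: measurable_funM.
under eq_integral do rewrite /= ger0_norm ?mulr_ge0 ?powpos_ge0 ?expR_ge0//.
by rewrite integral_powpos_expR// ltry.
Qed.

Lemma intg_powpos_avg : mu.-integrable setT (EFin \o (fun t => powpos alpha t * expR (- (lam * t)) * avg t)).
Proof.
have l0 : 0 < lam by exact: lt_le_trans lam1.
apply: (intg_le measurableT _ _ (intgZr measurableT (B * cauchy_mass) (intg_powpos_expR l0))).
  apply: measurable_funM; last exact: measurable_avg. exact: (intg_meas (intg_powpos_expR l0)).
move=> t _; rewrite normrM (ger0_norm (_ : 0 <= powpos _ _ * _)); last first.
  by rewrite mulr_ge0 ?powpos_ge0 ?expR_ge0.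
rewrite /powpos; have [t0|t0] := ltP 0 t; last by rewrite !mul0r.
by rewrite ler_wpM2l ?mulr_ge0 ?powR_ge0 ?expR_ge0// avg_le.
Qed.

Lemma integral_pow_wave :
  \int[mu]_tau ((tau ^+ 2 + lam) `^ (- alpha) * wave 0 tau) =
  2 * pi / Gamma alpha * \int[mu]_t (powpos alpha t * expR (- (lam * t)) * avg t).
Proof.
have G0 := Gamma_gt0 alpha0; have l0 : 0 < lam by exact: lt_le_trans lam1.
pose F (tau t : measurableTypeR R) : R := powpos alpha t * expR (- ((tau ^+ 2 + lam) * t)) * wave 0 tau.
have mF : measurable_fun setT (fun z => F z.1 z.2).
  apply: measurable_funM; last exact: (measurableT_comp (measurable_wave 0)).
  apply: measurable_funM; first exact: (measurableT_comp (measurable_powpos _)).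
  apply: (measurableT_comp (@measurable_expR R)).
  apply: (measurableT_comp (@oppr_measurable R setT)); apply: measurable_funM => //.
  by apply: measurable_funD => //; exact: measurable_funX.
have Foo : (\int[mu]_s \int[mu]_u `|F s u|%:E < +oo)%E.
  (* Discarding [tau^2] in the exponent decouples the variables: integrability in [tau] comes from
     [waveB], that in [t] from [exp(- lam t)]. *)
  apply: (@fubini_dom _ _ (measurableTypeR R) (measurableTypeR R) R mu mu F
    (fun tau => B * (1 + tau ^+ 2)^-1) (fun t => powpos alpha t * expR (- (lam * t)))) => //.
  - move=> tau t; rewrite /F normrM mulrC (ger0_norm (_ : 0 <= powpos _ _ * _)); last first.
      by rewrite mulr_ge0 ?powpos_ge0 ?expR_ge0.
    apply: ler_pM => //; first by rewrite mulr_ge0 ?powpos_ge0 ?expR_ge0.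
    rewrite /powpos; have [t0|t0] := ltP 0 t; last by rewrite !mul0r.
    by rewrite ler_wpM2l ?powR_ge0// ler_expR lerN2 ler_wpM2r ?(ltW t0)// lerDr sqr_ge0.
  - by move=> tau; rewrite mulr_ge0// invr_ge0 addr_ge0// sqr_ge0.
  - by move=> t; rewrite mulr_ge0 ?powpos_ge0 ?expR_ge0.
  - by apply: intgZl => //; exact: intg_oneDsqrV.
  - exact: intg_powpos_expR.
have := @Rfubini _ _ (measurableTypeR R) (measurableTypeR R) R mu mu F mF Foo.
have -> : \int[mu]_s \int[mu]_u F s u =
    Gamma alpha * \int[mu]_tau ((tau ^+ 2 + lam) `^ (- alpha) * wave 0 tau).
  rewrite -RintegralZl//; last exact: intg_pow_wave.
  apply: eq_Rintegral => tau _; rewrite /F RintegralZr//; last exact: intg_powpos_expR.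
  by rewrite {1}/Rintegral integral_powpos_expR//=; ring.
have -> : \int[mu]_u \int[mu]_s F s u =
    \int[mu]_t (2 * pi * (powpos alpha t * expR (- (lam * t)) * avg t)).
  apply: eq_Rintegral => t _; have [t0|t0] := ltP 0 t; last first.
    rewrite /F /powpos ltNge t0 /= !mul0r mulr0; under eq_Rintegral do rewrite !mul0r.
    by rewrite /Rintegral integral0.
  have -> : 2 * pi * (powpos alpha t * expR (- (lam * t)) * avg t) =
    powpos alpha t * expR (- (lam * t)) * (2 * pi * avg t) by ring.
  rewrite -wave_gauss// -RintegralZl//; last first.
    apply: (intg_le measurableT _ _ (intg_abs (intg_wave 0))).
      apply: measurable_funM; last exact: measurable_wave.
      exact: (intg_meas (intg_gauss1 t0)).
    move=> tau _; rewrite normrM (ger0_norm (gexp0 _ _)) ler_piMl//.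
    by rewrite expR_le1 oppr_le0 mulr_ge0 ?sqr_ge0// ltW.
  apply: eq_Rintegral => tau _; rewrite /F mulrDl opprD expRD (mulrC t).
  ring.
move=> h; have -> : \int[mu]_tau ((tau ^+ 2 + lam) `^ (- alpha) * wave 0 tau) =
    (Gamma alpha)^-1 * \int[mu]_t (2 * pi * (powpos alpha t * expR (- (lam * t)) * avg t)).
  by rewrite -h mulrA mulVf ?mul1r// gt_eqF.
rewrite RintegralZl//; [by ring|exact: intg_powpos_avg].
Qed.

End mode.

(** * Decay of the modes of a test function *)

Section product_derivatives.
Context {R : realType} {d : nat}.
Local Notation V := (R * 'rV[R]_d)%type.
Implicit Types (z v : V) (f : R -> R) (h : 'rV[R]_d -> R).

Lemma is_derive_snd h z v (df : R) : is_derive z.2 v.2 h df -> is_derive z v (fun z => h z.2) df.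
Proof. by move=> H; apply/is_derive_line0; apply/(is_derive_line0 h z.2 v.2). Qed.

Lemma is_derive_fst f z v (df : R) : is_derive z.1 v.1 f df -> is_derive z v (fun z => f z.1) df.
Proof. by move=> H; apply/is_derive_line0; apply/(is_derive_line0 f z.1 v.1). Qed.

Lemma is_derive_dir0 (U : normedModType R) (g : U -> R) x : is_derive x 0 g 0.
Proof.
apply/is_derive_line0; rewrite (_ : (fun s => _) = (fun=> g x)); first exact: is_derive_cst.
by apply/funext => s; rewrite scaler0 add0r.
Qed.

Lemma continuous_snd_comp h : continuous h -> continuous (fun z : V => h z.2).
Proof.
by move=> ch z; apply: (@continuous_comp _ _ _ (@snd R 'rV[R]_d) h); [exact: cvg_snd|exact: ch].
Qed.

Lemma continuous_fst_comp f : continuous f -> continuous (fun z : V => f z.1).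
Proof.
by move=> ch z; apply: (@continuous_comp _ _ _ (@fst R 'rV[R]_d) f); [exact: cvg_fst|exact: ch].
Qed.

Lemma smoothR_sqnorm_snd : smoothR (fun z : V => sqnorm z.2).
Proof.
have sc (i : 'I_d) : smoothR (fun z : V => z.2 ord0 i).
  apply: smoothR_linear; last by move=> t x v; rewrite !mxE.
  by apply: (@continuous_snd_comp (fun x => x ord0 i)); exact: coord_continuous.
by apply: smoothR_sum => i _; apply: smoothR_mul.
Qed.

End product_derivatives.

Section decay.
Context {R : realType} {d : nat}.
Local Notation V := (R * 'rV[R]_d)%type.
Local Notation L := (@lebesgue_RxRd R d).
Implicit Types (g : V -> R) (z v w : V).

Definition test_fun g := smoothR g /\ exists M : R, forall z, M < `|z| -> g z = 0.

Lemma test_fun_derive g v : test_fun g -> test_fun (fun z => 'D_v g z).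
Proof.
move=> [sg [M gM]]; split; first exact: smoothR_derive.
by exists M => z Mz; apply: (is_derive_out gM Mz); exact: smoothR_is_derive.
Qed.

Lemma test_fun_mul f g : smoothR f -> test_fun g -> test_fun (fun z => f z * g z).
Proof.
by move=> sf [sg [M gM]]; split; [exact: smoothR_mul|exists M => z /gM ->; rewrite mulr0].
Qed.

Lemma test_fun_sub f g : test_fun f -> test_fun g -> test_fun (fun z => f z - g z).
Proof.
move=> [sf [M fM]] [sg [N gN]]; split; first exact: smoothR_sub.
exists (Num.max M N) => z; rewrite gt_max => /andP[Mz Nz].
by rewrite fM// gN// subrr.
Qed.

Lemma test_fun_add f g : test_fun f -> test_fun g -> test_fun (fun z => f z + g z).
Proof.
move=> [sf [M fM]] [sg [N gN]]; split; first exact: smoothR_add.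
exists (Num.max M N) => z; rewrite gt_max => /andP[Mz Nz].
by rewrite fM// gN// addr0.
Qed.

Lemma tst0 : test_fun (fun=> 0).
Proof. by split; [exact: smoothR_cst|exists 0]. Qed.

Lemma test_fun_sum I (s : seq I) (F : I -> V -> R) : (forall i, test_fun (F i)) ->
  test_fun (fun z => \sum_(i <- s) F i z).
Proof.
move=> tF; elim: s => [|i s IH]; first by under eq_fun do rewrite big_nil; exact: tst0.
by under eq_fun do rewrite big_cons; exact: test_fun_add.
Qed.

Lemma test_fun_intg g : test_fun g -> L.-integrable setT (EFin \o g).
Proof. by move=> [sg [M gM]]; exact: (cs_integrable_RxRd (smoothR_cont sg) gM). Qed.

Definition erho : V := (1, 0).
Definition ey (i : 'I_d) : V := (0, delta_mx ord0 i).
(** Green's identity moves this operator and [osc_y] between the test function and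
    [cos((rho - rho') tau + phi) Pk(x, x')]. There they act as the scalars [1 + tau^2] and
    [2 k + d]. *)
Definition one_sub_d2rho g z : R := g z - 'D_erho (fun w => 'D_erho g w) z.
Definition osc_y g z : R := sqnorm z.2 * g z - \sum_(i < d) 'D_(ey i) (fun w => 'D_(ey i) g w) z.

Lemma test_fun_one_sub_d2rho g : test_fun g -> test_fun (one_sub_d2rho g).
Proof. by move=> tg; apply: test_fun_sub => //; do 2 apply: test_fun_derive. Qed.

Lemma test_fun_osc_y g : test_fun g -> test_fun (osc_y g).
Proof.
move=> tg; apply: test_fun_sub; first by apply: test_fun_mul => //; exact: smoothR_sqnorm_snd.
by apply: test_fun_sum => i; do 2 apply: test_fun_derive.
Qed.

Lemma eigR_Pk k (x : 'rV[R]_d) : eigR k (Pk k x).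
Proof.
rewrite /Pk; elim: (index_enum _) => [|mu s IH].
  by under [X in eigR _ X]eq_fun do rewrite big_nil; exact: eigR0.
under [X in eigR _ X]eq_fun do rewrite big_cons; case muk : (_ == k) => //.
apply: eigRD => //; apply: eigRZ; have := @eigR_hermf R d (mi mu).
by rewrite (_ : (\sum_i mi mu i)%N = k)//; exact/eqP.
Qed.

Variables (rho : R) (x : 'rV[R]_d) (k : nat) (phi tau : R).
Let P := Pk k x.
Let C (r : R) := cos ((rho - r) * tau + phi).
Let S (r : R) := sin ((rho - r) * tau + phi).

Let smP : smoothR P. Proof. by have [] := eigR_Pk k x. Qed.

Let dlin r : is_derive r (1 : R) (fun r => (rho - r) * tau + phi) (- tau).
Proof.
have h := is_derive_add (is_derive_mul (is_derive_sub (is_derive_cst rho r (1:R)) (is_derive_id r (1:R)))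
  (is_derive_cst tau r (1:R))) (is_derive_cst phi r (1:R)).
by apply: (is_derive_eq h); rewrite /cst/=; ring.
Qed.

Let dC r : is_derive r (1 : R) C (tau * S r).
Proof. by apply: (is_derive_eq (is_derive_chain (is_derive_cos _) (dlin r))); rewrite /S; ring. Qed.

Let dS r : is_derive r (1 : R) S (- tau * C r).
Proof. by apply: (is_derive_eq (is_derive_chain (is_derive_sin _) (dlin r))); rewrite /C; ring. Qed.

Let cts (f f' : R -> R) : (forall x, is_derive x (1 : R) f (f' x)) -> continuous f.
Proof.
move=> df r; apply: differentiable_continuous; apply/derivable1_diffP.
exact: (@ex_derive _ _ _ _ _ _ _ (df r)).
Qed.

Let cC_ : continuous (fun z : V => C z.1).
Proof. exact: continuous_fst_comp (cts dC). Qed.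
Let cS_ : continuous (fun z : V => S z.1).
Proof. exact: continuous_fst_comp (cts dS). Qed.

Let p z := C z.1 * P z.2.

Let cp (h : 'rV[R]_d -> R) : smoothR h -> continuous (fun z : V => C z.1 * h z.2).
Proof. by move=> sh; apply: continuousR_mul => //; apply: continuous_snd_comp; exact: smoothR_cont. Qed.

Lemma wave_testE g : wave rho (fun w => P w.2 * g w) phi tau = \int[L]_w (p w * g w).
Proof. by apply: eq_Rintegral => w _; rewrite /p /C mulrA. Qed.

Let ipg g (h : 'rV[R]_d -> R) : test_fun g -> smoothR h -> L.-integrable setT (EFin \o (fun w => C w.1 * h w.2 * g w)).
Proof.
move=> [sg [M gM]] sh; apply: (@cs_integrable_RxRd R d (fun w => C w.1 * h w.2 * g w) M).
  by apply: continuousR_mul; [exact: cp|exact: smoothR_cont].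
by move=> z /gM ->; rewrite mulr0.
Qed.

Lemma integral_one_sub_d2rho g : test_fun g -> \int[L]_w (p w * one_sub_d2rho g w) = (1 + tau ^+ 2) * \int[L]_w (p w * g w).
Proof.
move=> tg; have [sg [M gM]] := tg.
have dr1 z : is_derive z erho p (tau * S z.1 * P z.2).
  apply: (is_derive_eq (is_derive_mul (@is_derive_fst _ _ C z erho _ (dC _)) (@is_derive_snd _ _ P z erho _ (is_derive_dir0 _ _)))).
  by ring.
have dr2 z : is_derive z erho (fun z => tau * S z.1 * P z.2) (- tau ^+ 2 * p z).
  have h := is_derive_mul (is_derive_cstmul tau (@is_derive_fst _ _ S z erho _ (dS _))) (@is_derive_snd _ _ P z erho _ (is_derive_dir0 _ _)).
  by apply: (is_derive_eq h); rewrite /p; ring.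
have G := @green_RxRd R d g (fun z => 'D_erho g z) (fun z => 'D_erho (fun w => 'D_erho g w) z)
  p (fun z => tau * S z.1 * P z.2) (fun z => - tau ^+ 2 * p z) erho M.
have {}G := G (fun z => smoothR_is_derive _ _ sg) (fun z => smoothR_is_derive _ _ (smoothR_derive _ sg)) dr1 dr2
  (smoothR_cont sg) (smoothR_cont (smoothR_derive _ sg)) (smoothR_cont (smoothR_derive _ (smoothR_derive _ sg))) (cp smP).
have c1 : continuous (fun z : V => tau * S z.1 * P z.2).
  by apply: continuousR_mul; [apply: continuousR_mul => //; exact: continuousR_cst|apply: continuous_snd_comp; exact: smoothR_cont].
have c2 : continuous (fun z : V => - tau ^+ 2 * p z) by apply: continuousR_mul; [exact: continuousR_cst|exact: cp].
have {}G := G c1 c2 gM; rewrite /= in G.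
have E : \int[L]_w (p w * one_sub_d2rho g w) = \int[L]_w (p w * g w) - \int[L]_w (p w * 'D_erho (fun w => 'D_erho g w) w).
  rewrite -RintegralB//.
  - by apply: eq_Rintegral => w _; rewrite /one_sub_d2rho mulrBr.
  - exact: ipg.
  - by apply: ipg => //; do 2 apply: test_fun_derive.
rewrite E G; have -> : \int[L]_w (g w * (- tau ^+ 2 * p w)) = - tau ^+ 2 * \int[L]_w (p w * g w).
  by rewrite -RintegralZl//; [apply: eq_Rintegral => w _; ring|exact: ipg].
ring.
Qed.

Lemma integral_osc_y g : test_fun g -> \int[L]_w (p w * osc_y g w) = (2 * k + d)%:R * \int[L]_w (p w * g w).
Proof.
move=> tg; have [sg [M gM]] := tg; have [_ _ oP] := eigR_Pk k x.
pose Pi i y : R := 'D_(delta_mx ord0 i) P y.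
pose Pii i y : R := 'D_(delta_mx ord0 i) (fun y => 'D_(delta_mx ord0 i) P y) y.
have sPi i : smoothR (Pi i) by exact: smoothR_derive.
have sPii i : smoothR (Pii i) by apply: smoothR_derive; exact: (sPi i).
have dC0 i z : is_derive z (ey i) (fun z => C z.1) 0.
  by apply: is_derive_fst; exact: is_derive_dir0.
have dh h i z : smoothR h -> is_derive z (ey i) (fun z => C z.1 * h z.2) (C z.1 * 'D_(delta_mx ord0 i) h z.2).
  move=> sh; have hh := is_derive_mul (dC0 i z) (@is_derive_snd _ _ h z (ey i) _ (smoothR_is_derive _ _ sh)).
  by apply: (is_derive_eq hh); ring.
have G i : \int[L]_w (p w * 'D_(ey i) (fun w => 'D_(ey i) g w) w) = \int[L]_w (g w * (C w.1 * Pii i w.2)).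
  exact: (@green_RxRd R d g (fun z => 'D_(ey i) g z) (fun z => 'D_(ey i) (fun w => 'D_(ey i) g w) z)
    p (fun z => C z.1 * Pi i z.2) (fun z => C z.1 * Pii i z.2) (ey i) M
    (fun z => smoothR_is_derive _ _ sg) (fun z => smoothR_is_derive _ _ (smoothR_derive _ sg)) (fun z => dh P i z smP) (fun z => dh (Pi i) i z (sPi i))
    (smoothR_cont sg) (smoothR_cont (smoothR_derive _ sg)) (smoothR_cont (smoothR_derive _ (smoothR_derive _ sg))) (cp smP) (cp (sPi i)) (cp (sPii i)) gM).
have tgi i : test_fun (fun w => 'D_(ey i) (fun w => 'D_(ey i) g w) w) by do 2 apply: test_fun_derive.
have tsq : test_fun (fun w => sqnorm w.2 * g w) by apply: test_fun_mul => //; exact: smoothR_sqnorm_snd.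
have E : \int[L]_w (p w * osc_y g w) = \int[L]_w (p w * (sqnorm w.2 * g w)) -
    \sum_(i < d) \int[L]_w (p w * 'D_(ey i) (fun w => 'D_(ey i) g w) w).
  rewrite -Rintegral_sum//; last by move=> i _; exact: ipg.
  rewrite -RintegralB//; [|exact: ipg|by apply: intg_sum => // i _; exact: ipg].
  by apply: eq_Rintegral => w _; rewrite /osc_y mulrBr mulr_sumr.
rewrite E (eq_bigr _ (fun i _ => G i)).
have ii i : L.-integrable setT (EFin \o (fun w => g w * (C w.1 * Pii i w.2))).
  by under [X in EFin \o X]eq_fun do rewrite mulrC; exact: ipg.
rewrite -Rintegral_sum// -RintegralB//; [|exact: ipg|exact: intg_sum].
rewrite -RintegralZl//; last exact: ipg.
apply: eq_Rintegral => w _; have := oP w.2; rewrite /osc_re /laplacian -/P => o.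
rewrite /p; transitivity (C w.1 * g w * (- \sum_(i < d) Pii i w.2 + sqnorm w.2 * P w.2)).
  have -> : \sum_(i < d) g w * (C w.1 * Pii i w.2) = C w.1 * g w * \sum_(i < d) Pii i w.2.
    by rewrite mulr_sumr; apply: eq_bigr => i _; ring.
  ring.
by rewrite /Pii o; ring.
Qed.

Lemma wave_decay g N : test_fun g ->
  (1 + tau ^+ 2) * (2 * k + d)%:R ^+ N * wave rho (fun w => P w.2 * g w) phi tau =
  wave rho (fun w => P w.2 * one_sub_d2rho (iter N osc_y g) w) phi tau.
Proof.
move=> tg; rewrite !wave_testE.
have [tN ->] : test_fun (iter N osc_y g) /\ \int[L]_w (p w * one_sub_d2rho (iter N osc_y g) w) =
    (1 + tau ^+ 2) * \int[L]_w (p w * iter N osc_y g w).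
  have tN : test_fun (iter N osc_y g) by elim: N => [//|N IH]; exact: test_fun_osc_y.
  by split => //; exact: integral_one_sub_d2rho.
rewrite -mulrA; congr (_ * _) => {tN}.
have : test_fun (iter N osc_y g) /\ (2 * k + d)%:R ^+ N * \int[L]_w (p w * g w) = \int[L]_w (p w * iter N osc_y g w).
  elim: N => [|N [tN IH]]; first by rewrite expr0 mul1r.
  by split; [exact: test_fun_osc_y|rewrite /= integral_osc_y// -IH exprS mulrA].
by case.
Qed.

End decay.

Lemma wave_bound (R : realType) (d : nat) (g : R * 'rV[R]_d -> R) : (1 <= d)%N -> test_fun g ->
  exists2 C : R, 0 <= C & forall rho x k phi tau,
    `|wave rho (fun w => Pk k x w.2 * g w) phi tau| <= C * (k.+2%:R ^+ 2)^-1 * (1 + tau ^+ 2)^-1.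
Proof.
move=> d1 tg; have [C C0 hC] := @Pk_growth R d.
(* [Pk] grows like [(k+2)^d], so [d+2] powers of the eigenvalue leave the summable factor
   [1/(k+2)^2]. The constant [2^(d+2)] comes from [k + 2 <= 2 (2 k + d)]. *)
pose gN := one_sub_d2rho (iter d.+2 osc_y g).
have tN : test_fun gN.
  by apply: test_fun_one_sub_d2rho; elim: (d.+2) => [//|N IH]; exact: test_fun_osc_y.
pose I := \int[lebesgue_RxRd d]_w `|gN w|.
have I0 : 0 <= I by apply: Rintegral_ge0.
exists (2 ^+ d.+2 * (C * I)); first by rewrite mulr_ge0 ?exprn_ge0// mulr_ge0// ltW.
move=> rho x k phi tau.
have iN := test_fun_intg tN.
have iPN : (lebesgue_RxRd d).-integrable setT (EFin \o (fun w => Pk k x w.2 * gN w)).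
  have [sN [M NM]] := tN; have [sP _ _] := eigR_Pk k x.
  apply: (@cs_integrable_RxRd R d (fun w => Pk k x w.2 * gN w) M); last by move=> z /NM ->; rewrite mulr0.
  by apply: continuousR_mul; [apply: continuous_snd_comp; exact: smoothR_cont|exact: smoothR_cont].
have l0 : 0 < (2 * k + d)%:R :> R by rewrite ltr0n addn_gt0 d1 orbT.
have t0 : 0 < 1 + tau ^+ 2 by rewrite ltr_pwDl// sqr_ge0.
have h1 : `|wave rho (fun w => Pk k x w.2 * gN w) phi tau| <= C * k.+2%:R ^+ d * I.
  apply: (le_trans (wave_le rho iPN phi tau)).
  rewrite /I -RintegralZl//; last exact: intg_abs.
  apply: le_Rintegral => //; [exact: (intg_abs iPN)|by apply: intgZl => //; exact: intg_abs|].
  by move=> w _; rewrite normrM ler_wpM2r.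
have h2 := wave_decay rho x k phi tau d.+2 tg.
have e0 : 0 < (1 + tau ^+ 2) * (2 * k + d)%:R ^+ d.+2 by rewrite mulr_gt0// exprn_gt0.
have -> : wave rho (fun w => Pk k x w.2 * g w) phi tau =
    ((1 + tau ^+ 2) * (2 * k + d)%:R ^+ d.+2)^-1 * wave rho (fun w => Pk k x w.2 * gN w) phi tau.
  by rewrite -h2 mulrA mulVf ?mul1r// gt_eqF.
rewrite normrM ger0_norm ?invr_ge0 ?(ltW e0)//.
apply: (le_trans (ler_wpM2l _ h1)); first by rewrite invr_ge0 ltW.
have h3 : k.+2%:R ^+ d.+2 <= 2 ^+ d.+2 * (2 * k + d)%:R ^+ d.+2 :> R.
  have kd : (k.+2 <= 2 * (2 * k + d))%N.
    by rewrite mulnDr -addn2 leq_add// ?mulnA ?leq_pmull ?leq_pmulr.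
  by rewrite -exprMn -natrM lerXn2r ?nnegrE ?ler_nat// ler0n.
move: ((2 * k + d)%:R ^+ d.+2) (exprn_gt0 d.+2 l0) h3 => l l1 h3.
have h4 : k.+2%:R ^+ d / l <= 2 ^+ d.+2 / k.+2%:R ^+ 2 :> R.
  by rewrite ler_pdivrMr// mulrAC ler_pdivlMr ?exprn_gt0// -exprD addn2.
move: (2 ^+ d.+2) (k.+2%:R ^+ d) (k.+2%:R ^+ 2) (1 + tau ^+ 2) t0 h4 => W K K2 T T0 h4.
rewrite (_ : (T * l)^-1 * (C * K * I) = (K / l) * (C * I / T)); last first.
  by field; rewrite !gt_eqF.
rewrite (_ : W * (C * I) * K2^-1 * T^-1 = (W / K2) * (C * I / T)); last by ring.
by rewrite ler_wpM2r// divr_ge0 ?(ltW T0)// mulr_ge0// ltW.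
Qed.

(** * Summation over the modes *)

(* No integrability is required: if [f] has infinite integral, both sides are [0] because
   [fine +oo = 0]. *)
Lemma RintegralZr_ge0 d1 (T : measurableType d1) (R : realType) (m : {measure set T -> \bar R})
    (f : T -> R) (c : R) : measurable_fun setT f -> (forall x, 0 <= f x) ->
  \int[m]_x (f x * c) = (\int[m]_x f x) * c.
Proof.
move=> mf f0.
have [/integrableP i|ni] := pselect (m.-integrable setT (EFin \o f)).
  by rewrite RintegralZr//; apply/integrableP.
have foo : (\int[m]_x (f x)%:E = +oo)%E.
  apply/eqP; rewrite -leye_eq leNgt; apply/negP => h; apply: ni; apply/integrableP; split.
    exact/measurable_EFinP.
  by under eq_integral do rewrite /= ger0_norm//.
have pos (a : R) : 0 < a -> (\int[m]_x (f x * a)%:E = +oo)%E.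
  move=> a0; under eq_integral do rewrite mulrC EFinM.
  by rewrite ge0_integralZl_EFin ?(ltW a0) ?foo ?gt0_muley ?lte_fin//;
    first [exact/measurable_EFinP | move=> x _; rewrite lee_fin].
rewrite {2}/Rintegral foo /= mul0r /Rintegral.
have [c0|c0|->] := ltgtP c 0.
- have -> : (\int[m]_x (f x * c)%:E = \int[m]_x - (f x * - c)%:E)%E.
    by apply: eq_integral => x _; rewrite mulrN EFinN oppeK.
  rewrite integral_ge0N; last by move=> x _; rewrite lee_fin mulr_ge0// oppr_ge0 ltW.
  by rewrite pos ?oppr_gt0.
- by rewrite pos.
- by under eq_integral do rewrite mulr0; rewrite integral0.
Qed.

Section mode_series.
Context {R : realType} {d : nat}.
Hypothesis d1 : (1 <= d)%N.
Variables (alpha : R) (alpha0 : 0 < alpha) (g : R * 'rV[R]_d -> R) (tg : test_fun g).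
Variable z : R * 'rV[R]_d.
Local Notation mu := (@lebesgue_measure R).
Local Notation V := (measurableTypeR R * 'rV[R]_d)%type.
Local Notation L := (@lebesgue_RxRd R d).

Let G k (w : V) : R := Pk k z.2 w.2 * g w.

Let lamk k : R := (2 * k + d)%:R.

Let lam1 k : 1 <= lamk k.
Proof. by rewrite ler1n addn_gt0 d1 orbT. Qed.

Let cPk k : continuous (fun w : R * 'rV[R]_d => Pk k z.2 w.2).
Proof. by apply: continuous_snd_comp; have [sP _ _] := eigR_Pk k z.2; exact: smoothR_cont. Qed.

Lemma intg_mode k : L.-integrable setT (EFin \o G k).
Proof.
have [sg [M gM]] := tg.
apply: (@cs_integrable_RxRd R d (G k) M); last by move=> w /gM; rewrite /G => ->; rewrite mulr0.
by apply: continuousR_mul; [exact: cPk|exact: smoothR_cont].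
Qed.

Let iG := intg_mode.

Lemma test_bounded : exists2 M : R, 0 <= M & forall w, `|g w| <= M.
Proof.
have [sg [M gM]] := tg; have [C C0 hC] := @bounded_on_ball_RxRd R d g M (smoothR_cont sg).
exists C => // w; have [|/gM ->] := leP `|w| M; first exact: hC.
by rewrite normr0.
Qed.

Let mg : measurable_fun [set: V] g.
Proof. by case: tg => sg _; apply: continuous_measurable_RxRd; exact: smoothR_cont. Qed.

Let q t : R := expR (- (2 * t)).

Lemma heat_factor_le0 (t s u v : R) : 0 < t -> 0 <= u -> 0 <= v ->
  heat_factor (d := d) t s u v <= heat_factor (d := d) t 0 0 0.
Proof.
move=> t0 u0 v0; have /andP[q0 q1] := expRN2_01 t0.
have h1 : line_heat t s <= line_heat t 0.
  rewrite /line_heat ler_wpM2l ?expR_ge0// ler_expR lerN2 expr0n mul0r.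
  by rewrite divr_ge0 ?sqr_ge0// mulr_ge0// ltW.
rewrite /heat_factor; apply: ler_pM; [exact: line_heat_ge0| |exact: h1|].
  by rewrite mulr_ge0 ?expR_ge0// mulr_ge0 ?expR_ge0// ltW// mehler0_gt0.
rewrite ler_wpM2l ?expR_ge0// ler_wpM2l ?(ltW (mehler0_gt0 _))//.
rewrite ler_expR lerN2 !mulr0 addr0 mulr0 mulr_ge0// addr_ge0// mulr_ge0//.
  by rewrite divr_ge0 ?subr_ge0 ?addr_ge0// ltW.
by rewrite divr_ge0 ?subr_ge0 ?addr_ge0// ltW.
Qed.

Lemma measurable_heat_ext_snd t : measurable_fun [set: V] (fun w => heat_ext t z w).
Proof.
apply: measurable_heat_factor => //.
- by apply: measurable_funB => //; exact: measurable_fst.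
- apply: measurable_sqnorm => i; under eq_fun do rewrite !mxE.
  apply: measurable_funB => //; apply: (measurableT_comp (measurable_coord i)).
  exact: measurable_snd.
- apply: measurable_sqnorm => i; under eq_fun do rewrite !mxE.
  apply: measurable_funD => //; apply: (measurableT_comp (measurable_coord i)).
  exact: measurable_snd.
Qed.

(** Since [exp(- lamk k * t)] is [exp(- d t)] times [q t ^+ k], the sum is Mehler's series at
    [r = q t] integrated against [g]. A constant times [|g|] is a majorant; that constant depends on
    [t]. *)
Let avg_sum_cvg t : 0 < t ->
  \sum_(k < n) (expR (- (lamk k * t)) * avg z.1 (G k) t) @[n --> \oo] -->
  \int[L]_w (heat_ext t z w * g w).
Proof.
move=> t0; have q01' := expRN2_01 t0; have [q0 q1] := andP q01'.
have ig := test_fun_intg tg.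
pose F n (w : V) : R := line_heat t (z.1 - w.1) * (expR (- (d%:R * t)) *
  ((\sum_(k < n) Pk k z.2 w.2 * q t ^+ k) * g w)).
have mh : measurable_fun [set: V] (fun w => line_heat t (z.1 - w.1)).
  by apply: measurable_line_heat => //; apply: measurable_funB => //; exact: measurable_fst.
have h0 s : line_heat t s <= line_heat t 0.
  rewrite /line_heat ler_wpM2l ?expR_ge0// ler_expR lerN2 expr0n mul0r.
  by rewrite divr_ge0 ?sqr_ge0// mulr_ge0// ltW.
have mP n : measurable_fun [set: V] (fun w => \sum_(k < n) Pk k z.2 w.2 * q t ^+ k).
  apply: measurable_sum => k; apply: measurable_funM => //.
  by apply: continuous_measurable_RxRd; exact: cPk.
have E n : \sum_(k < n) (expR (- (lamk k * t)) * avg z.1 (G k) t) = \int[L]_w F n w.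
  have ik k : L.-integrable setT (EFin \o (fun w => line_heat t (z.1 - w.1) * G k w)).
    apply: (intg_le measurableT _ _ (intgZl measurableT (line_heat t 0) (intg_abs (iG k)))).
      by apply: measurable_funM => //; exact: (intg_meas (iG k)).
    by move=> w _; rewrite normrM (ger0_norm (line_heat_ge0 _ _)) ler_wpM2r.
  transitivity (\int[L]_w \sum_(k < n) (expR (- (lamk k * t)) * (line_heat t (z.1 - w.1) * G k w))).
    rewrite Rintegral_sum//; last by move=> k _; exact: intgZl.
    by apply: eq_bigr => k _; rewrite /avg RintegralZl.
  apply: eq_Rintegral => w _; rewrite /F mulr_suml !mulr_sumr; apply: eq_bigr => k _.
  have -> : expR (- (lamk k * t)) = expR (- (d%:R * t)) * q t ^+ k.
    by rewrite /q -expRM_natl -expRD; congr expR; rewrite /lamk natrD natrM; ring.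
  by rewrite /G; ring.
rewrite (_ : (fun n => _) = (fun n => \int[L]_w F n w)); last exact/funext.
have mF n : measurable_fun setT (F n).
  by apply: measurable_funM => //; apply: measurable_funM => //; exact: measurable_funM.
have cF w : F n w @[n --> \oo] --> heat_ext t z w * g w.
  rewrite /F (_ : heat_ext t z w * g w = line_heat t (z.1 - w.1) *
      (expR (- (d%:R * t)) * (mehler (q t) z.2 w.2 * g w))); last first.
    rewrite /heat_ext heat_factor_mehler//; move: (line_heat _ _) (expR _) (mehler _ _ _) => a b c; ring.
  apply: cvgMr; apply: cvgMr; apply: cvgMl.
  have := @mehler_cvg R d z.2 w.2 (q t) q01'.
  rewrite (_ : series _ = (fun n => \sum_(k < n) Pk k z.2 w.2 * q t ^+ k))//.
  by apply/funext => n; rewrite /series /= big_mkord.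
have mH : measurable_fun [set: V] (fun w => heat_ext t z w * g w).
  by apply: measurable_funM => //; exact: measurable_heat_ext_snd.
pose c := line_heat t 0 * (expR (- (d%:R * t)) * mehler0 (d := d) (q t)).
refine (proj2 (@dominated_cvg_Rintegral _ V R L F (fun w => heat_ext t z w * g w) (fun w => c * `|g w|) mF mH cF _ _)).
  by apply: intgZl => //; exact: intg_abs.
move=> n w; rewrite /F normrM (ger0_norm (line_heat_ge0 _ _)) normrM (ger0_norm (expR_ge0 _)) normrM.
rewrite (_ : c * `|g w| = line_heat t 0 * (expR (- (d%:R * t)) * (mehler0 (d := d) (q t) * `|g w|))); last first.
  by rewrite /c; move: (line_heat _ _) (expR _) (mehler0 _) => x y a; ring.
apply: ler_pM; [exact: line_heat_ge0|by rewrite mulr_ge0 ?expR_ge0|exact: h0|].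
rewrite ler_wpM2l ?expR_ge0// ler_wpM2r//.
apply: (le_trans (ler_norm_sum _ _ _)).
rewrite (eq_bigr (fun k : 'I_n => `|Pk k z.2 w.2| * q t ^+ k)); last first.
  by move=> k _; rewrite normrM [X in _ * X]ger0_norm// exprn_ge0.
apply: (le_trans (sum_Pk_le z.2 w.2 n q01')).
rewrite ler_piMr ?(ltW (mehler0_gt0 _))// expR_le1 oppr_le0 mulr_ge0 ?sqnorm_ge0//.
by rewrite divr_ge0// divr_ge0 ?subr_ge0 ?addr_ge0// ltW.
Qed.

(** Telescoping with [1/(k+2)^2 <= 1/(k+1) - 1/(k+2)]. *)
Let sum_inv_sqr n : \sum_(k < n) (k.+2%:R ^+ 2)^-1 <= 1 - n.+1%:R^-1 :> R.
Proof.
elim: n => [|n IH]; first by rewrite big_ord0 invr1 subrr.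
rewrite big_ord_recr /=; apply: (le_trans (lerD IH (lexx _))).
have n0 : 0 < n.+1%:R :> R by [].
have -> : n.+2%:R = n.+1%:R + 1 :> R by rewrite [in RHS]natr1.
move: (n.+1%:R) n0 => N N0; rewrite -lerBrDl.
have -> : 1 - (N + 1)^-1 - (1 - N^-1) = (N * (N + 1))^-1.
  by field; rewrite !gt_eqF// addr_gt0.
by rewrite lef_pV2 ?posrE ?exprn_gt0 ?mulr_gt0 ?addr_gt0//; nra.
Qed.

Lemma Kpar_fine w : fine (Kpar alpha z w) =
  (Gamma alpha)^-1 * \int[mu]_t (powpos alpha t * heat_ext t z w).
Proof.
have G0 := Gamma_gt0 alpha0.
rewrite KparE /Rintegral.
have : (0 <= \int[mu]_t (powpos alpha t * heat_ext t z w)%:E)%E.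
  by apply: integral_ge0 => t _; rewrite lee_fin mulr_ge0 ?powpos_ge0 ?heat_ext_ge0.
(* Where the integral diverges, [fine] makes both sides 0. *)
case: (\int[mu]_t _)%E => [r| |] //= _.
by rewrite gt0_muley ?lte_fin ?invr_gt0// mulr0.
Qed.

Let F (w : V) (t : measurableTypeR R) : R := powpos alpha t * heat_ext t z w * g w.

Let mF : measurable_fun setT (fun p : V * measurableTypeR R => F p.1 p.2).
Proof.
apply: measurable_funM; last exact: (measurableT_comp mg).
by apply/measurable_EFinP; apply: (measurable_heat_ext alpha (f := fun=> z)).
Qed.

(** [g] is bounded and the row integral of [Kpar] is finite, which justifies exchanging the
    integrals in [w] and [t] even though the kernel may be infinite at single points. *)
Let Foo : (\int[L]_w \int[mu]_t `|F w t|%:E < +oo)%E.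
Proof.
have [M M0 hM] := test_bounded; have G0 := Gamma_gt0 alpha0.
have mK := @measurable_Kpar R d alpha.
apply: (@le_lt_trans _ _ (\int[L]_w ((Gamma alpha * M)%:E * Kpar alpha z w))%E).
  apply: ge0_le_integral => //.
  - by move=> w _; apply: integral_ge0 => t _; rewrite lee_fin.
  - apply: (measurable_fun_fubini_tonelli_F (fun p : V * measurableTypeR R => `|F p.1 p.2|%:E)%E) => //.
    by apply/measurable_EFinP; exact: measurableT_comp.
  - by apply: emeasurable_funM => //; exact: (measurableT_comp mK (pair1_measurable z)).
  move=> w _; rewrite KparE muleA -EFinM mulrAC divff ?gt_eqF// mul1r.
  rewrite -ge0_integralZl_EFin//; last 2 first.
  - by move=> t _; rewrite lee_fin mulr_ge0 ?powpos_ge0 ?heat_ext_ge0.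
  - exact: measurable_powpos_heat_ext.
  apply: ge0_le_integral => //.
  - by apply/measurable_EFinP; apply: measurableT_comp => //; exact: (measurableT_comp mF (pair1_measurable w)).
  - by apply: emeasurable_funM => //; exact: measurable_powpos_heat_ext.
  move=> t _; rewrite -EFinM lee_fin /F normrM ger0_norm ?mulr_ge0 ?powpos_ge0 ?heat_ext_ge0//.
  by rewrite mulrC ler_wpM2r ?mulr_ge0 ?powpos_ge0 ?heat_ext_ge0.
rewrite ge0_integralZl_EFin ?mulr_ge0 ?(ltW G0)//; last 2 first.
- by move=> w _; exact: Kpar_ge0.
- exact: (measurableT_comp mK (pair1_measurable z)).
rewrite lte_mul_pinfty ?lee_fin ?mulr_ge0 ?(ltW G0)//.
by apply: (le_lt_trans (Kpar_row d1 alpha0 z)); rewrite ltry.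
Qed.

Lemma mode_series :
  \sum_(k < n) ((2 * pi)^-1 * \int[mu]_tau ((tau ^+ 2 + lamk k) `^ (- alpha) * wave z.1 (G k) 0 tau))
    @[n --> \oo] --> \int[L]_w (fine (Kpar alpha z w) * g w).
Proof.
have [B B0 hB] := wave_bound d1 tg.
have hBk k phi tau : `|wave z.1 (G k) phi tau| <= B * (k.+2%:R ^+ 2)^-1 * (1 + tau ^+ 2)^-1 by exact: hB.
have Bk0 k : 0 <= B * (k.+2%:R ^+ 2)^-1 by rewrite mulr_ge0// invr_ge0 exprn_ge0.
have I00 : 0 <= cauchy_mass (R := R).
  by apply: Rintegral_ge0 => tau _; rewrite invr_ge0 addr_ge0// sqr_ge0.
pose H n t := \sum_(k < n) (powpos alpha t * expR (- (lamk k * t)) * avg z.1 (G k) t).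
have mexp k : measurable_fun setT (fun t : R => expR (- (lamk k * t))).
  apply: (measurableT_comp (@measurable_expR R)).
  by apply: (measurableT_comp (@oppr_measurable R setT)); exact: measurable_funM.
have ik k : mu.-integrable setT (EFin \o (fun t => powpos alpha t * expR (- (lamk k * t)) * avg z.1 (G k) t)).
  exact: (intg_powpos_avg (iG k) (Bk0 k) (hBk k) alpha0 (lam1 k)).
have E n : \sum_(k < n) ((2 * pi)^-1 * \int[mu]_tau ((tau ^+ 2 + lamk k) `^ (- alpha) * wave z.1 (G k) 0 tau)) =
    (Gamma alpha)^-1 * \int[mu]_t H n t.
  rewrite /H Rintegral_sum// mulr_sumr; apply: eq_bigr => k _.
  rewrite (integral_pow_wave (iG k) (Bk0 k) (hBk k) alpha0 (lam1 k)).
  by rewrite mulrA [_^-1 * _]mulrA mulVf ?mul1r// mulf_neq0// gt_eqF// pi_gt0.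
rewrite (_ : (fun n => _) = (fun n => (Gamma alpha)^-1 * \int[mu]_t H n t)); last exact/funext.
have E2 t : \int[L]_w F w t = powpos alpha t * \int[L]_w (heat_ext t z w * g w).
  rewrite /F; have [t0|t0] := ltP 0 t; last first.
    rewrite /powpos ltNge t0 /= mul0r; under eq_Rintegral do rewrite !mul0r.
    by rewrite /Rintegral integral0.
  rewrite -RintegralZl//; first by apply: eq_Rintegral => w _; rewrite mulrA.
  apply: (intg_le measurableT _ _ (intgZl measurableT (heat_factor (d := d) t 0 0 0) (intg_abs (test_fun_intg tg)))).
    by apply: measurable_funM => //; exact: measurable_heat_ext_snd.
  move=> w _; rewrite normrM (ger0_norm (heat_ext_ge0 _ _ _)) ler_wpM2r//.
  by apply: heat_factor_le0 => //; exact: sqnorm_ge0.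
have -> : \int[L]_w (fine (Kpar alpha z w) * g w) =
    (Gamma alpha)^-1 * \int[mu]_t (powpos alpha t * \int[L]_w (heat_ext t z w * g w)).
  transitivity ((Gamma alpha)^-1 * \int[L]_w \int[mu]_t F w t).
    rewrite -RintegralZl//; last exact: (Rfubini_integrable1 mF Foo).
    apply: eq_Rintegral => w _; rewrite Kpar_fine -mulrA; congr (_ * _).
    rewrite /F RintegralZr_ge0//; last by move=> t; rewrite mulr_ge0 ?powpos_ge0 ?heat_ext_ge0.
    by apply/measurable_EFinP; exact: measurable_powpos_heat_ext.
  by rewrite (Rfubini mF Foo); congr (_ * _); apply: eq_Rintegral => t _.
apply: cvgMr.
(* The bound of [avg_le] does not depend on [t], the eigenvalues are at least 1, which gives
   [exp(- t)], and the factors [1/(k+2)^2] sum to at most 1. *)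
pose c t := B * cauchy_mass (R := R) * (powpos alpha t * expR (- t)).
refine (proj2 (@dominated_cvg_Rintegral _ (measurableTypeR R) R mu H
  (fun t => powpos alpha t * \int[L]_w (heat_ext t z w * g w)) c _ _ _ _ _)).
- by move=> n; apply: measurable_sum => k; exact: (intg_meas (ik k)).
- by have := intg_meas (Rfubini_integrable2 mF Foo); under eq_fun do rewrite E2.
- move=> t; rewrite /H; have [t0|t0] := ltP 0 t; last first.
    rewrite /powpos ltNge t0 /= mul0r (_ : (fun n => _) = (fun=> 0)); first exact: cvg_cst.
    by apply/funext => n; apply: big1 => k _; rewrite !mul0r.
  rewrite (_ : (fun n => _) = (fun n => powpos alpha t * \sum_(k < n) (expR (- (lamk k * t)) * avg z.1 (G k) t))); last first.
    by apply/funext => n; rewrite mulr_sumr; apply: eq_bigr => k _; rewrite mulrA.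
  by apply: cvgMr; exact: avg_sum_cvg.
- by apply: intgZl => //; exact: integrable_gamma.
- move=> n t; rewrite /c /H; have [t0|t0] := ltP 0 t; last first.
    rewrite /powpos ltNge t0 /= mul0r mulr0 big1 ?normr0// => k _.
    by rewrite !mul0r.
  apply: (le_trans (ler_norm_sum _ _ _)).
  apply: (@le_trans _ _ (\sum_(k < n) (B * cauchy_mass (R := R) * (powpos alpha t * expR (- t)) * (k.+2%:R ^+ 2)^-1))).
    apply: ler_sum => k _; rewrite normrM ger0_norm ?mulr_ge0 ?powpos_ge0 ?expR_ge0//.
    have h1 := avg_le (iG k) (Bk0 k) (hBk k) t0.
    have h2 : powpos alpha t * expR (- (lamk k * t)) <= powpos alpha t * expR (- t).
      by rewrite ler_wpM2l ?powpos_ge0// ler_expR lerN2 ler_peMl// ltW.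
    apply: (le_trans (ler_pM _ _ h2 h1)) => //; first by rewrite mulr_ge0 ?powpos_ge0 ?expR_ge0.
    by rewrite le_eqVlt; apply/orP; left; apply/eqP; ring.
  rewrite -mulr_sumr ler_piMr//; first by rewrite mulr_ge0 ?mulr_ge0 ?powpos_ge0 ?expR_ge0.
  by rewrite (le_trans (sum_inv_sqr n))// gerBl invr_ge0.
Qed.

End mode_series.

(** * The integral representation *)

Section rho_integral.
Context {R : realType} {d : nat}.
Local Notation mu := (@lebesgue_measure R).
Local Notation V := (measurableTypeR R * 'rV[R]_d)%type.
Local Notation L := (@lebesgue_RxRd R d).
Local Notation leb := (@lebesgue_rV R d).
Variables (H : R * 'rV[R]_d -> R) (M : R).
Hypothesis cH : continuous H.
Hypothesis HM : forall z, M < `|z| -> H z = 0.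

Let mH : measurable_fun [set: V] H.
Proof. exact: continuous_measurable_RxRd. Qed.

Let iH : L.-integrable setT (EFin \o H).
Proof. exact: (cs_integrable_RxRd cH HM). Qed.

Let h (x : 'rV[R]_d) : R := \int[mu]_r H (r, x).

Let H0l r x : M < `|x| -> H (r, x) = 0.
Proof. by move=> Mx; apply: HM; rewrite prod_normE/= lt_max Mx orbT. Qed.

Let H0r (r : R) x : M < `|r| -> H (r, x) = 0.
Proof. by move=> Mr; apply: HM; rewrite prod_normE/= lt_max Mr. Qed.

Lemma Rfubini_fin (F : V -> R) : L.-integrable setT (EFin \o F) ->
  (\int[mu]_s \int[leb]_u `|F (s, u)|%:E < +oo)%E.
Proof.
move=> iF; have mF : measurable_fun [set: V] (EFin \o F) by move/integrableP : iF => [].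
exact: (proj1 (@integrable12ltyP _ _ _ _ _ mu leb _ mF) iF).
Qed.

Let intg_interval : mu.-integrable setT (EFin \o (fun r : R => if `|r| <= M then 1 else 0 : R)).
Proof.
rewrite (_ : (fun r => _) = \1_[set r : R | `|r| <= M]); last first.
  by apply/funext => r; rewrite indicE; case: ifPn => rM; [rewrite mem_set|rewrite memNset//; exact/negP].
have -> : [set r : R | `|r| <= M] = `[- M, M]%classic.
  by apply/seteqP; split => r /=; rewrite in_itv/= -ler_norml.
apply: intg_indic; first exact: measurable_itv.
have : (mu `[(- M)%R, M]%classic < +oo)%E.
  by rewrite lebesgue_measure_itv/=; case: ifP => // _; rewrite -EFinD ltry.
by [].
Qed.

Lemma intg_rho_slice x : mu.-integrable setT (EFin \o (fun r => H (r, x))).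
Proof.
have [C C0 hC] := bounded_on_ball_RxRd M cH.
apply: (intg_le measurableT _ _ (intgZl measurableT C intg_interval)).
  exact: (measurableT_comp mH (pair2_measurable x)).
move=> r _; case: ifPn => rM.
  rewrite mulr1; have [|/HM ->] := leP `|(r, x)| M; [exact: hC|by rewrite normr0].
by rewrite H0r ?normr0 ?mulr0// ltNge.
Qed.

(** Supplies the square integrability in [x], at each frequency, that [osc_projE] requires of the
    Fourier transform. *)
Lemma L2_rho_integral : L2 h.
Proof.
have [C C0 hC] := bounded_on_ball_RxRd M cH.
have HC z : `|H z| <= C.
  by have [|/HM ->] := leP `|z| M; [exact: hC|rewrite normr0].
have mh : measurable_fun setT h.
  have mH' : measurable_fun [set: measurableTypeR R * 'rV[R]_d] (fun z => H (z.1, z.2)).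
    by rewrite (_ : (fun z => _) = H)//; apply/funext => -[].
  have := @Rfubini_integrable2 _ _ (measurableTypeR R) _ R mu leb (fun r x => H (r, x)) mH' (Rfubini_fin iH).
  exact: intg_meas.
split => //.
pose K := \int[mu]_r (C * (if `|r| <= M then 1 else 0)).
have ib : mu.-integrable setT (EFin \o (fun r : R => C * (if `|r| <= M then 1 else 0))).
  by apply: intgZl => //; exact: intg_interval.
have hK x : `|h x| <= K.
  have iHx := intg_rho_slice x.
  apply: (le_trans (le_normr_Rintegral _ iHx)) => //.
  apply: le_Rintegral => //; first exact: (intg_abs iHx).
  move=> r _; case: ifPn => rM; first by rewrite mulr1.
  by rewrite H0r ?normr0 ?mulr0// ltNge.
have K0 : 0 <= K by apply: le_trans (hK 0).
apply: (intg_le measurableT _ _ (intgZl measurableT (K ^+ 2) (@integrable_ball_rV R d M))).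
  exact: measurable_funX.
move=> x _; rewrite normrX; case: ifPn => xM.
  by rewrite mulr1 lerXn2r// ?nnegrE.
rewrite mulr0 (_ : h x = 0) ?normr0 ?expr0n// /h.
under eq_Rintegral do rewrite H0l ?ltNge//.
by rewrite /Rintegral integral0.
Qed.

Lemma projR_rho_integral k x : projR k h x = \int[L]_w (Pk k x w.2 * H w).
Proof.
have cG : continuous (fun w : R * 'rV[R]_d => Pk k x w.2 * H w).
  apply: continuousR_mul => //; apply: continuous_snd_comp.
  by have [sP _ _] := eigR_Pk k x; exact: smoothR_cont.
have iG : L.-integrable setT (EFin \o (fun w : V => Pk k x w.2 * H w)).
  by apply: (cs_integrable_RxRd cG (M := M)) => z /HM ->; rewrite mulr0.
have mG : measurable_fun [set: measurableTypeR R * 'rV[R]_d] (fun z => Pk k x z.2 * H (z.1, z.2)).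
  rewrite (_ : (fun z => _) = (fun w => Pk k x w.2 * H w)); last by apply/funext => -[].
  exact: continuous_measurable_RxRd.
have E := @Rintegral_prod2 _ _ (measurableTypeR R) _ R mu leb (fun r y => Pk k x y * H (r, y)) mG (Rfubini_fin iG).
transitivity (\int[L]_w (Pk k x w.2 * H (w.1, w.2))); last by apply: eq_Rintegral => -[].
rewrite /lebesgue_RxRd -E /projR; apply: eq_Rintegral => y _.
by rewrite /h RintegralZl//; exact: intg_rho_slice.
Qed.

End rho_integral.

Section complex_limit.
Context {R : realType}.
Local Notation Re := (@complex.Re R).
Local Notation Im := (@complex.Im R).

Lemma complex_cvg (u : nat -> R[i]^o) (l : R[i]^o) :
  Re (u n) @[n --> \oo] --> Re l -> Im (u n) @[n --> \oo] --> Im l ->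
  u n @[n --> \oo] --> l.
Proof.
(* The norm on [R[i]] takes complex values; positivity of the radius forces its imaginary part to be
   0. *)
move=> ur ui; apply/cvgrPdist_lt => -[e e'] /=; rewrite ltcE /= => /andP[/eqP e'0 e0].
have e20 : 0 < e / 2 by rewrite divr_gt0.
move/cvgrPdist_lt : ur => /(_ _ e20) ur; move/cvgrPdist_lt : ui => /(_ _ e20) ui.
near=> n.
have h1 : `|Re l - Re (u n)| < e / 2 by near: n.
have h2 : `|Im l - Im (u n)| < e / 2 by near: n.
rewrite e'0 (_ : `|l - u n| = (Normc.normc (l - u n))%:C)// ltcE /= eqxx /=.
apply: (le_lt_trans (normc_le _)); rewrite ReBc ImBc.
by rewrite (splitr e) ltrD.
Unshelve. all: by end_near. Qed.

Lemma Re_sum I (s : seq I) (F : I -> R[i]) : Re (\sum_(i <- s) F i) = \sum_(i <- s) Re (F i).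
Proof. by elim/big_rec2 : _ => // i a b _ <-; rewrite ReDc. Qed.

Lemma Im_sum I (s : seq I) (F : I -> R[i]) : Im (\sum_(i <- s) F i) = \sum_(i <- s) Im (F i).
Proof. by elim/big_rec2 : _ => // i a b _ <-; rewrite ImDc. Qed.

End complex_limit.

Section Hpar_Kpar.
Context {R : realType} {d : nat}.
Hypothesis d1 : (1 <= d)%N.
Variables (alpha : R) (alpha0 : 0 < alpha) (f : R * 'rV[R]_d -> R[i]) (tf : test_function f).
Variable z : R * 'rV[R]_d.
Local Notation mu := (@lebesgue_measure R).
Local Notation V := (measurableTypeR R * 'rV[R]_d)%type.
Local Notation L := (@lebesgue_RxRd R d).
Local Notation Re := (@complex.Re R).
Local Notation Im := (@complex.Im R).

Let fr w : R := Re (f w).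
Let fi w : R := Im (f w).

Let supp : exists M : R, forall w, M < `|w| -> f w = 0.
Proof.
have [_ /compact_bounded[M [_ hM]]] := tf.
exists (M + 1) => w Mw; apply/eqP; apply: contraTT Mw => fw; rewrite -leNgt.
by apply: (hM (M + 1)); [rewrite ltrDl|exact: subset_closure].
Qed.

Let tfr : test_fun fr.
Proof.
have [sf _] := tf; have [M hM] := supp.
by split; [move=> n; have [] := sf n|exists M => w /hM; rewrite /fr => ->].
Qed.

Let tfi : test_fun fi.
Proof.
have [sf _] := tf; have [M hM] := supp.
by split; [move=> n; have [] := sf n|exists M => w /hM; rewrite /fi => ->].
Qed.

Let c : R := (Num.sqrt (2 * pi))^-1.

Let cc : c * c = (2 * pi)^-1.
Proof.
by rewrite /c -invfM -expr2 sqr_sqrtr// mulr_ge0// ltW// pi_gt0.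
Qed.

(** One formula for both components of [exp(- i rho tau) f]: the real part is [s = 1] with
    [(Re f, Im f)], the imaginary part [s = -1] with [(Im f, Re f)]. *)
Let Hu0 (s tau : R) (a b : R * 'rV[R]_d -> R) (w : R * 'rV[R]_d) : R :=
  cos (w.1 * tau) * a w + s * sin (w.1 * tau) * b w.

Let Hu s tau a b w := c * Hu0 s tau a b w.

Let cHu0 s tau a b : continuous a -> continuous b -> continuous (Hu0 s tau a b).
Proof.
move=> ca cb.
have clin : continuous (fun r : R => r * tau).
  by apply: continuousR_mul; [move=> ?; exact: cvg_id|exact: continuousR_cst].
have c1 : continuous (fun r : R => cos (r * tau)).
  by move=> r; exact: (continuous_comp (clin r) (@continuous_cos R _)).
have c2 : continuous (fun r : R => sin (r * tau)).
  by move=> r; exact: (continuous_comp (clin r) (@continuous_sin R _)).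
apply: continuousR_add; apply: continuousR_mul => //; first exact: (continuous_fst_comp c1).
by apply: continuousR_mul; [exact: continuousR_cst|exact: (continuous_fst_comp c2)].
Qed.

Let cHu s tau a b : continuous a -> continuous b -> continuous (Hu s tau a b).
Proof. by move=> ca cb; apply: continuousR_mul; [exact: continuousR_cst|exact: cHu0]. Qed.

Let cfr : continuous fr. Proof. by case: tfr => s _; exact: smoothR_cont. Qed.
Let cfi : continuous fi. Proof. by case: tfi => s _; exact: smoothR_cont. Qed.

Let mulrcE (a : R) (w : R[i]) : a%:C * w = (a * Re w) +i* (a * Im w).
Proof. by apply/eqP; rewrite eq_complex /=; apply/andP; split; apply/eqP; case: w => x y /=; ring. Qed.

Let fourierE tau x : fourier_rho f tau x =
  (\int[mu]_r Hu 1 tau fr fi (r, x)) +i* (\int[mu]_r Hu (-1) tau fi fr (r, x)).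
Proof.
have [M hM] := supp.
have H0 s (a b : R * 'rV[R]_d -> R) : (forall w, M < `|w| -> a w = 0) -> (forall w, M < `|w| -> b w = 0) ->
    forall w, M < `|w| -> Hu0 s tau a b w = 0.
  by move=> aM bM w Mw; rewrite /Hu0 aM// bM// !mulr0 addr0.
have frM w : M < `|w| -> fr w = 0 by move=> /hM; rewrite /fr => ->.
have fiM w : M < `|w| -> fi w = 0 by move=> /hM; rewrite /fi => ->.
have i1 := intg_rho_slice (@cHu0 1 tau _ _ cfr cfi) (H0 _ _ _ frM fiM) x.
have i2 := intg_rho_slice (@cHu0 (-1) tau _ _ cfi cfr) (H0 _ _ _ fiM frM) x.
rewrite /fourier_rho mulrcE -/c /cintegral; congr (_ +i* _).
  transitivity (c * \int[mu]_r Hu0 1 tau fr fi (r, x)); last by rewrite -RintegralZl.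
  congr (c * _); apply: eq_Rintegral => r _.
  by rewrite cReM /expi /= cosN sinN /Hu0 /= /fr /fi; ring.
transitivity (c * \int[mu]_r Hu0 (-1) tau fi fr (r, x)); last by rewrite -RintegralZl.
congr (c * _); apply: eq_Rintegral => r _.
by rewrite cImM /expi /= cosN sinN /Hu0 /= /fr /fi; ring.
Qed.

Let Ac tau k (a : V -> R) := \int[L]_w (cos (w.1 * tau) * (Pk k z.2 w.2 * a w)).
Let As tau k (a : V -> R) := \int[L]_w (sin (w.1 * tau) * (Pk k z.2 w.2 * a w)).

Let mtrig (t : R -> R) tau : continuous t -> measurable_fun [set: V] (fun w => t (w.1 * tau)).
Proof.
move=> ct; apply: (measurableT_comp (continuous_measurable_fun ct)).
by apply: measurable_funM => //; exact: measurable_fst.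
Qed.

Let iAc tau k a : test_fun a -> L.-integrable setT (EFin \o (fun w : V => cos (w.1 * tau) * (Pk k z.2 w.2 * a w))).
Proof.
move=> ta; have iG := intg_mode ta z k.
apply: (intg_le measurableT _ _ (intg_abs iG)).
  by apply: measurable_funM; [exact: (mtrig tau (@continuous_cos R))|exact: (intg_meas iG)].
by move=> w _; rewrite normrM ler_piMl// ler_norml cos_geN1 cos_le1.
Qed.

Let iAs tau k a : test_fun a -> L.-integrable setT (EFin \o (fun w : V => sin (w.1 * tau) * (Pk k z.2 w.2 * a w))).
Proof.
move=> ta; have iG := intg_mode ta z k.
apply: (intg_le measurableT _ _ (intg_abs iG)).
  by apply: measurable_funM; [exact: (mtrig tau (@continuous_sin R))|exact: (intg_meas iG)].
by move=> w _; rewrite normrM ler_piMl// ler_norml sin_geN1 sin_le1.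
Qed.

Let wvc tau k (a : V -> R) := wave z.1 (fun w => Pk k z.2 w.2 * a w) 0 tau.
Let wvs tau k (a : V -> R) := wave z.1 (fun w => Pk k z.2 w.2 * a w) (- (pi / 2)) tau.

Let wvcE tau k a : test_fun a -> wvc tau k a =
  cos (z.1 * tau) * Ac tau k a + sin (z.1 * tau) * As tau k a.
Proof.
move=> ta; rewrite /wvc /wave -Rintegral_lin; [|exact: iAc|exact: iAs].
by apply: eq_Rintegral => w _; rewrite addr0 mulrBl cosB; ring.
Qed.

Let wvsE tau k a : test_fun a -> wvs tau k a =
  sin (z.1 * tau) * Ac tau k a + - cos (z.1 * tau) * As tau k a.
Proof.
move=> ta; rewrite /wvs /wave -Rintegral_lin; [|exact: iAc|exact: iAs].
apply: eq_Rintegral => w _.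
have E (x : R) : cos (x - pi / 2) = sin x.
  by rewrite cosB cos_pihalf sin_pihalf mulr0 mulr1 add0r.
by rewrite E mulrBl sinB; ring.
Qed.

Let PRHu s tau k a b : test_fun a -> test_fun b ->
  L2 (fun x => \int[mu]_r Hu s tau a b (r, x)) /\
  projR k (fun x => \int[mu]_r Hu s tau a b (r, x)) z.2 = c * (Ac tau k a + s * As tau k b).
Proof.
move=> ta tb; have [sa [M aM]] := ta; have [sb [N bN]] := tb.
have cH := @cHu s tau _ _ (smoothR_cont sa) (smoothR_cont sb).
have HM w : Num.max M N < `|w| -> Hu s tau a b w = 0.
  by rewrite gt_max => /andP[Mw Nw]; rewrite /Hu /Hu0 aM// bN// !mulr0 addr0 mulr0.
split; first exact: (L2_rho_integral cH HM).
rewrite (projR_rho_integral cH HM).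
transitivity (\int[L]_w (c * (cos (w.1 * tau) * (Pk k z.2 w.2 * a w)) +
    (c * s) * (sin (w.1 * tau) * (Pk k z.2 w.2 * b w)))).
  by apply: eq_Rintegral => w _; rewrite /Hu /Hu0; ring.
rewrite Rintegral_lin; [|exact: iAc|exact: iAs].
by rewrite mulrDr mulrA.
Qed.

Let pwr k tau : R := (tau ^+ 2 + (2 * k + d)%:R) `^ (- alpha).

(** Multiplying by [exp(i rho tau)] recombines, by the addition formulas, into waves in
    [rho - rho']. Each part of [f] contributes a cosine wave to its own component and a sine wave to
    the other. *)
Let Hpar_integrandE k tau : Hpar_integrand (- alpha) f z k tau =
  (c * (pwr k tau * wvc tau k fr - pwr k tau * wvs tau k fi)) +i*
  (c * (pwr k tau * wvc tau k fi + pwr k tau * wvs tau k fr)).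
Proof.
have [L1 P1] := PRHu 1 tau k tfr tfi; have [L2_ P2] := PRHu (-1) tau k tfi tfr.
have FE : fourier_rho f tau = fun x => (\int[mu]_r Hu 1 tau fr fi (r, x)) +i* (\int[mu]_r Hu (-1) tau fi fr (r, x)).
  by apply/funext => x; exact: fourierE.
have -> : Hpar_integrand (- alpha) f z k tau = expi (z.1 * tau) * (pwr k tau)%:C *
    ((c * (Ac tau k fr + 1 * As tau k fi)) +i* (c * (Ac tau k fi + -1 * As tau k fr))).
  rewrite /Hpar_integrand -/(pwr k tau) FE osc_projE//.
  by rewrite -P1 -P2.
rewrite !wvcE// !wvsE//.
move: (Ac _ _ _) (As _ _ _) (Ac _ _ _) (As _ _ _) (pwr _ _) => A B A' B' P.
rewrite /expi; apply/eqP; rewrite eq_complex /=; apply/andP; split; apply/eqP; ring.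
Qed.

Let lam1 k : (1 : R) <= (2 * k + d)%:R.
Proof. by rewrite ler1n addn_gt0 d1 orbT. Qed.

Let mode_facts k a : test_fun a ->
  [/\ mu.-integrable setT (EFin \o (fun tau => pwr k tau * wvc tau k a)),
      mu.-integrable setT (EFin \o (fun tau => pwr k tau * wvs tau k a)) &
      \int[mu]_tau (pwr k tau * wvs tau k a) = 0].
Proof.
move=> ta; have [B B0 hB] := wave_bound d1 ta.
have iG := intg_mode ta z k.
split.
- exact: (intg_pow_wave iG (hB z.1 z.2 k) alpha0 (lam1 k)).
- exact: (intg_pow_wave iG (hB z.1 z.2 k) alpha0 (lam1 k)).
- exact: (integral_pow_wave_sin z.1 iG).
Qed.

Let cint k : cintegrable mu (Hpar_integrand (- alpha) f z k).
Proof.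
have [r1 r2 _] := mode_facts k tfr; have [i1 i2 _] := mode_facts k tfi.
split; under eq_fun do rewrite Hpar_integrandE /=.
- by apply: intgZl => //; exact: intgB.
- by apply: intgZl => //; exact: intgD.
Qed.

(** The sine waves are odd in [tau] and drop out; the factors [c] of the Fourier transform and of
    its inverse give [1/(2 pi)]. *)
Let termE k : Hpar_term (- alpha) f z k =
  ((2 * pi)^-1 * \int[mu]_tau (pwr k tau * wvc tau k fr)) +i*
  ((2 * pi)^-1 * \int[mu]_tau (pwr k tau * wvc tau k fi)).
Proof.
have [r1 r2 r3] := mode_facts k tfr; have [i1 i2 i3] := mode_facts k tfi.
rewrite /Hpar_term mulrcE -/c /cintegral -cc; congr (_ +i* _); rewrite -mulrA.
  congr (c * _); rewrite -[in RHS](subr0 (\int[mu]_tau _)) -[in RHS]i3 -RintegralB// -RintegralZl//; last exact: intgB.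
  by apply: eq_Rintegral => tau _; rewrite Hpar_integrandE.
congr (c * _); rewrite -[in RHS](addr0 (\int[mu]_tau _)) -[in RHS]r3 -RintegralD// -RintegralZl//; last exact: intgD.
by apply: eq_Rintegral => tau _; rewrite Hpar_integrandE.
Qed.

Let Kpar_opE : Kpar_op alpha f z =
  (\int[L]_w (fine (Kpar alpha z w) * fr w)) +i* (\int[L]_w (fine (Kpar alpha z w) * fi w)).
Proof. exact: (schur_opE L (Kpar alpha) f z). Qed.

Let series_cvg : series (Hpar_term (- alpha) f z) @ \oo --> (Kpar_op alpha f z : R[i]^o).
Proof.
rewrite Kpar_opE; apply: complex_cvg => /=.
- rewrite (_ : (fun n => _) = (fun n => \sum_(k < n) ((2 * pi)^-1 * \int[mu]_tau (pwr k tau * wvc tau k fr)))).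
    exact: (mode_series d1 alpha0 tfr).
  apply/funext => n; rewrite /series /= big_mkord Re_sum; apply: eq_bigr => k _.
  by rewrite termE.
- rewrite (_ : (fun n => _) = (fun n => \sum_(k < n) ((2 * pi)^-1 * \int[mu]_tau (pwr k tau * wvc tau k fi)))).
    exact: (mode_series d1 alpha0 tfi).
  apply/funext => n; rewrite /series /= big_mkord Im_sum; apply: eq_bigr => k _.
  by rewrite termE.
Qed.

Lemma Hpar_converges_test : Hpar_converges (- alpha) f z.
Proof. by split; [exact: cint|apply/cvg_ex; exists (Kpar_op alpha f z); exact: series_cvg]. Qed.

Lemma HparE : Hpar (- alpha) f z = Kpar_op alpha f z.
Proof. by apply: (cvg_lim _ series_cvg); exact: norm_hausdorff. Qed.

Lemma Kpar_integrable_test : Kpar_integrable alpha f z.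
Proof.
have [M M0 hM] := test_bounded tfr; have [N N0 hN] := test_bounded tfi.
have mK : measurable_fun setT (Kpar alpha z) by exact: (measurableT_comp (@measurable_Kpar R d alpha) (pair1_measurable z)).
have iK : L.-integrable setT (Kpar alpha z).
  apply/integrableP; split => //.
  under eq_integral do rewrite (gee0_abs (Kpar_ge0 alpha0 _ _)).
  by apply: (le_lt_trans (Kpar_row d1 alpha0 z)); rewrite ltry.
have := integrableZl measurableT (M + N) iK.
apply: le_integrable => //.
  apply: emeasurable_funM => //; apply/measurable_EFinP; apply: measurable_normc.
    exact: (continuous_measurable_RxRd cfr).
  exact: (continuous_measurable_RxRd cfi).
move=> w _; have k0 := Kpar_ge0 alpha0 z w.
have n0 : (0 <= (Normc.normc (f w))%:E)%E by rewrite lee_fin normc_ge0.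
have mn0 : (0 <= (M + N)%:E)%E by rewrite lee_fin addr_ge0.
rewrite (gee0_abs (mule_ge0 k0 n0)) (gee0_abs (mule_ge0 mn0 k0)) muleC lee_wpmul2r// lee_fin.
by apply: (le_trans (normc_le _)); apply: lerD; [exact: hM|exact: hN].
Qed.

End Hpar_Kpar.

Lemma ae_weaken d1 (T : measurableType d1) (R : realType) (m : {measure set T -> \bar R})
    (P Q : T -> Prop) : (forall x, P x -> Q x) -> {ae m, forall x, P x} -> {ae m, forall x, Q x}.
Proof. by move=> PQ; exact: filterS. Qed.

Theorem proposition3p2 (R : realType) (d : nat) (hd : (1 <= d)%N)
    (alpha : R) (halpha : 0 < alpha) :
  [/\ forall f : R * 'rV[R]_d -> R[i], test_function f ->
        forall z : R * 'rV[R]_d,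
          [/\ Hpar_converges (- alpha) f z,
              Kpar_integrable alpha f z &
              Hpar (- alpha) f z = Kpar_op alpha f z],
      exists (Psi : R * 'rV[R]_d -> \bar R) (C : R),
        [/\ (lebesgue_RxRd d).-integrable setT Psi,
            0 < C &
            forall z z' : R * 'rV[R]_d,
              (Kpar alpha z z' <= C%:E * Psi (z - z')%R)%E] &
      exists A : (R * 'rV[R]_d -> R[i]) -> (R * 'rV[R]_d -> R[i]),
        (forall f, test_function f ->
           forall z, A f z = Hpar (- alpha) f z) /\
        forall p : \bar R, (1 <= p)%E ->
          (forall f, inLp (lebesgue_RxRd d) p f ->
             {ae lebesgue_RxRd d, forall z,
               Kpar_integrable alpha f z /\ A f z = Kpar_op alpha f z}) /\
          bounded_linear_on_Lp (lebesgue_RxRd d) p A].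
Proof.
split.
- move=> f tf z; split; [exact: Hpar_converges_test|exact: Kpar_integrable_test|exact: HparE].
- exists (Psi (d := d) alpha), (Gamma alpha)^-1; split.
  + exact: integrable_Psi.
  + by rewrite invr_gt0 Gamma_gt0.
  + by move=> z z'; exact: Kpar_le.
(* The kernel operator itself is the extension: it makes sense on every [L^p] and agrees with the
   spectral operator on test functions. *)
- exists (Kpar_op alpha); split; first by move=> f tf z; rewrite HparE.
  move=> p p1; split; last exact: Kpar_bounded.
  by move=> f fp; apply: ae_weaken (Kpar_ae_integrable hd halpha p1 fp) => z.
Qed.
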